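(* Let $n\ge2$. There exist a real vector-valued $a\in L^\infty_{loc}(\mathbb{R}^n)$ and a real-valued $V\in L^1_{loc}(\mathbb{R}^n)$ with $V\ge0$ such that the operator $H_{a,V}$ has a discrete spectrum and the following property holds. Let $f:[0,+\infty)\to(0,1)$ be any decreasing function such that $$f(t)=(1+t)^{\frac{2-n}{2}}h(t)\ \text{ if } n\ge3,\qquad f(t)=(1+\log(1+t))^{-1}h(t)\ \text{ if } n=2,$$ where $h(t)\to+\infty$ as $t\to+\infty$. Then, for every fixed $d>0$, with $\gamma=f(\mu_0(Q_d)d^2)$, the condition $$\mu_0(Q_d)+d^{-n}M_\gamma(Q_d;V)\to+\infty\quad\text{as } Q_d\to\infty$$ is not satisfied. Consequently, for $f$ of this form, and for any $g\in\mathcal{G}$ and any constant $c_n>0$, the condition displayed above with $\gamma=c_nf(\mu_0(Q_d)d^2)g(d)^{-1}d^2$ (required for all sufficiently small $d>0$) is not necessary for the discreteness of the spectrum.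
   Context: $H_{a,V}=\sum_{j=1}^n\left(\frac1i\frac{\partial}{\partial x^j}+a_j\right)^2+V$ is the magnetic Schrödinger operator in $L^2(\mathbb{R}^n)$, defined as the self-adjoint operator associated with the closure of the quadratic form $h_{a,V}(u,u)=\int_{\mathbb{R}^n}(|\nabla_a u|^2+V|u|^2)\,dx$, $u\in C_c^\infty(\mathbb{R}^n)$, where $\nabla_a u=\nabla u+iau$. Its spectrum is called discrete if it consists of isolated eigenvalues of finite multiplicity (equivalently, $H_{a,V}$ has compact resolvent). $Q_d\subset\mathbb{R}^n$ denotes a closed cube with edge length $d>0$ and edges parallel to the coordinate axes, $\overset{\circ}{Q}_d$ its interior. ''$Q_d\to\infty$'' means that the center of the cube goes to infinity with $d$ fixed. Local energy of the magnetic field: $\mu_0(Q_d)=\inf_u \frac{\int_{Q_d}|\nabla_a u|^2dx}{\int_{Q_d}|u|^2dx}$, infimum over nonzero $u\in C^\infty(\overset{\circ}{Q}_d)\cap L^2(\overset{\circ}{Q}_d)$. Capacity: for an open set $\Omega$ and compact $F\subset\Omega$, $\mathrm{cap}_\Omega(F)=\inf\{\int|\nabla u|^2dx : u \text{ Lipschitz with compact support in }\Omega,\ u|_F=1\}$. For compact $F\subset Q_d$, $\mathrm{cap}(F)=\mathrm{cap}_{\mathbb{R}^n}(F)$ if $n\ge3$, and $\mathrm{cap}(F)=\mathrm{cap}_{\overset{\circ}{Q}_{2d}}(F)$ if $n=2$, where $Q_{2d}$ has the same center as $Q_d$. Molchanov functional: $M_\gamma(Q_d;V)=\inf_F\left\{\int_{Q_d\setminus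 F}V\,dx : F\subset Q_d \text{ compact},\ \mathrm{cap}(F)\le\gamma\,\mathrm{cap}(Q_d)\right\}$. Class $\mathcal{G}$: functions $g:(0,d_0)\to(0,+\infty)$, for some $d_0>0$, with $g(\tau)\to0$ as $\tau\to0$ and $g(d)^{-1}d^2\le1$ for all $d\in(0,d_0)$. *)

(* Defs.v *)
From HB Require Import structures.
From mathcomp Require Import all_boot all_order all_algebra.
From mathcomp Require Import all_classical all_reals all_analysis.
From mathcomp Require Export complex.

Set Implicit Arguments.
Unset Strict Implicit.
Unset Printing Implicit Defensive.

Import Order.TTheory GRing.Theory Num.Theory.
Import numFieldNormedType.Exports.

Local Open Scope classical_set_scope.
Local Open Scope ring_scope.

Section rV_measurable.
Context {R : realType} (n : nat).

Let coord (i : 'I_n) (v : 'rV[R]_n) : measurableTypeR R := v 0 i.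

Let rV_set0 : g_sigma_preimage coord set0.
Proof. exact: sigma_algebra0. Qed.

Let rV_setC A : g_sigma_preimage coord A -> g_sigma_preimage coord (~` A).
Proof. exact: sigma_algebraC. Qed.

Let rV_bigcup (F : (set 'rV[R]_n)^nat) :
  (forall i, g_sigma_preimage coord (F i)) ->
  g_sigma_preimage coord (\bigcup_i (F i)).
Proof. exact: sigma_algebra_bigcup. Qed.

HB.instance Definition _ :=
  @isMeasurable.Build (measure_tuple_display default_measure_display)
    'rV[R]_n (g_sigma_preimage coord) rV_set0 rV_setC rV_bigcup.

Lemma measurable_rV_coord (i : 'I_n) :
  measurable_fun setT (fun v : 'rV[R]_n => v 0 i : measurableTypeR R).
Proof.
move=> _ Y mY; rewrite setTI; apply: sub_sigma_algebra => /=.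
rewrite -bigcup_seq/=; exists i => /=; first by rewrite mem_index_enum.
by exists Y => //; rewrite setTI.
Qed.

Lemma measurable_fun_rVP d (T : measurableType d) (f : T -> 'rV[R]_n) :
  (forall i, measurable_fun setT (fun t => f t 0 i : measurableTypeR R)) ->
  measurable_fun setT f.
Proof.
move=> mf.
have fS : g_sigma_preimage (fun i => coord i \o f) `<=` measurable.
  apply: smallest_sub; first exact: sigma_algebra_measurable.
  apply: (big_ind (fun X : set (set T) => X `<=` measurable)) => //.
    by move=> A B mA mB C [/mA|/mB].
  by move=> i _ A [B mB <-]; exact: mf.
move: fS; rewrite g_sigma_preimage_comp => fS _ A mA.
by apply: fS; exists A.
Qed.

End rV_measurable.

Section lebesgue_rV.
Context {R : realType}.

Definition rV_cons n (p : measurableTypeR R * 'rV[R]_n) : 'rV[R]_n.+1 :=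
  row_mx (const_mx p.1 : 'rV[R]_1) p.2.

Definition rV_uncons n (v : 'rV[R]_n.+1) : measurableTypeR R * 'rV[R]_n :=
  (v 0 0, \row_i v 0 (lift 0 i)).

Lemma rV_cons0 n p : @rV_cons n p 0 0 = p.1.
Proof.
rewrite /rV_cons mxE; case: (splitP (0 : 'I_(1 + n))) => [j _|//].
by rewrite mxE.
Qed.

Lemma rV_consS n p i : @rV_cons n p 0 (lift 0 i) = p.2 0 i.
Proof.
rewrite /rV_cons mxE; case: (splitP (lift 0 i : 'I_(1 + n))) => j /=.
  by rewrite ord1.
by rewrite /bump leq0n => /addnI/val_inj ->.
Qed.

Lemma rV_consK n : cancel (@rV_cons n) (@rV_uncons n).
Proof.
move=> [x v]; rewrite /rV_uncons rV_cons0; congr pair.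
by apply/rowP => i; rewrite mxE rV_consS.
Qed.

Lemma measurable_rV_cons n : measurable_fun setT (@rV_cons n).
Proof.
apply: measurable_fun_rVP => i; case: (unliftP 0 i) => [j|] ->.
  rewrite (_ : (fun _ => _) =
      (fun v : 'rV[R]_n => v 0 j : measurableTypeR R) \o snd); last first.
    by apply/funext => p /=; rewrite rV_consS.
  by apply: measurableT_comp => //; exact: measurable_rV_coord.
rewrite (_ : (fun _ => _) = fst); first exact: measurable_fst.
by apply/funext => p; rewrite rV_cons0.
Qed.

Lemma measurable_rV_uncons n : measurable_fun setT (@rV_uncons n).
Proof.
apply/measurable_fun_pairP; split; first exact: measurable_rV_coord.
apply: measurable_fun_rVP => i; rewrite (_ : (fun _ => _) =
  (fun v : 'rV[R]_n.+1 => v 0 (lift 0 i) : measurableTypeR R)).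
  exact: measurable_rV_coord.
by apply/funext => v /=; rewrite mxE.
Qed.

Definition rV_measureS n (m : {sigma_finite_measure set 'rV[R]_n -> \bar R}) :
    set 'rV[R]_n.+1 -> \bar R :=
  pushforward (lebesgue_measure \x m)%E (@rV_cons n).

Section rV_measureS.
Local Open Scope ereal_scope.
Variables (n : nat) (m : {sigma_finite_measure set 'rV[R]_n -> \bar R}).

Let measurable_preimage (f : measurableTypeR R * 'rV[R]_n -> 'rV[R]_n.+1) A :
  measurable_fun setT f -> measurable A -> measurable (f @^-1` A).
Proof. by move=> mf mA; rewrite -[X in measurable X]setTI; exact: mf. Qed.

Let rV_measureS0 : rV_measureS m set0 = 0.
Proof. by rewrite /rV_measureS /pushforward preimage_set0 measure0. Qed.

Let rV_measureS_ge0 A : 0 <= rV_measureS m A.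
Proof. by rewrite /rV_measureS /pushforward. Qed.

Let rV_measureS_sigma_additive : semi_sigma_additive (rV_measureS m).
Proof.
move=> F mF tF mUF; rewrite /rV_measureS /pushforward preimage_bigcup.
apply: measure_semi_sigma_additive.
- by move=> k; exact: (measurable_preimage (@measurable_rV_cons n)).
- apply/trivIsetP => /= i j _ _ ij; rewrite -preimage_setI.
  by move/trivIsetP : tF => /(_ _ _ _ _ ij) ->//; rewrite preimage_set0.
- rewrite -preimage_bigcup.
  exact: (measurable_preimage (@measurable_rV_cons n)).
Qed.

HB.instance Definition _ := isMeasure.Build _ _ _ (rV_measureS m)
  rV_measureS0 rV_measureS_ge0 rV_measureS_sigma_additive.

Let rV_measureS_sigma_finite : sigma_finite setT (rV_measureS m).
Proof.
have /sigma_finiteP[F [TF ndF Foo]] := sigma_finiteT (@lebesgue_measure R).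
have /sigma_finiteP[G [TG ndG Goo]] := sigma_finiteT m.
exists (fun k => @rV_uncons n @^-1` (F k `*` G k)).
  apply/esym; rewrite -subTset => v _.
  have [i _ Fi] : (\bigcup_i F i) (rV_uncons v).1 by rewrite -TF.
  have [j _ Gj] : (\bigcup_j G j) (rV_uncons v).2 by rewrite -TG.
  exists (maxn i j) => //; split.
    by move: Fi; exact/subsetPset/ndF/leq_maxl.
  by move: Gj; exact/subsetPset/ndG/leq_maxr.
move=> k; have [mF Fk] := Foo k; have [mG Gk] := Goo k; split.
  rewrite -[X in measurable X]setTI; apply: measurable_rV_uncons => //.
  exact: measurableX.
rewrite /rV_measureS /pushforward -comp_preimage.
rewrite (_ : _ \o _ = id) ?preimage_id; last first.
  by apply/funext => p /=; rewrite rV_consK.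
by rewrite product_measure1E// lte_mul_pinfty// ge0_fin_numE.
Qed.

HB.instance Definition _ := Measure_isSigmaFinite.Build _ _ _ (rV_measureS m)
  rV_measureS_sigma_finite.

End rV_measureS.

(* Lebesgue measure on R^n, as the n-fold product of the Lebesgue measure on R;
   on R^0 it is the unit mass. *)
Fixpoint lebesgue_rV (n : nat) :
    {sigma_finite_measure set 'rV[R]_n -> \bar R} :=
  if n is n'.+1 then rV_measureS (lebesgue_rV n') else dirac (0 : 'rV[R]_0).

End lebesgue_rV.

Section calculus.
Context {R : realType} {n : nat}.
Implicit Types (f : 'rV[R]_n -> R) (u v : 'rV[R]_n -> R[i]) (U : set 'rV[R]_n).

Definition pd (j : 'I_n) f : 'rV[R]_n -> R := fun x => 'D_(delta_mx 0 j) f x.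

(* For U open: partial derivatives of all orders exist and are continuous on U *)
Definition smooth_on U f : Prop :=
  forall (s : seq 'I_n) x, U x ->
    {for x, continuous (foldr pd f s)} /\
    forall j, derivable (foldr pd f s) x (delta_mx 0 j).

Definition re_fun u : 'rV[R]_n -> R := fun x => complex.Re (u x).
Definition im_fun u : 'rV[R]_n -> R := fun x => complex.Im (u x).

Definition csmooth_on U u : Prop :=
  smooth_on U (re_fun u) /\ smooth_on U (im_fun u).

Definition cpd (j : 'I_n) u : 'rV[R]_n -> R[i] :=
  fun x => (pd j (re_fun u) x +i* pd j (im_fun u) x)%C.

Definition support_of (T : nmodType) (u : 'rV[R]_n -> T) : set 'rV[R]_n :=
  closure [set x | u x != 0].

Definition test_fun u : Prop := csmooth_on setT u /\ compact (support_of u).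

End calculus.

Section L2.
Context {R : realType} {n : nat}.
Implicit Types (u v : 'rV[R]_n -> R[i]) (U : set 'rV[R]_n).

Definition sqmod (z : R[i]) : R := complex.Re z ^+ 2 + complex.Im z ^+ 2.

Definition sqnorm_on U u : \bar R :=
  (\int[lebesgue_rV n]_(x in U) (sqmod (u x))%:E)%E.

Definition L2_on U u : Prop :=
  [/\ measurable_fun U (re_fun u), measurable_fun U (im_fun u)
    & (sqnorm_on U u < +oo)%E].

Definition cintegral u : R[i] :=
  ((\int[lebesgue_rV n]_x re_fun u x)%R +i*
   (\int[lebesgue_rV n]_x im_fun u x)%R)%C.

Definition inner u v : R[i] := cintegral (fun x => u x * conjc (v x)).

Definition ccvg (z_ : nat -> R[i]) (z : R[i]) : Prop :=
  complex.Re (z_ k) @[k --> \oo] --> complex.Re z /\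
  complex.Im (z_ k) @[k --> \oo] --> complex.Im z.

End L2.

Section operator.
Context {R : realType} {n : nat}.
Variables (a : 'rV[R]_n -> 'rV[R]_n) (V : 'rV[R]_n -> R).
Implicit Types (u v g : 'rV[R]_n -> R[i]).

Definition mgrad (j : 'I_n) u : 'rV[R]_n -> R[i] :=
  fun x => cpd j u x + 'i%C * (a x 0 j)%:C%C * u x.

Definition hform u v : R[i] :=
  cintegral (fun x => \sum_(j < n) mgrad j u x * conjc (mgrad j v x)
                      + (V x)%:C%C * (u x * conjc (v x))).

(* V is only supposed locally integrable, so the form is first defined on
   C_c^oo and then closed: u_ is a sequence in C_c^oo, Cauchy for the form, with limit u in L^2 *)
Definition form_approx u (u_ : nat -> 'rV[R]_n -> R[i]) : Prop :=
  [/\ forall k, test_fun (u_ k),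
      L2_on setT u,
      sqnorm_on setT (u_ k \- u) @[k --> \oo] --> 0%E
    & forall e : R, 0 < e -> exists N, forall k l, (N <= k)%N -> (N <= l)%N ->
        complex.Re (hform (u_ k \- u_ l) (u_ k \- u_ l)) < e].

Definition form_domain u : Prop := exists u_ : nat -> _, form_approx u u_.

(* The closed form takes the value z at (u, v). *)
Definition form_closure u v (z : R[i]) : Prop :=
  exists (u_ v_ : nat -> _), [/\ form_approx u u_, form_approx v v_
                  & ccvg (fun k => hform (u_ k) (v_ k)) z].

(* The graph of the self-adjoint operator associated with the closed form: u is
   in its domain and H u = f (functions being considered up to a.e. equality). *)
Definition magnetic_schrodinger u f : Prop :=
  [/\ form_domain u, L2_on setT f
    & forall v, form_domain v -> form_closure u v (inner f v)].

(* H - l is a bijection from its domain onto L^2 with bounded inverse; the first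
   conjunct also gives injectivity. *)
Definition resolvent_set (l : R[i]) : Prop :=
  (exists C : R, forall u g, L2_on setT g ->
     magnetic_schrodinger u (fun x => l * u x + g x) ->
     (sqnorm_on setT u <= C%:E * sqnorm_on setT g)%E) /\
  (forall g, L2_on setT g ->
     exists u, magnetic_schrodinger u (fun x => l * u x + g x)).

Definition spectrum : set R[i] := [set l | ~ resolvent_set l].

Definition eigenvector (l : R[i]) u : Prop :=
  magnetic_schrodinger u (fun x => l * u x) /\ (0 < sqnorm_on setT u)%E.

Definition finite_multiplicity (l : R[i]) : Prop :=
  exists (m : nat) (e : 'I_m -> 'rV[R]_n -> R[i]), forall u, eigenvector l u ->
    exists c : 'I_m -> R[i],
      {ae lebesgue_rV n, forall x, u x = \sum_(k < m) c k * e k x}.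

Definition discrete_spectrum : Prop :=
  forall l, spectrum l ->
    [/\ exists2 e : R, 0 < e &
          forall l', spectrum l' -> sqmod (l' - l) < e ^+ 2 -> l' = l,
        exists u, eigenvector l u
      & finite_multiplicity l].

End operator.

Section criterion.
Context {R : realType} {n : nat}.
Implicit Types (a : 'rV[R]_n -> 'rV[R]_n) (V : 'rV[R]_n -> R).
Implicit Types (c : 'rV[R]_n) (d : R) (F Omega : set 'rV[R]_n).

Definition Linfty_loc a : Prop :=
  (forall j, measurable_fun setT (fun x => a x 0 j)) /\
  (forall K, compact K -> exists M : R,
     {ae lebesgue_rV n, forall x, K x -> `|a x| <= M}).

Definition L1_loc V : Prop :=
  measurable_fun setT V /\
  (forall K, compact K -> (lebesgue_rV n).-integrable K (EFin \o V)).

Definition admissible a V : Prop :=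
  [/\ Linfty_loc a, L1_loc V & forall x, 0 <= V x].

(* The closed cube with center c and edge length d *)
Definition cube c d : set 'rV[R]_n :=
  [set x | forall i, `|x 0 i - c 0 i| <= d / 2].

(* The numerator may be +oo; the denominator is finite and positive. *)
Definition local_energy a c d : \bar R :=
  ereal_inf
    [set ((\int[lebesgue_rV n]_(x in (cube c d)°)
             (\sum_(j < n) sqmod (mgrad a j u x))%:E)
          * ((fine (sqnorm_on (cube c d)° u))^-1)%:E)%E
      | u in [set u : 'rV[R]_n -> R[i] |
          [/\ csmooth_on (cube c d)° u, L2_on (cube c d)° u
            & exists2 x, (cube c d)° x & u x != 0]]].

(* Lipschitz functions have partial derivatives almost everywhere; where a
   derivative does not exist, 'D takes the junk value 0, on a null set. *)
Definition capacity Omega F : \bar R :=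
  ereal_inf
    [set (\int[lebesgue_rV n]_x (\sum_(j < n) pd j u x ^+ 2)%:E)%E
      | u in [set u : 'rV[R]_n -> R |
          [/\ exists k : R, k.-lipschitz u, compact (support_of u),
              support_of u `<=` Omega & forall x, F x -> u x = 1]]].

Definition cap_in_cube c d F : \bar R :=
  if n == 2%N then capacity (cube c (2 * d))° F else capacity setT F.

Definition molchanov (gamma : R) c d V : \bar R :=
  ereal_inf
    [set (\int[lebesgue_rV n]_(x in cube c d `\` F) (V x)%:E)%E
      | F in [set F | [/\ compact F, F `<=` cube c d
          & (cap_in_cube c d F <= gamma%:E * cap_in_cube c d (cube c d))%E]]].

(* mu_0(Q_d) + d^-n M_gamma(Q_d; V) --> +oo as Q_d --> oo (d fixed), where
   gamma = G (mu_0(Q_d) d^2). The norm of 'rV is the maximum norm. *)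
Definition energy_condition a V (G : R -> R) d : Prop :=
  forall A : R, \forall r \near +oo, forall c, r <= `|c| ->
    (A%:E <= local_energy a c d + (d ^- n)%:E *
       molchanov (G (fine (local_energy a c d) * d ^+ 2)%R) c d V)%E.

End criterion.

Section function_classes.
Context {R : realType}.

Definition profile (n : nat) (t : R) : R :=
  if n == 2%N then (1 + ln (1 + t))^-1 else (1 + t) `^ ((2 - n%:R) / 2).

(* f and h are functions on [0, +oo): their values at negative reals are
   irrelevant, as are those of g in classG outside ]0, d0[. "Decreasing" is
   understood in the weak sense. *)
Definition slow_fun (n : nat) (f : R -> R) : Prop :=
  [/\ forall t, 0 <= t -> 0 < f t < 1,
      forall s t, 0 <= s -> s <= t -> f t <= f s
    & exists2 h : R -> R, h t @[t --> +oo] --> +oo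
        & forall t, 0 <= t -> f t = profile n t * h t].

Definition classG (d0 : R) (g : R -> R) : Prop :=
  [/\ 0 < d0, forall t, 0 < t < d0 -> 0 < g t, g t @[t --> 0^'+] --> 0
    & forall d, 0 < d < d0 -> (g d)^-1 * d ^+ 2 <= 1].

End function_classes.

(* Main.v *)
From HB Require Import structures.
Require Import Defs.
From mathcomp Require Import all_boot all_order all_algebra.
From mathcomp Require Import all_classical all_reals all_analysis.
From mathcomp Require Import measurable_realfun.
From mathcomp Require Import ring lra.
Import Order.TTheory GRing.Theory Num.Theory.
Import numFieldNormedType.Exports.
Local Open Scope classical_set_scope.
Local Open Scope ring_scope.

Set Implicit Arguments.
Unset Strict Implicit.
Unset Printing Implicit Defensive.

(* Write om = 1 + |x|^2 and let w be a smooth weight with values in [0, 1] that vanishes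
   on balls B_k whose radii take every value 2^-m infinitely often and whose centers lie
   on a coordinate axis, at mutual distances tending to infinity. Take a = (0, .., 0, alpha)
   with alpha = x_0 om w, and V = om (1 - w). The magnetic field pd 0 alpha satisfies
   pd 0 alpha + V >= om, and expanding |D_0 u - i D_(n-1) u|^2 >= 0 shows that the form
   dominates the integral of om |u|^2; as om tends to infinity, Rellich's theorem makes the
   form domain compactly embedded in L^2, so that the spectrum is discrete.

   Now fix d and a small radius r = 2^-m. For the cubes Q_d centered at the balls B_k of
   radius r, a bump supported in B_k, where a = 0, gives mu_0(Q_d) <= C / r^2, while V
   vanishes on Q_d outside a cube F of size comparable to r. Since cap F = O(r^(n-2)), or
   O(1 / log (1/r)) if n = 2, has the size of the profile at r^-2, the factor h makes F
   negligible when r is small. So M_gamma(Q_d; V) = 0, and the sum stays below C / r^2 along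
   infinitely many k. *)

(** * Semi-inner products *)

(** One pair (a, V) has to serve all f, d and constants at once: h decides how small the radius must
    be, and the cube must then still go to infinity with that radius fixed. Only an upper bound on
    mu_0 is available; monotonicity of f turns it into a lower bound on gamma. The factor c_n
    g(d)^-1 d^2 is a positive constant once d is fixed and is absorbed into h. No spectral theorem
    is used. The form enters through its real part, on functions rather than classes, so it is only
    a semi-inner product; resolvents come from the Riesz representation and a least-squares
    argument. The weight is only of class C^1, which is enough because at most one derivative of a
    ever occurs; derivatives of all orders are needed only for the bump tested in mu_0. The capacity
    of Q_d must be bounded below uniformly in the center. This is done by completing a square with
    an explicit vector field; as the competitors are merely Lipschitz, it requires their
    differentiability almost everywhere. *)

Lemma sqr_lt_normr (R : realDomainType) (x e : R) : 0 < e -> x ^+ 2 < e ^+ 2 -> `|x| < e.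
Proof.
move=> e0 xe; rewrite -(@ltr_pXn2r _ 2)// ?nnegrE ?(ltW e0)//.
by rewrite real_normK ?num_real.
Qed.

Section semi_inner_product.
Context {R : realType} {E : lmodType R[i]}.
Implicit Types (D : set E) (h : E -> E -> R) (u v w : E).

(** [h] stands for the real part of a sesquilinear form on a complex space: it is real bilinear, and
    [semi_inneri] records the complex structure. Positivity is not strict because functions that
    agree almost everywhere are not identified. *)
Record semi_inner (D : set E) (h : E -> E -> R) : Prop := SemiInner {
  semi_inner0 : D 0;
  semi_innerP : forall (z : R[i]) u v, D u -> D v -> D (z *: u + v);
  semi_innerC : forall u v, D u -> D v -> h u v = h v u;
  semi_innerDl : forall u v w, D u -> D v -> D w -> h (u + v) w = h u w + h v w;
  semi_innerZl : forall (r : R) u v, D u -> D v -> h (r%:C%C *: u) v = r * h u v;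
  semi_inneri : forall u v, D u -> D v -> h ('i%C *: u) v = - h u ('i%C *: v);
  semi_inner_ge0 : forall u, D u -> 0 <= h u u }.

Definition cvg_in h (u_ : nat -> E) u := (fun k => h (u_ k - u) (u_ k - u)) @ \oo --> (0 : R).

Definition cauchy_in h (u_ : nat -> E) := forall e : R, 0 < e -> exists N, forall k l,
  (N <= k)%N -> (N <= l)%N -> h (u_ k - u_ l) (u_ k - u_ l) < e.

Definition complete_in D h := forall u_ : nat -> E, (forall k, D (u_ k)) ->
  cauchy_in h u_ -> exists2 u, D u & cvg_in h u_ u.

Section theory.
Variables (D : set E) (h : E -> E -> R).
Hypothesis H : semi_inner D h.

Lemma in_D u v : D u -> D v -> D (u + v).
Proof. by move=> Du Dv; rewrite -[u]scale1r; exact: (semi_innerP H). Qed.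

Lemma in_Z z u : D u -> D (z *: u).
Proof. by move=> Du; rewrite -[_ *: _]addr0; apply: (semi_innerP H) => //; exact: (semi_inner0 H). Qed.

Lemma in_N u : D u -> D (- u).
Proof. by rewrite -scaleN1r; exact: in_Z. Qed.

Lemma in_B u v : D u -> D v -> D (u - v).
Proof. by move=> Du Dv; apply: in_D => //; exact: in_N. Qed.

Lemma in_sum (I : Type) (r : seq I) (F : I -> E) :
  (forall i, D (F i)) -> D (\sum_(i <- r) F i).
Proof. by move=> DF; apply: (big_ind D) => //; [exact: (semi_inner0 H)|exact: in_D]. Qed.

Local Hint Resolve in_D in_Z in_N in_B : core.

Let hC := semi_innerC H.
Let hDl := semi_innerDl H.
Let hZl := semi_innerZl H.

Lemma hDr u v w : D u -> D v -> D w -> h u (v + w) = h u v + h u w.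
Proof. by move=> Du Dv Dw; rewrite hC ?hDl//; auto; rewrite (hC Dv Du) (hC Dw Du). Qed.

Lemma hZr (r : R) u v : D u -> D v -> h u (r%:C%C *: v) = r * h u v.
Proof. by move=> Du Dv; rewrite hC ?hZl//; auto; rewrite hC. Qed.

Lemma hNl u v : D u -> D v -> h (- u) v = - h u v.
Proof.
move=> Du Dv; rewrite -scaleN1r.
have -> : (-1 : R[i]) = (-1)%:C%C by rewrite rmorphN.
by rewrite hZl// mulN1r.
Qed.

Lemma hNr u v : D u -> D v -> h u (- v) = - h u v.
Proof. by move=> Du Dv; rewrite hC ?hNl//; auto; rewrite hC. Qed.

Lemma hBl u v w : D u -> D v -> D w -> h (u - v) w = h u w - h v w.
Proof. by move=> Du Dv Dw; rewrite hDl ?hNl//; auto. Qed.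

Lemma hBr u v w : D u -> D v -> D w -> h u (v - w) = h u v - h u w.
Proof. by move=> Du Dv Dw; rewrite hDr ?hNr//; auto. Qed.

Lemma hir u v : D u -> D v -> h u ('i%C *: v) = - h ('i%C *: u) v.
Proof. by move=> Du Dv; rewrite (semi_inneri H)// opprK. Qed.

Lemma complexE (z : R[i]) : z = (complex.Re z)%:C%C + 'i%C * (complex.Im z)%:C%C.
Proof. by case: z => a b; simpc. Qed.

Lemma hconj (z : R[i]) u v : D u -> D v -> h (z *: u) v = h u (conjc z *: v).
Proof.
move=> Du Dv; rewrite (complexE z).
have -> : conjc ((complex.Re z)%:C%C + 'i%C * (complex.Im z)%:C%C) =
    (complex.Re z)%:C%C + 'i%C * (- complex.Im z)%:C%C :> R[i].
  by case: z => a b; simpc.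
rewrite !scalerDl -!scalerA hDl ?hDr//; auto.
rewrite hZl// hZr// (semi_inneri H)//; auto; congr +%R.
rewrite hZl//; auto.
have -> : 'i%C *: ((- complex.Im z)%:C%C *: v) = (- complex.Im z)%:C%C *: ('i%C *: v).
  by rewrite !scalerA mulrC.
by rewrite hZr ?mulNr//; auto.
Qed.

Lemma hDD u v : D u -> D v -> h (u + v) (u + v) = h u u + 2 * h u v + h v v.
Proof. by move=> Du Dv; rewrite hDl ?hDr//; auto; rewrite (hC Dv Du); ring. Qed.

Lemma hBB u v : D u -> D v -> h (u - v) (u - v) = h u u - 2 * h u v + h v v.
Proof. by move=> Du Dv; rewrite hBl ?hBr//; auto; rewrite (hC Dv Du); ring. Qed.

Lemma h0l u : D u -> h 0 u = 0.
Proof.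
by move=> Du; rewrite -(scale0r 0) -(rmorph0 (real_complex R)) hZl ?mul0r//; exact: (semi_inner0 H).
Qed.

Lemma cauchy_schwarz u v : D u -> D v -> h u v ^+ 2 <= h u u * h v v.
Proof.
move=> Du Dv.
have ge0 : forall t : R, 0 <= h u u + t * (2 * h u v) + t ^+ 2 * h v v.
  move=> t; have := semi_inner_ge0 H (in_D Du (in_Z t%:C%C Dv)).
  by rewrite hDD//; auto; rewrite !(hZr, hZl)//; auto; lra.
have vv := semi_inner_ge0 H Dv; have uu := semi_inner_ge0 H Du.
have [v0|v0] := eqVneq (h v v) 0; last first.
  have vp : 0 < h v v by rewrite lt_neqAle eq_sym v0.
  have := ge0 (- (h u v / h v v)).
  rewrite -(ler_pM2r vp) mul0r.
  have -> : (h u u + - (h u v / h v v) * (2 * h u v) +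
     (- (h u v / h v v)) ^+ 2 * h v v) * h v v = h u u * h v v - h u v ^+ 2.
    by field.
  by rewrite subr_ge0.
rewrite v0 mulr0.
have [->|uv] := eqVneq (h u v) 0; first by rewrite expr0n.
(* When [h v v = 0] the quadratic is affine in [t], and it takes the value -1 at this point. *)
have := ge0 (- (h u u + 1) / (2 * h u v)).
rewrite v0 mulr0 addr0.
have -> : - (h u u + 1) / (2 * h u v) * (2 * h u v) = - (h u u + 1) by field.
by rewrite opprD addrA subrr add0r oppr_ge0 ler10.
Qed.

(** Expand [h] at [e u - v]; the free weight [e] allows one of the two terms to be absorbed
    later. *)
Lemma h_bound u v (e : R) : D u -> D v -> 0 < e ->
  2 * h u v <= e * h u u + e^-1 * h v v.
Proof.
move=> Du Dv e0.
have := semi_inner_ge0 H (in_B (in_Z e%:C%C Du) Dv).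
rewrite hBB; auto; rewrite !(hZl, hZr)//; auto => ge0.
rewrite -(ler_pM2l e0) mulrDr (mulrA e e^-1) divff ?gt_eqF// mul1r.
lra.
Qed.

Lemma hB_le u v : D u -> D v -> h (u - v) (u - v) <= 2 * h u u + 2 * h v v.
Proof.
move=> Du Dv; have := semi_inner_ge0 H (in_D Du Dv).
by rewrite (hBB Du Dv) (hDD Du Dv); lra.
Qed.

Lemma hD_le u v : D u -> D v -> h (u + v) (u + v) <= 2 * h u u + 2 * h v v.
Proof.
move=> Du Dv; have := semi_inner_ge0 H (in_B Du Dv).
by rewrite (hDD Du Dv) (hBB Du Dv); lra.
Qed.

Lemma hB_tri u v w : D u -> D v -> D w ->
  h (u - w) (u - w) <= 2 * h (u - v) (u - v) + 2 * h (v - w) (v - w).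
Proof.
move=> Du Dv Dw; have -> : u - w = (u - v) + (v - w) by rewrite addrA subrK.
by apply: hD_le; auto.
Qed.

Lemma hBC u v : D u -> D v -> h (u - v) (u - v) = h (v - u) (v - u).
Proof. by move=> Du Dv; rewrite !hBB// (hC Dv Du); ring. Qed.

Lemma null_hl u v : D u -> D v -> h u u = 0 -> h u v = 0.
Proof.
move=> Du Dv u0; have := cauchy_schwarz Du Dv; rewrite u0 mul0r => ?.
by apply/eqP; rewrite -sqrf_eq0 eq_le sqr_ge0 andbT.
Qed.

Lemma hZZ z u : D u -> h (z *: u) (z *: u) = sqmod z * h u u.
Proof.
move=> Du; rewrite hconj//; auto; rewrite scalerA.
have -> : conjc z * z = (sqmod z)%:C%C :> R[i].
  by case: z => a b; rewrite /sqmod/=; simpc; congr (_ +i* _)%C; ring.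
by rewrite hZr.
Qed.

Lemma cvg_inP (u_ : nat -> E) u : cvg_in h u_ u <->
  forall e : R, 0 < e -> exists N, forall k, (N <= k)%N -> `|h (u_ k - u) (u_ k - u)| < e.
Proof.
split=> [/cvgrPdist_lt cv e e0|cv].
  have [N _ HN] := cv e e0; exists N => k Nk.
  by have := HN k Nk; rewrite /= sub0r normrN.
apply/cvgrPdist_lt => e e0; have [N HN] := cv e e0; exists N => // k Nk.
by rewrite /= sub0r normrN; exact: HN.
Qed.

Lemma cvg_hr (u_ : nat -> E) u v : (forall k, D (u_ k)) -> D u -> D v -> cvg_in h u_ u ->
  h (u_ k) v @[k --> \oo] --> h u v.
Proof.
move=> Du_ Du Dv cv.
have vv := semi_inner_ge0 H Dv.
apply/cvgrPdist_lt => e e0.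
move/cvg_inP : cv => /(_ (e ^+ 2 / (h v v + 1))) [|N HN].
  by rewrite divr_gt0 ?exprn_gt0// ltr_wpDl.
exists N => // k Nk /=.
rewrite -hBl//.
apply: sqr_lt_normr => //.
apply: (le_lt_trans (cauchy_schwarz _ _)); auto.
have := HN k Nk; rewrite hBC// ger0_norm ?(semi_inner_ge0 H)//; auto.
rewrite ltr_pdivlMr ?ltr_wpDl// => ?.
have : 0 <= h (u - u_ k) (u - u_ k) by apply: (semi_inner_ge0 H); auto.
lra.
Qed.

(** The representative minimizes the energy [J u = h u u - 2 F u]: completeness supplies the
    minimizer, and the claim is its Euler equation. *)
Lemma riesz (F : E -> R) (M : R) : complete_in D h ->
  (forall u v, D u -> D v -> F (u + v) = F u + F v) ->
  (forall r u, D u -> F (r%:C%C *: u) = r * F u) ->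
  (forall u, D u -> F u ^+ 2 <= M * h u u) ->
  exists2 w, D w & forall v, D v -> h w v = F v.
Proof.
move=> cD FD FZ FM.
pose J u := h u u - 2 * F u.
have M0 : 0 <= M \/ forall u, D u -> F u = 0.
  have [?|M0] := leP 0 M; [by left|right => u Du].
  have := FM _ Du; have : M * h u u <= 0.
    by rewrite nmulr_rle0// (semi_inner_ge0 H).
  move=> a b; have {}a := le_trans b a.
  by apply/eqP; rewrite -sqrf_eq0 eq_le a sqr_ge0.
case: M0 => [M0|F0]; last first.
  exists 0; first exact: (semi_inner0 H).
  by move=> v Dv; rewrite h0l ?F0.
have Jlb : forall u, D u -> - M - 1 <= J u.
  move=> u Du; rewrite /J.
  have hu := semi_inner_ge0 H Du.
  have := FM _ Du.
  have : 0 <= (h u u - M) ^+ 2 by exact: sqr_ge0.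
  have [Fu|Fu] := leP (F u) 0; first by lra.
  move=> sq FMu; rewrite leNgt; apply/negP => lt.
  have : h u u + M < 2 * F u by lra.
  rewrite -(@ltr_pXn2r _ 2) ?nnegrE//; [|lra|lra].
  nra.
pose A := [set J u | u in D].
have hA : has_inf A.
  split; first by exists (J 0); exists 0 => //; exact: (semi_inner0 H).
  by exists (- M - 1) => _ [u Du <-]; exact: Jlb.
pose m := inf A.
have mJ u : D u -> m <= J u by move=> Du; apply: ge_inf; [exact: hA.2|exists u].
have ex k : exists u, D u /\ J u < m + k.+1%:R^-1.
  have : m < m + k.+1%:R^-1 by rewrite ltrDl.
  by move=> /(inf_lt hA.1)[_ [u Du <-]] lt; exists u.
have {ex}[u_ u_P] := choice ex.
have Du_ k : D (u_ k) := (u_P k).1.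
have Jt u v (t : R) : D u -> D v ->
    J (u + t%:C%C *: v) = J u + 2 * t * (h u v - F v) + t ^+ 2 * h v v.
  move=> Du Dv; rewrite /J hDD ?FD//; auto.
  by rewrite FZ//; auto; rewrite !(hZr, hZl)//; auto; ring.
(* [u_ k] minimizes [J] up to [1/(k+1)], so the quadratic in [t] below is nonnegative, and its
   discriminant bounds the defect in the Euler equation. *)
have key k v : D v -> (h (u_ k) v - F v) ^+ 2 <= k.+1%:R^-1 * h v v.
  move=> Dv.
  have hv := semi_inner_ge0 H Dv.
  pose c := h (u_ k) v - F v.
  have H1 t : 0 <= k.+1%:R^-1 + 2 * t * c + t ^+ 2 * h v v.
    have := mJ _ (in_D (Du_ k) (in_Z t%:C%C Dv)); rewrite Jt//.
    have := (u_P k).2; rewrite -/c; move: (k.+1%:R^-1) (2 * t * c) => ek tc; lra.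
  rewrite -/c.
  have [v0|v0] := eqVneq (h v v) 0.
    rewrite v0 mulr0.
    have [->|c0] := eqVneq c 0; first by rewrite expr0n.
    have := H1 (- (k.+1%:R^-1 + 1) / (2 * c)); rewrite v0 mulr0 addr0.
    have -> : 2 * (- (k.+1%:R^-1 + 1) / (2 * c)) * c = - (k.+1%:R^-1 + 1).
      by move: (k.+1%:R^-1) => ek; field.
    by move: (k.+1%:R^-1) => ek; lra.
  have vp : 0 < h v v by rewrite lt_neqAle eq_sym v0.
  have := H1 (- (c / h v v)); rewrite -(ler_pM2r vp) mul0r.
  have -> : (k.+1%:R^-1 + 2 * - (c / h v v) * c + (- (c / h v v)) ^+ 2 * h v v) * h v v
     = k.+1%:R^-1 * h v v - c ^+ 2.
    by move: (k.+1%:R^-1) => ek; field.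
  by rewrite subr_ge0.
have cu : cauchy_in h u_.
  move=> e e0.
  have [N HN] : exists N, forall k, (N <= k)%N -> k.+1%:R^-1 < e / 4.
    have := @cvg_harmonic R => /cvgrPdist_lt/(_ (e/4)).
    rewrite divr_gt0// => /(_ isT)[N _ HN]; exists N => k Nk.
    have := HN k Nk; rewrite /= sub0r normrN ger0_norm ?invr_ge0//.
  exists N => k l Nk Nl.
  (* Parallelogram law: since [J] is at least [m] at the midpoint, two near-minimizers are close to
     each other. *)
  have Dm : D (u_ k + (2^-1)%:C%C *: (u_ l - u_ k)) by auto.
  have Jm := mJ _ Dm.
  have := HN k Nk; have := HN l Nl.
  have := (u_P k).2; have := (u_P l).2.
  move: (k.+1%:R^-1) (l.+1%:R^-1) => ek el.
  move: Jm; rewrite Jt//; auto.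
  have FB : F (u_ l - u_ k) = F (u_ l) - F (u_ k).
    rewrite FD; auto; rewrite -scaleN1r.
    by rewrite -(rmorphN1 (real_complex R)) FZ// mulN1r.
  rewrite FB hBr// !hBB// /J (hC (Du_ k) (Du_ l)).
  set a := h (u_ k) _; set b := h (u_ l) (u_ l); set c := h (u_ l) (u_ k).
  lra.
have [w Dw cw] := cD _ Du_ cu; exists w => // v Dv.
have hv := semi_inner_ge0 H Dv.
have cv1 := cvg_hr Du_ Dw Dv cw.
suff cv2 : h (u_ k) v @[k --> \oo] --> F v.
  exact: (cvg_unique _ cv1 cv2).
apply/cvgrPdist_lt => e e0.
have := @cvg_harmonic R => /cvgrPdist_lt/(_ (e ^+ 2 / (h v v + 1))).
rewrite divr_gt0 ?exprn_gt0 ?ltr_wpDl// => /(_ isT)[N _ HN].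
exists N => // k Nk /=; have := HN k Nk.
rewrite /= sub0r normrN ger0_norm ?invr_ge0// ltr_pdivlMr ?ltr_wpDl// => lt.
rewrite distrC; apply: sqr_lt_normr => //.
apply: (le_lt_trans (key k v Dv)).
rewrite /= in lt.
have : 0 < k.+1%:R^-1 :> R by rewrite invr_gt0.
by move: (k.+1%:R^-1) lt => ek; lra.
Qed.

End theory.
End semi_inner_product.

(** * The closure of a form *)

Section form_closure.
Context {R : realType} {E : lmodType R[i]}.
Implicit Types (u v w : E).

Lemma real_cauchy_cvg (x : nat -> R) :
  (forall e, 0 < e -> exists N, forall k l, (N <= k)%N -> (N <= l)%N -> `|x k - x l| < e) ->
  cvgn x.
Proof.
move=> cx; apply/cauchy_cvgP; apply/cauchy_exP => e e0.
have [N HN] := cx e e0; exists (x N); exists N => // k Nk.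
by rewrite /ball/=; apply: HN.
Qed.

Lemma cvg0P (x : nat -> R) : x @ \oo --> 0 <->
  forall e, 0 < e -> exists N, forall k, (N <= k)%N -> `|x k| < e.
Proof.
split=> [/cvgrPdist_lt cv e e0|cv].
  have [N _ HN] := cv e e0; exists N => k Nk.
  by have := HN k Nk; rewrite /= sub0r normrN.
apply/cvgrPdist_lt => e e0; have [N HN] := cv e e0; exists N => // k Nk.
by rewrite /= sub0r normrN; exact: HN.
Qed.

Lemma inv_succ_small (e : R) : 0 < e -> exists N, forall k, (N <= k)%N -> k.+1%:R^-1 < e.
Proof.
move=> e0; have := @cvg_harmonic R => /cvg0P/(_ e e0)[N HN]; exists N => k Nk.
by have := HN k Nk; rewrite ger0_norm //= invr_ge0.
Qed.

Lemma seq_cvgD (x y : nat -> R) a b : x @ \oo --> a -> y @ \oo --> b ->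
  (fun k => x k + y k) @ \oo --> a + b.
Proof. exact: cvgD. Qed.

Lemma seq_cvgB (x y : nat -> R) a b : x @ \oo --> a -> y @ \oo --> b ->
  (fun k => x k - y k) @ \oo --> a - b.
Proof. exact: cvgB. Qed.

Lemma seq_cvgN (x : nat -> R) a : x @ \oo --> a -> (fun k => - x k) @ \oo --> - a.
Proof. exact: cvgN. Qed.

Lemma seq_cvgZ (x : nat -> R) r a : x @ \oo --> a ->
  (fun k => r * x k) @ \oo --> r * a.
Proof. exact: cvgMl_tmp. Qed.

Lemma seq_squeeze0 (x y : nat -> R) : (forall k, 0 <= x k <= y k) ->
  y @ \oo --> 0 -> x @ \oo --> 0.
Proof.
move=> xy; apply: (@squeeze_cvgr _ _ _ _ (cst 0)); first exact: nearW.
exact: cvg_cst.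
Qed.

Lemma seq_cvg_le N (x y : nat -> R) a b : (forall k, (N <= k)%N -> x k <= y k) ->
  x @ \oo --> a -> y @ \oo --> b -> a <= b.
Proof. by move=> xy cx cy; apply: ler_cvg_to cx cy _; exists N. Qed.

Section cvg.
Variables (D : set E) (h : E -> E -> R).
Hypothesis H : semi_inner D h.

Lemma cvg_hh (u_ : nat -> E) u : (forall k, D (u_ k)) -> D u -> cvg_in h u_ u ->
  h (u_ k) (u_ k) @[k --> \oo] --> h u u.
Proof.
move=> Du_ Du cu.
have c1 := cvg_hr H Du_ Du Du cu.
have -> : (fun k => h (u_ k) (u_ k)) =
  (fun k => h (u_ k - u) (u_ k - u) + 2 * h (u_ k) u - h u u).
  by apply/funext => k; rewrite (hBB H)//; ring.
have e : 0 + 2 * h u u - h u u = h u u by ring.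
rewrite -[X in _ --> X]e.
by apply: seq_cvgB; [apply: seq_cvgD; [exact: cu|exact: seq_cvgZ]|exact: cvg_cst].
Qed.

Lemma cauchy_in_bounded (u_ : nat -> E) : (forall k, D (u_ k)) -> cauchy_in h u_ ->
  exists M N, 0 < M /\ forall k, (N <= k)%N -> h (u_ k) (u_ k) <= M.
Proof.
move=> Du_ cu; have [N HN] := cu 1 ltr01.
have p := semi_inner_ge0 H (Du_ N).
exists (2 + 2 * h (u_ N) (u_ N)), N; split; first lra.
move=> k Nk; have -> : u_ k = (u_ k - u_ N) + u_ N by rewrite subrK.
have := hD_le H (in_B H (Du_ k) (Du_ N)) (Du_ N).
by have := HN k N Nk (leqnn N); rewrite subrK; lra.
Qed.

Lemma h_diff u u' v v' : D u -> D u' -> D v -> D v' ->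
  (h u v - h u' v') ^+ 2 <=
  2 * (h (u - u') (u - u') * h v v) + 2 * (h u' u' * h (v - v') (v - v')).
Proof.
move=> Du Du' Dv Dv'.
have -> : h u v - h u' v' = h (u - u') v + h u' (v - v').
  by rewrite (hBl H)// (hBr H)//; ring.
have := cauchy_schwarz H (in_B H Du Du') Dv.
have := cauchy_schwarz H Du' (in_B H Dv Dv').
set a := h (u - u') v; set b := h u' (v - v').
have : 0 <= (a - b) ^+ 2 by exact: sqr_ge0.
nra.
Qed.

Lemma cauchy_pair_cvg (u_ v_ : nat -> E) : (forall k, D (u_ k)) -> (forall k, D (v_ k)) ->
  cauchy_in h u_ -> cauchy_in h v_ -> cvgn (fun k => h (u_ k) (v_ k)).
Proof.
move=> Du_ Dv_ cu cv.
have [Mu [Nu [Mu0 bu]]] := cauchy_in_bounded Du_ cu.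
have [Mv [Nv [Mv0 bv]]] := cauchy_in_bounded Dv_ cv.
apply: real_cauchy_cvg => e e0.
have e20 : 0 < e ^+ 2 by rewrite exprn_gt0.
have [|N1 H1] := cu (e ^+ 2 / (4 * Mv)); first by rewrite divr_gt0// mulr_gt0.
have [|N2 H2] := cv (e ^+ 2 / (4 * Mu)); first by rewrite divr_gt0// mulr_gt0.
exists (maxn (maxn Nu Nv) (maxn N1 N2)) => k l.
rewrite !geq_max => /andP[/andP[k1 k2] /andP[k3 k4]] /andP[/andP[l1 l2] /andP[l3 l4]].
apply: sqr_lt_normr => //.
apply: (le_lt_trans (h_diff _ _ _ _)) => //.
have := H1 k l k3 l3; rewrite ltr_pdivlMr ?mulr_gt0// => A.
have := H2 k l k4 l4; rewrite ltr_pdivlMr ?mulr_gt0// => B.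
have A' := semi_inner_ge0 H (in_B H (Du_ k) (Du_ l)).
have B' := semi_inner_ge0 H (in_B H (Dv_ k) (Dv_ l)).
have : h (u_ k - u_ l) (u_ k - u_ l) * h (v_ k) (v_ k) <= h (u_ k - u_ l) (u_ k - u_ l) * Mv.
  by apply: ler_wpM2l => //; exact: bv.
have : h (u_ l) (u_ l) * h (v_ k - v_ l) (v_ k - v_ l) <= Mu * h (v_ k - v_ l) (v_ k - v_ l).
  by apply: ler_wpM2r => //; exact: bu.
lra.
Qed.

Lemma cvg_in_P (z : R[i]) (u_ v_ : nat -> E) u v :
  (forall k, D (u_ k)) -> (forall k, D (v_ k)) -> D u -> D v ->
  cvg_in h u_ u -> cvg_in h v_ v ->
  cvg_in h (fun k => z *: u_ k + v_ k) (z *: u + v).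
Proof.
move=> Du_ Dv_ Du Dv cu cv.
apply: (@seq_squeeze0 _ 
  (fun k => 2 * (sqmod z * h (u_ k - u) (u_ k - u)) + 2 * h (v_ k - v) (v_ k - v))).
- move=> k.
  have Da := in_B H (Du_ k) Du; have Db := in_B H (Dv_ k) Dv.
  have -> : z *: u_ k + v_ k - (z *: u + v) = z *: (u_ k - u) + (v_ k - v).
    by rewrite scalerBr opprD addrACA.
  rewrite (semi_inner_ge0 H (semi_innerP H z Da Db))/=.
  apply: le_trans (hD_le H (in_Z H z Da) Db) _.
  by rewrite (hZZ H).
- have := seq_cvgD (seq_cvgZ (r := 2) (seq_cvgZ (r := sqmod z) cu)) (seq_cvgZ (r := 2) cv).
  by rewrite !mulr0 addr0.
Qed.

Lemma cauchy_in_P (z : R[i]) (u_ v_ : nat -> E) :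
  (forall k, D (u_ k)) -> (forall k, D (v_ k)) ->
  cauchy_in h u_ -> cauchy_in h v_ -> cauchy_in h (fun k => z *: u_ k + v_ k).
Proof.
move=> Du_ Dv_ cu cv e e0.
have z0 : 0 <= sqmod z by rewrite addr_ge0// sqr_ge0.
have [|N1 H1] := cu (e / (4 * (sqmod z + 1))).
  by rewrite divr_gt0// mulr_gt0// ltr_wpDl.
have [|N2 H2] := cv (e / 4); first by rewrite divr_gt0.
exists (maxn N1 N2) => k l; rewrite !geq_max => /andP[k1 k2] /andP[l1 l2].
have Da := in_B H (Du_ k) (Du_ l); have Db := in_B H (Dv_ k) (Dv_ l).
have -> : z *: u_ k + v_ k - (z *: u_ l + v_ l) = z *: (u_ k - u_ l) + (v_ k - v_ l).
  by rewrite scalerBr opprD addrACA.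
apply: le_lt_trans (hD_le H (in_Z H z Da) Db) _.
rewrite (hZZ H)//; have := H2 k l k2 l2.
have := H1 k l k1 l1; rewrite ltr_pdivlMr ?mulr_gt0 ?ltr_wpDl//.
have := semi_inner_ge0 H Da; have := semi_inner_ge0 H Db.
nra.
Qed.

End cvg.

Variables (L T : set E) (s t : E -> E -> R).
Hypotheses (HL : semi_inner L s) (cL : complete_in L s) (HT : semi_inner T t).
Hypotheses (TL : T `<=` L) (st : forall u, T u -> s u u <= t u u).
Hypothesis adj : forall phi, T phi -> exists2 psi, L psi & forall u, T u -> t u phi = s u psi.

Definition approx u (u_ : nat -> E) :=
  [/\ forall k, T (u_ k), L u, cvg_in s u_ u & cauchy_in t u_].

Definition closure_dom u := exists u_ : nat -> E, approx u u_.

(** One chosen approximating sequence, the zero sequence by default when there is none;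
    [closure_formP] shows that the form does not depend on the choice. *)
Definition approx_seq u := xget (fun=> 0) [set x : nat -> E | approx u x].

Definition closure_form u v := limn (fun k => t (approx_seq u k) (approx_seq v k)).

Let D := closure_dom.
Let h := closure_form.

Lemma approx_seqP u : D u -> approx u (approx_seq u).
Proof. by move=> [u_ au]; rewrite /approx_seq; case: xgetP => // /(_ u_). Qed.

(* As [t] is given by an operator on [T], [t (w_ k) (w_ N)] tends to 0 for every
   fixed [N]. *)
Lemma closable (w_ : nat -> E) : (forall k, T (w_ k)) -> cauchy_in t w_ ->
  cvg_in s w_ 0 -> t (w_ k) (w_ k) @[k --> \oo] --> 0.
Proof.
move=> Tw cw sw; apply/cvg0P => e e0.
have [|N HN] := cw (e / 2); first by rewrite divr_gt0.
have [psi Lp tp] := adj (Tw N).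
have := cvg_hr HL (fun k => TL (Tw k)) (semi_inner0 HL) Lp sw.
rewrite (h0l HL)// => /cvg0P/(_ (e / 4)).
rewrite divr_gt0// => /(_ isT)[N' HN'].
exists (maxn N N') => k; rewrite geq_max => /andP[k1 k2].
rewrite ger0_norm ?(semi_inner_ge0 HT)//.
have := h_bound HT (Tw k) (in_B HT (Tw k) (Tw N)) ltr01.
rewrite (hBr HT)// tp// invr1 !mul1r.
have := HN k N k1 (leqnn _).
have := HN' k k2; rewrite ltr_norml => /andP[_].
lra.
Qed.

Lemma approxP z u v (u_ v_ : nat -> E) : approx u u_ -> approx v v_ ->
  approx (z *: u + v) (fun k => z *: u_ k + v_ k).
Proof.
move=> [a1 a2 a3 a4] [b1 b2 b3 b4]; split.
- by move=> k; exact: (semi_innerP HT).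
- exact: (semi_innerP HL).
- by apply: (cvg_in_P HL) => // k; exact: TL.
- exact: (cauchy_in_P HT).
Qed.

(** The difference of the two sequences approximates 0, so [closable] applies to it. *)
Lemma approx_diff u (u_ u'_ : nat -> E) : approx u u_ -> approx u u'_ ->
  t (u_ k - u'_ k) (u_ k - u'_ k) @[k --> \oo] --> 0.
Proof.
move=> au au'; have := approxP (-1) au' au.
rewrite scaleN1r addNr => -[a1 a2 a3 a4].
have := closable a1 a4 a3; rewrite (_ : (fun k => _) = (fun k => t (u_ k - u'_ k) (u_ k - u'_ k)))//.
by apply/funext => k; rewrite scaleN1r addrC.
Qed.

Lemma closure_formP u v (u_ v_ : nat -> E) : approx u u_ -> approx v v_ ->
  t (u_ k) (v_ k) @[k --> \oo] --> h u v.
Proof.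
move=> au av.
have Du : D u by exists u_.
have Dv : D v by exists v_.
have au' := approx_seqP Du; have av' := approx_seqP Dv.
have [a1 a2 a3 a4] := au; have [b1 b2 b3 b4] := av.
have [a1' a2' a3' a4'] := au'; have [b1' b2' b3' b4'] := av'.
have cvh : t (approx_seq u k) (approx_seq v k) @[k --> \oo] --> h u v.
  exact: (cauchy_pair_cvg HT).
suff d0 : (fun k => t (u_ k) (v_ k) - t (approx_seq u k) (approx_seq v k)) @ \oo --> 0.
  have := seq_cvgD d0 cvh; rewrite add0r.
  rewrite (_ : (fun k => _ - _ + _) = (fun k => t (u_ k) (v_ k)))//.
  by apply/funext => k; rewrite subrK.
have [Mu [Nu [Mu0 bu]]] := cauchy_in_bounded HT a1' a4'.
have [Mv [Nv [Mv0 bv]]] := cauchy_in_bounded HT b1 b4.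
have /cvg0P du := approx_diff au au'.
have /cvg0P dv := approx_diff av av'.
apply/cvg0P => e e0.
have e20 : 0 < e ^+ 2 by rewrite exprn_gt0.
have [|N1 H1] := du (e ^+ 2 / (4 * Mv)); first by rewrite divr_gt0// mulr_gt0.
have [|N2 H2] := dv (e ^+ 2 / (4 * Mu)); first by rewrite divr_gt0// mulr_gt0.
exists (maxn (maxn Nu Nv) (maxn N1 N2)) => k.
rewrite !geq_max => /andP[/andP[k1 k2] /andP[k3 k4]].
apply: sqr_lt_normr => //.
apply: (le_lt_trans (h_diff HT _ _ _ _)) => //.
have A' := semi_inner_ge0 HT (in_B HT (a1 k) (a1' k)).
have B' := semi_inner_ge0 HT (in_B HT (b1 k) (b1' k)).
have := H1 k k3; rewrite ger0_norm// ltr_pdivlMr ?mulr_gt0// => A.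
have := H2 k k4; rewrite ger0_norm// ltr_pdivlMr ?mulr_gt0// => B.
have : t (u_ k - approx_seq u k) (u_ k - approx_seq u k) * t (v_ k) (v_ k) <=
       t (u_ k - approx_seq u k) (u_ k - approx_seq u k) * Mv.
  by apply: ler_wpM2l => //; exact: bv.
have : t (approx_seq u k) (approx_seq u k) * t (v_ k - approx_seq v k) (v_ k - approx_seq v k) <=
       Mu * t (v_ k - approx_seq v k) (v_ k - approx_seq v k).
  by apply: ler_wpM2r => //; exact: bu.
lra.
Qed.

Lemma approx_cst phi : T phi -> approx phi (fun=> phi).
Proof.
move=> Tp; split=> //; first exact: TL.
  rewrite /cvg_in (_ : (fun k => _) = cst 0); first exact: cvg_cst.
  by apply/funext => k /=; rewrite subrr (h0l HL)//; exact: (semi_inner0 HL).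
by move=> e e0; exists 0%N => k l _ _; rewrite subrr (h0l HT)//; exact: (semi_inner0 HT).
Qed.

Lemma closure_dom_sub : T `<=` D.
Proof. by move=> phi Tp; exists (fun=> phi); exact: approx_cst. Qed.

Lemma closure_dom_L : D `<=` L.
Proof. by move=> u [u_ []]. Qed.

Lemma closure_form_test phi psi : T phi -> T psi -> h phi psi = t phi psi.
Proof.
move=> Tp Tq; have := closure_formP (approx_cst Tp) (approx_cst Tq).
by move=> c; exact: (cvg_unique _ c (@cvg_cst _ _ _ _ _)).
Qed.

Lemma closure_semi_inner : semi_inner D h.
Proof.
split.
- exact/closure_dom_sub/(semi_inner0 HT).
- move=> z u v [u_ au] [v_ av]; eexists; exact: approxP au av.
- move=> u v [u_ au] [v_ av].
  have := closure_formP au av; have := closure_formP av au.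
  rewrite (_ : (fun k => t (v_ k) (u_ k)) = (fun k => t (u_ k) (v_ k))).
    by move=> c1 c2; exact: (cvg_unique _ c2 c1).
  by apply/funext => k; rewrite (semi_innerC HT)//; [case: av|case: au].
- move=> u v w [u_ au] [v_ av] [w_ aw].
  have := closure_formP (approxP 1 au av) aw.
  have := seq_cvgD (closure_formP au aw) (closure_formP av aw).
  rewrite scale1r.
  rewrite (_ : (fun k => t (1 *: u_ k + v_ k) (w_ k)) =
     (fun k => t (u_ k) (w_ k) + t (v_ k) (w_ k))).
    by move=> c1 c2; exact: (cvg_unique _ c2 c1).
  apply/funext => k /=; rewrite scale1r (semi_innerDl HT)//; [by case: au|by case: av|by case: aw].
- move=> r u v [u_ au] [v_ av].
  have a0 := approx_cst (semi_inner0 HT).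
  have := closure_formP (approxP r%:C%C au a0) av.
  have := seq_cvgZ (r := r) (closure_formP au av).
  rewrite addr0.
  rewrite (_ : (fun k => t (r%:C%C *: u_ k + 0) (v_ k)) = (fun k => r * t (u_ k) (v_ k))).
    by move=> c1 c2; exact: (cvg_unique _ c2 c1).
  apply/funext => k /=; rewrite addr0 (semi_innerZl HT)//; [by case: au|by case: av].
- move=> u v [u_ au] [v_ av].
  have a0 := approx_cst (semi_inner0 HT).
  have := closure_formP (approxP 'i%C au a0) av.
  have := seq_cvgN (closure_formP au (approxP 'i%C av a0)).
  rewrite !addr0.
  rewrite (_ : (fun k => t ('i%C *: u_ k + 0) (v_ k)) =
      (fun k => - t (u_ k) ('i%C *: v_ k + 0))).
    by move=> c1 c2; exact: (cvg_unique _ c2 c1).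
  apply/funext => k /=; rewrite !addr0 (semi_inneri HT)//; [by case: au|by case: av].
- move=> u [u_ au].
  apply: (seq_cvg_le (N := 0) _ (cvg_cst 0) (closure_formP au au)) => k _.
  by apply: (semi_inner_ge0 HT); case: au.
Qed.

Let HD := closure_semi_inner.

Lemma closure_form_ge u : D u -> s u u <= h u u.
Proof.
move=> [u_ au]; have [a1 a2 a3 a4] := au.
apply: (seq_cvg_le (N := 0) _ (cvg_hh HL (fun k => TL (a1 k)) a2 a3) (closure_formP au au)) => k _.
exact: st.
Qed.

(** Approximation is defined by convergence in [s]; convergence in the closed form follows because,
    for fixed k, the form of [u_ k - u] is the limit over l of that of [u_ k - u_ l], which is small
    by the Cauchy property. *)
Lemma approx_cvg u (u_ : nat -> E) : approx u u_ -> cvg_in h u_ u.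
Proof.
move=> au; have [a1 a2 a3 a4] := au.
have Du : D u by exists u_.
apply/cvg0P => e e0.
have [|N HN] := a4 (e / 2); first by rewrite divr_gt0.
exists N => k Nk.
have := approxP (-1) (approx_cst (a1 k)) au; rewrite scaleN1r addrC => a.
have Dk : D (u_ k) by exact: closure_dom_sub.
rewrite ger0_norm; last by apply: (semi_inner_ge0 HD); exact: (in_B HD).
rewrite (hBC HD)//.
apply: (@le_lt_trans _ _ (e / 2)); last by lra.
apply: (seq_cvg_le (N := N) _ (closure_formP a a) (cvg_cst _)) => l Nl.
by rewrite addrC ltW// HN.
Qed.

(** Replace each [u_ k] by an element of [T] within [1/(k+1)]. The new sequence is Cauchy for [t],
    hence for [s], and its limit in [L] lies in the domain by the very definition of the closure. *)
Lemma closure_complete : complete_in D h.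
Proof.
move=> u_ Du_ cu.
have ex k : exists phi, T phi /\ h (u_ k - phi) (u_ k - phi) < k.+1%:R^-1.
  have [v av] := Du_ k; have /cvg0P/(_ k.+1%:R^-1) := approx_cvg av.
  rewrite invr_gt0 ltr0Sn => /(_ isT)[N HN].
  have [a1 _ _ _] := av; exists (v N); split=> //.
  rewrite (hBC HD)//; last exact: closure_dom_sub.
  by apply: le_lt_trans (HN N _) => //; exact: ler_norm.
have {ex}[p pP] := choice ex.
have Tp k : T (p k) := (pP k).1.
have Dp k : D (p k) := closure_dom_sub (Tp k).
have ct : cauchy_in t p.
  move=> e e0.
  have [|N1 H1] := cu (e / 8); first by rewrite divr_gt0.
  have [|N2 H2] := @inv_succ_small (e / 16); first by rewrite divr_gt0.
  exists (maxn N1 N2) => k l; rewrite !geq_max => /andP[k1 k2] /andP[l1 l2].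
  rewrite -closure_form_test; [|exact: (in_B HT)..].
  have t1 := hB_tri HD (Dp k) (Du_ k) (Dp l).
  have t2 := hB_tri HD (Du_ k) (Du_ l) (Dp l).
  rewrite (hBC HD (Dp k) (Du_ k)) in t1.
  have := (pP k).2; have := (pP l).2; have := H1 k l k1 l1.
  have := H2 k k2; have := H2 l l2.
  move: (k.+1%:R^-1) (l.+1%:R^-1) => ek el; lra.
have cs : cauchy_in s p.
  move=> e e0; have [N HN] := ct e e0; exists N => k l kN lN.
  by apply: le_lt_trans (HN k l kN lN); apply: st; exact: (in_B HT).
have [u Lu su] := cL (fun k => TL (Tp k)) cs.
have au : approx u p by split.
have Du : D u by exists p.
exists u => //; apply/cvg0P => e e0.
have /cvg0P/(_ (e / 4)) := approx_cvg au.
rewrite divr_gt0// => /(_ isT)[N1 H1].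
have [|N2 H2] := @inv_succ_small (e / 4); first by rewrite divr_gt0.
exists (maxn N1 N2) => k; rewrite geq_max => /andP[k1 k2].
rewrite ger0_norm; last by apply: (semi_inner_ge0 HD); exact: (in_B HD).
have t1 := hB_tri HD (Du_ k) (Dp k) Du.
have := (pP k).2; have := H1 k k1; have := H2 k k2.
rewrite ltr_norml => + /andP[_].
move: (k.+1%:R^-1) => ek; lra.
Qed.

Lemma closure_rellich (e : R) (b : seq E) : (forall x, x \in b -> L x) ->
  (forall u, T u -> s u u <= e * t u u + \sum_(x <- b) s u x ^+ 2) ->
  forall u, D u -> s u u <= e * h u u + \sum_(x <- b) s u x ^+ 2.
Proof.
move=> Lb Tb u [u_ au]; have [a1 a2 a3 a4] := au.
have Lu k : L (u_ k) by exact: TL.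
apply: (seq_cvg_le (N := 0) _ (cvg_hh HL _ a2 a3) (seq_cvgD (seq_cvgZ (closure_formP au au)) _)).
- by move=> k _; exact: Tb.
- by [].
- elim: b Lb {Tb} => [|x b IH] Lb.
    rewrite big_nil (_ : (fun k => _) = cst 0); first exact: cvg_cst.
    by apply/funext => k; rewrite big_nil.
  rewrite big_cons (_ : (fun k => _) = (fun k => s (u_ k) x * s (u_ k) x +
     \sum_(x <- b) s (u_ k) x ^+ 2)); last first.
    by apply/funext => k; rewrite big_cons expr2.
  apply: seq_cvgD; last by apply: IH => y yb; apply: Lb; rewrite inE yb orbT.
  have Lx : L x by apply: Lb; rewrite mem_head.
  by apply: cvgM; exact: (cvg_hr HL).
Qed.

End form_closure.

(** * Forms with a compact embedding *)

Section spectral.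
Context {R : realType} {E : lmodType R[i]}.
Implicit Types (u v w g : E).
Variables (L D : set E) (s h : E -> E -> R).
Hypotheses (HL : semi_inner L s) (HD : semi_inner D h) (cD : complete_in D h).
Hypotheses (DL : D `<=` L) (sh : forall u, D u -> s u u <= h u u).
(** Compactness of the embedding in quantitative form: modulo a small multiple of the form norm, [s]
    is controlled by finitely many linear functionals. *)
Hypothesis rellich : forall e : R, 0 < e -> exists2 b : seq E, forall x, x \in b -> L x &
  forall u, D u -> s u u <= e * h u u + \sum_(x <- b) s u x ^+ 2.

Lemma sqmod_le2 (z l : R[i]) : sqmod z <= 2 * sqmod (z - l) + 2 * sqmod l.
Proof.
case: z l => a b [c d]; rewrite /sqmod/=.
have := sqr_ge0 (a - 2 * c); have := sqr_ge0 (b - 2 * d); nra.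
Qed.

Lemma ultra_bounded_cvg (G : set_system nat) (x : nat -> R) (C : R) : UltraFilter G ->
  (forall k, `|x k| <= C) -> exists p : R, x @ G --> p.
Proof.
move=> UG xC.
have [p [_ cp]] : `[- C, C]%classic `&` cluster (x @ G) !=set0.
  apply: (@segment_compact R (- C) C).
  change (G (x @^-1` `[- C, C]%classic)); apply: filterE => k.
  by rewrite /= in_itv/= -ler_norml; exact: xC.
exists p => B nB.
have [//|GB] := in_ultra_setVsetC (x @^-1` B) UG.
have [y [/= nBy By]] := cp (~` B) B GB nB.
by [].
Qed.

Lemma ultra_small_sum (G : set_system nat) (u_ : nat -> E) (M : R) (b : seq E) :
  UltraFilter G -> (forall k, L (u_ k)) -> (forall k, s (u_ k) (u_ k) <= M) ->
  (forall x, x \in b -> L x) -> forall d : R, 0 < d -> exists2 A, G A &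
  forall k l, A k -> A l -> \sum_(x <- b) s (u_ k - u_ l) x ^+ 2 < d.
Proof.
move=> UG Lu uM; elim: b => [|x b IH] Lb d d0.
  exists setT; first exact: filterT.
  by move=> k l _ _; rewrite big_nil.
have [y yb||A GA HA] := IH _ (d / 2).
- by apply: Lb; rewrite inE yb orbT.
- by rewrite divr_gt0.
have Lx : L x by apply: Lb; rewrite mem_head.
have xx := semi_inner_ge0 HL Lx.
have M0 : 0 <= M by apply: le_trans (uM 0%N); exact: (semi_inner_ge0 HL).
have bd k : `|s (u_ k) x| <= M * s x x + 1.
  have : `|s (u_ k) x| ^+ 2 <= M * s x x.
    rewrite real_normK ?num_real//; apply: le_trans (cauchy_schwarz HL _ _) _ => //.
    exact: ler_wpM2r.
  have : 0 <= `|s (u_ k) x| by [].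
  have : 0 <= M * s x x by rewrite mulr_ge0.
  by nra.
have [p /cvgrPdist_lt px] := ultra_bounded_cvg UG bd.
have eta0 : 0 < Num.sqrt (d / 8) by rewrite sqrtr_gt0 divr_gt0.
have GB := px _ eta0.
exists (A `&` [set k | `|p - s (u_ k) x| < Num.sqrt (d / 8)]); first exact: filterI.
move=> k m [Ak /= Bk] [Am /= Bm]; rewrite big_cons.
have := HA k m Ak Am.
suff : s (u_ k - u_ m) x ^+ 2 <= d / 2 by lra.
rewrite (hBl HL)//.
have sq : Num.sqrt (d / 8) ^+ 2 = d / 8 by rewrite sqr_sqrtr// divr_ge0// ltW.
move: Bk Bm; rewrite !ltr_norml => /andP[k1 k2] /andP[m1 m2].
set r := Num.sqrt _ in eta0 sq k1 k2 m1 m2 *.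
have : `|s (u_ k) x - s (u_ m) x| <= 2 * r by rewrite ler_norml; lra.
rewrite -[X in _ -> X <= _]real_normK ?num_real// => H.
have : 0 <= `|s (u_ k) x - s (u_ m) x| by [].
nra.
Qed.

(** Along an ultrafilter finer than [\oo] every functional [s (u_ k) x] converges, so [rellich]
    makes [s] of the differences small on a set of the ultrafilter. Choosing [sg j] in the sets of
    index 0 to j replaces the diagonal extraction; [sg] tends to infinity but need not be
    increasing. *)
Lemma compact_subsequence (u_ : nat -> E) (M : R) : (forall k, D (u_ k)) ->
  (forall k, h (u_ k) (u_ k) <= M) ->
  exists2 sg : nat -> nat, forall k, (k <= sg k)%N & cauchy_in s (u_ \o sg).
Proof.
move=> Du uM.
have M0 : 0 <= M by apply: le_trans (uM 0%N); exact: (semi_inner_ge0 HD).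
have Lu k : L (u_ k) by exact: DL.
have sM k : s (u_ k) (u_ k) <= M by apply: le_trans (uM k); exact: sh.
have [G [UG ooG]] := @ultraFilterLemma nat \oo _.
have small e : 0 < e -> exists2 A, G A & forall k l, A k -> A l ->
    s (u_ k - u_ l) (u_ k - u_ l) < e.
  (* The form of a difference is at most [4 M], so the first term of [rellich] takes at most half of
     [e]. *)
  move=> e0; have [|b Lb Hb] := rellich (e := e / (8 * (M + 1))).
    by rewrite divr_gt0// mulr_gt0// ltr_wpDl.
  have [|A GA HA] := ultra_small_sum UG Lu sM Lb (d := e / 2); first by rewrite divr_gt0.
  exists A => // k l Ak Al; have := HA k l Ak Al.
  have := Hb _ (in_B HD (Du k) (Du l)).
  have : e / (8 * (M + 1)) * h (u_ k - u_ l) (u_ k - u_ l) <= e / 2.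
    rewrite mulrAC ler_pdivrMr ?mulr_gt0 ?ltr_wpDl//.
    have := hB_le HD (Du k) (Du l); have := uM k; have := uM l.
    nra.
  lra.
have /choice[A AP] : forall j : nat, exists A : set nat, G A /\ forall k l, A k -> A l ->
    s (u_ k - u_ l) (u_ k - u_ l) < j.+1%:R^-1.
  by move=> j; have [|A ? ?] := small j.+1%:R^-1; [rewrite invr_gt0|exists A].
have GB j : G [set k | forall i, (i <= j)%N -> A i k].
  elim: j => [|j IH].
    by apply: filterS (AP 0%N).1 => k Ak i; rewrite leqn0 => /eqP ->.
  apply: filterS (filterI IH (AP j.+1).1) => k [Bk Ak] i.
  by rewrite leq_eqVlt => /predU1P[->//|]; rewrite ltnS; exact: Bk.
have /choice[sg sgP] : forall j : nat, exists k, (forall i, (i <= j)%N -> A i k) /\ (j <= k)%N.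
  move=> j; have Gj : G [set k | (j <= k)%N] by apply: ooG; exists j.
  have [k [k1 k2]] := @filter_ex _ G _ _ (filterI (GB j) Gj).
  by exists k.
exists sg; first by move=> k; case: (sgP k).
move=> e e0; have [N HN] := inv_succ_small e0.
exists N => k l Nk Nl /=; apply: lt_trans (HN N (leqnn _)).
by apply: (AP N).2; [case: (sgP k) => + _; apply|case: (sgP l) => + _; apply].
Qed.

(** The equation H u = f tested with real parts only; as [D] is stable under multiplication by i,
    this contains the imaginary part too. *)
Definition weak_sol u f := [/\ D u, L f & forall v, D v -> h u v = s f v].

Lemma weak_solZ z u f : weak_sol u f -> weak_sol (z *: u) (z *: f).
Proof.
move=> [Du Lf uf]; split; [exact: (in_Z HD)|exact: (in_Z HL)|].
move=> v Dv; rewrite (hconj HD)// (hconj HL)//; last exact: DL.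
by apply: uf; exact: (in_Z HD).
Qed.

Lemma weak_solD u f u' f' : weak_sol u f -> weak_sol u' f' -> weak_sol (u + u') (f + f').
Proof.
move=> [Du Lf uf] [Du' Lf' uf']; split; [exact: (in_D HD)|exact: (in_D HL)|].
by move=> v Dv; rewrite (semi_innerDl HD)// (semi_innerDl HL)// ?uf ?uf'//; exact: DL.
Qed.

Lemma eigen_bound l u : weak_sol u (l *: u) -> h u u <= (sqmod l + 1) * s u u.
Proof.
move=> [Du _ uu]; rewrite uu//; have Lu := DL Du.
have := h_bound HL (in_Z HL l Lu) Lu ltr01; rewrite (hZZ HL)// invr1 !mul1r.
have : 0 <= sqmod l * s u u.
  by rewrite mulr_ge0 ?(semi_inner_ge0 HL)// addr_ge0// sqr_ge0.
have := semi_inner_ge0 HL Lu.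
lra.
Qed.

(** Test with i u: the form gives 0, the right-hand side gives the imaginary part of [l] times
    [s u u]. *)
Lemma eigen_real l u : weak_sol u (l *: u) -> 0 < s u u -> complex.Im l = 0.
Proof.
move=> [Du _ uu] u0; have Lu := DL Du.
have Diu := in_Z HD 'i%C Du; have Liu := DL Diu.
have hi : h u ('i%C *: u) = 0.
  by have := hir HD Du Du; rewrite (semi_innerC HD Diu Du); lra.
have si : s u ('i%C *: u) = 0.
  by have := hir HL Lu Lu; rewrite (semi_innerC HL Liu Lu); lra.
have sii : s ('i%C *: u) ('i%C *: u) = s u u.
  by rewrite (hZZ HL)// /sqmod/= expr0n expr1n add0r mul1r.
have := uu _ Diu; rewrite hi {1}(complexE l) scalerDl mulrC -scalerA.
rewrite (semi_innerDl HL)//; [|exact: (in_Z HL)..].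
rewrite !(semi_innerZl HL)// si sii mulr0 add0r => /esym/eqP.
by rewrite mulf_eq0 (gt_eqF u0) orbF => /eqP.
Qed.

Lemma eigen_orthogonal l l' u v : weak_sol u (l *: u) -> weak_sol v (l' *: v) ->
  complex.Im l = 0 -> complex.Im l' = 0 -> l != l' -> s u v = 0.
Proof.
move=> [Du _ uu] [Dv _ vv] il il' ll'.
have Lu := DL Du; have Lv := DL Dv.
have e1 : h u v = complex.Re l * s u v.
  by rewrite uu// {1}(complexE l) il rmorph0 mulr0 addr0 (semi_innerZl HL).
have e2 : h v u = complex.Re l' * s u v.
  by rewrite vv// {1}(complexE l') il' rmorph0 mulr0 addr0 (semi_innerZl HL)// (semi_innerC HL).
have : (complex.Re l - complex.Re l') * s u v = 0.
  by rewrite mulrBl -e1 -e2 (semi_innerC HD)// subrr.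
move/eqP; rewrite mulf_eq0 => /orP[|/eqP//]; rewrite subr_eq0 => /eqP ll.
by case/eqP: ll'; rewrite (complexE l) (complexE l') il il' ll.
Qed.

(** On an eigenspace [h] is bounded by a multiple of [s], so by [rellich] the finite vector [phi u]
    determines u up to a null vector. A maximal family of eigenvectors with linearly independent
    images therefore spans, even with real coefficients. *)
Lemma eigen_finite l : exists (m : nat) (e : 'I_m -> E), forall u, weak_sol u (l *: u) ->
  exists c : 'I_m -> R[i], let w := u - \sum_(k < m) c k *: e k in L w /\ s w w = 0.
Proof.
have M0 : 0 < sqmod l + 1 by rewrite ltr_wpDl// addr_ge0// sqr_ge0.
(* With [eigen_bound], this value makes the form term at most half of the left-hand side, where it
   is absorbed. *)
have [|b Lb Hb] := rellich (e := (2 * (sqmod l + 1))^-1); first by rewrite invr_gt0 mulr_gt0.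
have {}Hb u : weak_sol u (l *: u) -> s u u <= 2 * \sum_(x <- b) s u x ^+ 2.
  move=> su; have [Du _ _] := su.
  have := Hb u Du; have := eigen_bound su.
  rewrite -(ler_pM2l (_ : 0 < (2 * (sqmod l + 1))^-1)) ?invr_gt0 ?mulr_gt0//.
  rewrite [X in _ <= X -> _](_ : _ = s u u / 2); first lra.
  by field; rewrite gt_eqF.
pose N := size b.
pose phi u : 'rV[R]_N := \row_i s u (nth 0 b i).
have Lbi (i : 'I_N) : L (nth 0 b i) by apply: Lb; exact: mem_nth.
pose P m := `[< exists X : seq E, [/\ size X = m, forall x, x \in X -> weak_sol x (l *: x)
   & free (map phi X)] >].
have P0 : exists m, P m.
  by exists 0%N; apply/asboolP; exists [::]; split => //; exact: nil_free.
have PN m : P m -> (m <= N)%N.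
  move=> /asboolP[X [<- _]]; rewrite /free size_map => /eqP <-.
  by apply: leq_trans (dimvS (subvf _)) _; rewrite dimvf /dim/= mul1n.
have [m /asboolP[X [Xm XS Xf]] mmax] := ex_maxnP P0 PN.
exists (size X), (fun i => X`_i) => u su.
have DX (i : 'I_(size X)) : weak_sol X`_i (l *: X`_i) by apply: XS; exact: mem_nth.
have us : phi u \in <<map phi X>>%VS.
  apply/negPn/negP => nus; have : P m.+1.
    apply/asboolP; exists (u :: X); split; first by rewrite /= Xm.
      by move=> x; rewrite inE => /predU1P[->//|]; exact: XS.
    by rewrite /= free_cons nus Xf.
  by move=> /mmax; rewrite ltnn.
have := @coord_span _ _ _ (in_tuple (map phi X)) (phi u) us.
set c := fun i => coord (in_tuple (map phi X)) i (phi u) => uE.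
have sX : size (map phi X) = size X by rewrite size_map.
pose c' (i : 'I_(size X)) := c (cast_ord (esym sX) i).
exists (fun i => (c' i)%:C%C) => w.
have sumS : weak_sol (\sum_(k < size X) (c' k)%:C%C *: X`_k) (l *: \sum_(k < size X) (c' k)%:C%C *: X`_k).
  apply: (big_ind (fun x => weak_sol x (l *: x))).
  - rewrite scaler0; split; [exact: (semi_inner0 HD)|exact: (semi_inner0 HL)|].
    by move=> v Dv; rewrite (h0l HD)// (h0l HL)//; exact: DL.
  - by move=> x y sx sy; rewrite scalerDr; exact: weak_solD.
  - by move=> i _; rewrite scalerA mulrC -scalerA; exact: weak_solZ.
have sw : weak_sol w (l *: w).
  rewrite /w -scaleN1r scalerDr; apply: weak_solD => //.
  by rewrite scalerA mulrC -scalerA; exact: weak_solZ.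
have [Dw _ _] := sw; have Lw := DL Dw; split => //.
have phiw : phi w = 0.
  apply/rowP => j; rewrite !mxE.
  have -> : s w b`_j = s u b`_j - s (\sum_(k < size X) (c' k)%:C%C *: X`_k) b`_j.
    by rewrite /w (hBl HL)//; [case: su => /DL|case: sumS => /DL].
  have -> : s u b`_j = phi u 0 j by rewrite mxE.
  have -> : s (\sum_(k < size X) (c' k)%:C%C *: X`_k) b`_j = \sum_(k < size X) c' k * s X`_k b`_j.
    have LX k : L X`_k.
      have [kX|kX] := ltnP k (size X); last by rewrite nth_default//; exact: (semi_inner0 HL).
      by have [/DL] := DX (Ordinal kX).
    suff [] : L (\sum_(k < size X) (c' k)%:C%C *: X`_k) /\
       s (\sum_(k < size X) (c' k)%:C%C *: X`_k) b`_j = \sum_(k < size X) c' k * s X`_k b`_j by [].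
    apply: (big_ind2 (fun x y => L x /\ s x b`_j = y)).
    - by split; [exact: (semi_inner0 HL)|rewrite (h0l HL)].
    - by move=> x1 x2 y1 y2 [? <-] [? <-]; split; [exact: (in_D HL)|rewrite (semi_innerDl HL)].
    - by move=> i _; split; [exact: (in_Z HL)|rewrite (semi_innerZl HL)].
  rewrite {1}uE summxE.
  rewrite [X in X - _](_ : _ = \sum_(k < size X) c' k * s X`_k b`_j) ?subrr//.
  rewrite (reindex (cast_ord (esym sX)))/=; last first.
    by exists (cast_ord sX) => i _; rewrite ?cast_ordK ?cast_ordKV.
  apply: eq_bigr => i _; rewrite mxE /c' (nth_map 0)//; by rewrite mxE.
apply/eqP; rewrite eq_le (semi_inner_ge0 HL)// andbT.
apply: le_trans (Hb _ sw) _; rewrite pmulr_rle0//.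
rewrite (big_nth 0) big_mkord big1// => i _.
by have /rowP/(_ i) := phiw; rewrite !mxE => ->; rewrite expr0n.
Qed.

(** Otherwise there are normalized eigenvectors whose eigenvalues tend to [l]. They are bounded in
    the form and so have an [s]-Cauchy subsequence, whereas eigenvectors for different eigenvalues
    are at squared distance 2. *)
Lemma eigen_isolated l : exists2 e : R, 0 < e & forall l' u, weak_sol u (l' *: u) ->
  0 < s u u -> sqmod (l' - l) < e ^+ 2 -> l' = l.
Proof.
apply: contrapT => nex.
have /choice[p pP] : forall k : nat, exists p : R[i] * E, [/\ weak_sol p.2 (p.1 *: p.2),
    s p.2 p.2 = 1, sqmod (p.1 - l) < k.+1%:R^-1 ^+ 2 & p.1 != l].
  move=> k; apply: contrapT => nk; apply: nex; exists k.+1%:R^-1; first by rewrite invr_gt0.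
  move=> l' u su u0 ll; apply/eqP/negPn/negP => ne; apply: nk.
  exists (l', (Num.sqrt (s u u))^-1%:C%C *: u); split => //=.
    by rewrite scalerA mulrC -scalerA; exact: weak_solZ.
  have [/DL Lu _ _] := su.
  rewrite (hZZ HL)// /sqmod/= expr0n addr0 exprVn sqr_sqrtr ?ltW// mulVf//.
  by rewrite gt_eqF.
have im0 k : complex.Im (p k).1 = 0.
  by have [a b _ _] := pP k; apply: eigen_real a _; rewrite b.
have Dp k : D (p k).2 by have [[]] := pP k.
have bd k : h (p k).2 (p k).2 <= 2 + 2 * sqmod l + 1.
  have [a b c _] := pP k; have := eigen_bound a; rewrite b mulr1.
  have := sqmod_le2 (p k).1 l.
  have : k.+1%:R^-1 ^+ 2 <= 1 :> R by rewrite expr_le1 ?invr_ge0// invf_le1// ler1n.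
  move: (k.+1%:R^-1 ^+ 2) c => ek; lra.
have [sg sgk cs] := compact_subsequence Dp bd.
have [N HN] := cs 1 ltr01.
have d0 : 0 < sqmod ((p (sg N)).1 - l).
  have [_ _ _ ne] := pP (sg N); rewrite /sqmod.
  rewrite lt_neqAle addr_ge0 ?sqr_ge0// andbT eq_sym paddr_eq0 ?sqr_ge0// !sqrf_eq0.
  apply: contraNN ne => /andP[/eqP re0 /eqP im0'].
  by rewrite -subr_eq0 (complexE (_ - l)) re0 im0' rmorph0 mulr0 addr0.
(* The index [m] is taken so large that its eigenvalue is closer to [l] than the one of index
   [sg N], hence different from it. *)
have [N' HN'] := inv_succ_small d0.
pose m := maxn N N'.
have Nm : (N <= m)%N by exact: leq_maxl.
have ne : (p (sg N)).1 != (p (sg m)).1.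
  apply/negP => /eqP e; have [_ _ + _] := pP (sg m); rewrite -e ltNge => /negP; apply.
  have N'm : (N' <= sg m)%N by apply: leq_trans (leq_maxr N N') (sgk m).
  apply: (le_trans _ (ltW (HN' _ N'm))).
  by rewrite expr2 ler_piMl// ?invr_ge0// invf_le1// ler1n.
have [a1 b1 _ _] := pP (sg N); have [a2 b2 _ _] := pP (sg m).
have := HN N m (leqnn _) Nm.
rewrite /= (hBB HL); [|by apply: DL..].
by rewrite b1 b2 (eigen_orthogonal a1 a2 (im0 _) (im0 _) ne); lra.
Qed.

(** * The resolvent away from the eigenvalues *)

Section solve.
Variable l : R[i].

(** This w is the weak solution of H w = g, by Riesz in the form domain. The implication sits inside
    the existential so that [choice] yields a total function. *)
Lemma K_exists g : exists w, L g -> D w /\ forall v, D v -> h w v = s g v.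
Proof.
have [Lg|nLg] := pselect (L g); last by exists 0.
have [|||w Dw Hw] := riesz (F := s g) (M := s g g) HD cD.
- by move=> u v Du Dv; rewrite (hDr HL)//; exact: DL.
- by move=> r u Du; rewrite (hZr HL)//; exact: DL.
- move=> u Du; apply: le_trans (cauchy_schwarz HL Lg (DL Du)) _.
  by rewrite ler_wpM2l ?(semi_inner_ge0 HL)// sh.
by exists w.
Qed.

Let K := projT1 (choice K_exists).

Let DK g : L g -> D (K g).
Proof. by move=> Lg; have [] := (projT2 (choice K_exists)) g Lg. Qed.

Let hK g v : L g -> D v -> h (K g) v = s g v.
Proof. by move=> Lg Dv; have [_] := (projT2 (choice K_exists)) g Lg; apply. Qed.

(** In the form inner product H - l becomes the bounded operator 1 - l K: solving (H - l) u = g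
    means that [A u - K g] is null. [q] is the squared norm of [A u], polarized. *)
Let A u := u - l *: K u.
Let q u v := h (A u) (A v).

Let DA u : D u -> D (A u).
Proof. by move=> Du; apply: (in_B HD) => //; apply: (in_Z HD); apply/DK/DL. Qed.

Let hA u v : D u -> D v -> h (A u) v = h u v - s (l *: u) v.
Proof.
move=> Du Dv; have Lu := DL Du; rewrite /A (hBl HD)//; last exact/(in_Z HD)/DK.
rewrite (hconj HD) ?hK ?(hconj HL)//; [exact: DL|exact: (in_Z HD)|exact: DK].
Qed.

Let Hq : semi_inner D q.
Proof.
split.
- exact: (semi_inner0 HD).
- exact: (semi_innerP HD).
- by move=> u v Du Dv; rewrite /q (semi_innerC HD); auto.
- move=> u v w Du Dv Dw; have Duv := in_D HD Du Dv.
  rewrite /q !hA; auto; rewrite (semi_innerDl HD); auto; rewrite scalerDr.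
  by rewrite (semi_innerDl HL); [ring|apply: (in_Z HL); exact: DL..|exact/DL/DA].
- move=> r u v Du Dv; have Dru := in_Z HD r%:C%C Du.
  rewrite /q !hA; auto; rewrite (semi_innerZl HD); auto; rewrite scalerA (mulrC l) -scalerA.
  by rewrite (semi_innerZl HL); [ring|apply: (in_Z HL); exact: DL|exact/DL/DA].
- move=> u v Du Dv; have Diu := in_Z HD 'i%C Du; have Div := in_Z HD 'i%C Dv.
  have e1 w : D w -> h (A ('i%C *: u)) w = - h (A u) ('i%C *: w).
    move=> Dw; have Diw := in_Z HD 'i%C Dw.
    rewrite !hA// (semi_inneri HD)// scalerA mulrC -scalerA (semi_inneri HL).
    + by rewrite opprB opprK addrC.
    + by apply: (in_Z HL); exact: DL.
    + exact: DL.
  rewrite /q e1; last exact: DA.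
  congr (- _); rewrite (semi_innerC HD); [|exact: DA|exact/(in_Z HD)/DA].
  rewrite (semi_innerC HD (DA Du) (DA Div)).
  have e2 w : D w -> h (A ('i%C *: v)) w = - h (A v) ('i%C *: w).
    move=> Dw; have Diw := in_Z HD 'i%C Dw.
    rewrite !hA// (semi_inneri HD)// scalerA mulrC -scalerA (semi_inneri HL).
    + by rewrite opprB opprK addrC.
    + by apply: (in_Z HL); exact: DL.
    + exact: DL.
  by rewrite e2; [rewrite (semi_inneri HD)//; exact: DA|exact: DA].
- by move=> u Du; apply: (semi_inner_ge0 HD); exact: DA.
Qed.

Let l0 : 0 <= sqmod l. Proof. by rewrite addr_ge0// sqr_ge0. Qed.

(** This upgrades convergence in [s] to convergence in [h] along sequences on which [q] tends to
    0. *)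
Let h_le_q u : D u -> h u u <= q u u + (1 + sqmod l) * s u u.
Proof.
move=> Du; have Lu := DL Du.
have := hA Du Du; have := h_bound HD (DA Du) Du ltr01.
have := h_bound HL (in_Z HL l Lu) Lu ltr01; rewrite (hZZ HL)// invr1 !mul1r -/(q u u).
lra.
Qed.

Let q_le_h u : D u -> q u u <= (2 + 2 * sqmod l) * h u u.
Proof.
move=> Du; have Lu := DL Du; have Dk := DK Lu.
have := hB_le HD Du (in_Z HD l Dk); rewrite -/(A u) -/(q u u) (hZZ HD)//.
have : h (K u) (K u) <= h u u.
  have := hK Lu Dk; have := h_bound HL Lu (DL Dk) ltr01.
  rewrite invr1 !mul1r; have := sh Dk; have := sh Du; lra.
move=> kk; have := ler_wpM2l l0 kk; lra.
Qed.

Hypothesis no_eig : forall u, weak_sol u (l *: u) -> s u u = 0.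

(** If [A] were not bounded below, there would be unit vectors with [q] tending to 0. By compactness
    and [h_le_q] a subsequence converges in [h] to a unit vector w with [A w] null, a forbidden
    eigenvector. *)
Let coercive : exists2 C, 0 < C & forall u, D u -> h u u <= C * q u u.
Proof.
apply: contrapT => nex.
have /choice[x xP] : forall k : nat, exists x, [/\ D x, h x x = 1 & q x x <= k.+1%:R^-1].
  move=> k; apply: contrapT => nk; apply: nex; exists k.+1%:R => // u Du.
  rewrite leNgt; apply/negP => lt; apply: nk.
  have q0 := semi_inner_ge0 Hq Du.
  have hp : 0 < h u u by apply: le_lt_trans lt; rewrite mulr_ge0.
  have sc : sqmod ((Num.sqrt (h u u))^-1%:C%C) = (h u u)^-1 :> R.
    by rewrite /sqmod/= expr0n addr0 exprVn sqr_sqrtr// ltW.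
  exists ((Num.sqrt (h u u))^-1%:C%C *: u); split; first exact: (in_Z HD).
    by rewrite (hZZ HD)// sc mulVf// gt_eqF.
  rewrite (hZZ Hq)// sc mulrC ler_pdivrMr// ler_pdivlMl// ltW//.
have Dx k : D (x k) by have [] := xP k.
have bx k : h (x k) (x k) <= 1 by have [_ ->] := xP k.
have [sg sgk cs] := compact_subsequence Dx bx.
pose y := x \o sg.
have Dy k : D (y k) by exact: Dx.
have qy k : q (y k) (y k) <= k.+1%:R^-1.
  have [_ _ H] := xP (sg k); apply: le_trans H _.
  by rewrite lef_pV2 ?posrE// ler_nat ltnS.
have ch : cauchy_in h y.
  move=> e e0; have l1 : 0 < 1 + sqmod l by rewrite ltr_wpDr.
  have [|N1 H1] := cs (e / (2 * (1 + sqmod l))); first by rewrite divr_gt0// mulr_gt0.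
  have [|N2 H2] := @inv_succ_small _ (e / 8); first by rewrite divr_gt0.
  exists (maxn N1 N2) => k m; rewrite !geq_max => /andP[k1 k2] /andP[m1 m2].
  have := h_le_q (in_B HD (Dy k) (Dy m)).
  have := H1 k m k1 m1; rewrite ltr_pdivlMr ?mulr_gt0// /=.
  have := hB_le Hq (Dy k) (Dy m).
  have := qy k; have := qy m; have := H2 k k2; have := H2 m m2.
  rewrite -/(y k) -/(y m).
  move: (k.+1%:R^-1) (m.+1%:R^-1) => ek em; lra.
have [w Dw cw] := cD Dy ch.
have hw : h w w = 1.
  have := cvg_hh HD Dy Dw cw.
  rewrite (_ : (fun k => _) = cst 1); last first.
    by apply/funext => k /=; have [] := xP (sg k).
  by move=> c1; exact: (cvg_unique _ c1 (@cvg_cst _ _ _ _ _)).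
have qw : q w w = 0.
  apply/eqP; rewrite eq_le (semi_inner_ge0 Hq)// andbT.
  apply/ler_addgt0Pr => e e0; rewrite add0r.
  have c0 : 0 < 2 + 2 * sqmod l by rewrite ltr_wpDr// mulr_ge0.
  move/cvg0P : cw => /(_ (e / (4 * (2 + 2 * sqmod l)))).
  rewrite divr_gt0// ?mulr_gt0// => /(_ isT)[N1 H1].
  have [|N2 H2] := @inv_succ_small _ (e / 4); first by rewrite divr_gt0.
  pose k := maxn N1 N2.
  have := H1 k (leq_maxl _ _); rewrite ltr_norml => /andP[_].
  rewrite ltr_pdivlMr ?mulr_gt0// (hBC HD)//.
  have := q_le_h (in_B HD Dw (Dy k)).
  have := hD_le Hq (in_B HD Dw (Dy k)) (Dy k); rewrite subrK.
  have := qy k; have := H2 k (leq_maxr _ _).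
  move: (k.+1%:R^-1) => ek; lra.
have sw : weak_sol w (l *: w).
  split=> //; first exact/(in_Z HL)/DL.
  move=> v Dv; have := hA Dw Dv; rewrite (null_hl HD (DA Dw) Dv qw); lra.
have s0 := no_eig sw; have [_ _ /(_ _ Dw)] := sw; have Lw := DL Dw.
rewrite hw (hconj HL)// (null_hl HL)//; last exact: (in_Z HL).
by move/eqP; rewrite oner_eq0.
Qed.

Lemma resolvent_bound : exists C : R, forall u g, L g -> weak_sol u (l *: u + g) ->
  s u u <= C * s g g.
Proof.
have [C C0 HC] := coercive; exists C => u g Lg [Du _ ug]; have Lu := DL Du.
have gA v : D v -> h (A u) v = s g v.
  move=> Dv; rewrite hA// ug// (semi_innerDl HL)//; [ring|exact: (in_Z HL)|exact: DL].
have := gA _ (DA Du); rewrite -/(q u u) => qg.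
have := h_bound HL Lg (DL (DA Du)) ltr01; rewrite invr1 !mul1r -qg.
have := sh (DA Du); rewrite -/(q u u) => a b.
have c : q u u <= s g g by lra.
apply: le_trans (sh Du) _; apply: le_trans (HC _ Du) _.
by rewrite ler_pM2l.
Qed.

Hypothesis no_eigC : forall u, weak_sol u (conjc l *: u) -> s u u = 0.

(* Least squares: the residual of a minimiser of [h (A w - K g) (A w - K g)] is an
   eigenvector for the conjugate of [l]. *)
Lemma resolvent_solve g : L g -> exists u, weak_sol u (l *: u + g).
Proof.
move=> Lg; have [C C0 HC] := coercive.
have Dg := DK Lg.
(* By [coercive] and [q_le_h], the forms [q] and [h] are equivalent. *)
have cq : complete_in D q.
  move=> u_ Du_ cu; have ch : cauchy_in h u_.
    move=> e e0; have [|N HN] := cu (e / C); first by rewrite divr_gt0.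
    exists N => k m Nk Nm; apply: le_lt_trans (HC _ (in_B HD (Du_ k) (Du_ m))) _.
    by have := HN k m Nk Nm; rewrite ltr_pdivlMr// mulrC.
  have [w Dw cw] := cD Du_ ch; exists w => //.
  apply: (@seq_squeeze0 _ _ (fun k => (2 + 2 * sqmod l) * h (u_ k - w) (u_ k - w))).
    move=> k; have Dk := in_B HD (Du_ k) Dw.
    by rewrite (semi_inner_ge0 Hq)//= q_le_h.
  by have := seq_cvgZ (r := 2 + 2 * sqmod l) cw; rewrite mulr0.
have FE v : D v -> h (K g) (A v) = h v (K g) - s (l *: v) (K g).
  by move=> Dv; rewrite (semi_innerC HD) ?hA//; exact: DA.
have [|||w Dw Hw] := riesz (F := fun v => h (K g) (A v)) (M := h (K g) (K g)) Hq cq.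
- move=> u v Du Dv; rewrite !FE//; last exact: (in_D HD).
  rewrite (semi_innerDl HD)// scalerDr (semi_innerDl HL); [ring|apply: (in_Z HL); exact: DL..|exact: DL].
- move=> r u Du; rewrite !FE//; last exact: (in_Z HD).
  rewrite (semi_innerZl HD)// scalerA (mulrC l) -scalerA (semi_innerZl HL); [ring|apply: (in_Z HL); exact: DL..|exact: DL].
- by move=> u Du; exact: (cauchy_schwarz HD Dg (DA Du)).
pose r := A w - K g.
have Dr : D r by apply: (in_B HD) => //; exact: DA.
have Lr := DL Dr.
have sr : weak_sol r (conjc l *: r).
  split=> //; first exact: (in_Z HL).
  move=> v Dv.
  have : h (A v) r = 0.
    rewrite (semi_innerC HD (DA Dv) Dr) /r (hBl HD (DA Dw) Dg (DA Dv)).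
    by have := Hw v Dv; rewrite /q => ->; rewrite subrr.
  rewrite hA// => /eqP; rewrite subr_eq0 => /eqP e.
  rewrite (semi_innerC HD)// e (hconj HL)//; [|exact: DL].
  by rewrite (semi_innerC HL)//; [exact: DL|exact: (in_Z HL)].
have s0 := no_eigC sr.
have hr0 : h r r = 0.
  have [_ _ ->//] := sr; rewrite (hconj HL)// (null_hl HL)//; exact: (in_Z HL).
exists w; split => //; first exact/(semi_innerP HL)/Lg/DL.
move=> v Dv; have Lw := DL Dw; have Lv := DL Dv.
have := null_hl HD Dr Dv hr0; rewrite (hBl HD)//; last exact: DA.
rewrite hA// hK// (semi_innerDl HL)//; [lra|exact: (in_Z HL)].
Qed.

End solve.

Lemma no_eig_conj l : (forall u, weak_sol u (l *: u) -> s u u = 0) ->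
  forall u, weak_sol u (conjc l *: u) -> s u u = 0.
Proof.
move=> nl u su; have [Du _ _] := su.
apply/eqP; rewrite eq_le (semi_inner_ge0 HL) ?andbT; last exact: DL.
rewrite leNgt; apply/negP => u0.
have := eigen_real su u0 => il.
have ll : conjc l = l.
  by case: (l) il => a b /= /eqP; rewrite oppr_eq0 => /eqP ->; rewrite oppr0.
by move: u0; rewrite nl ?ltxx// -ll.
Qed.

End spectral.

(** * Lebesgue measure on row vectors *)

Section rV_measure.
Context {R : realType}.

Lemma rV_normE n (x : 'rV[R]_n) (r : R) : 0 <= r -> (`|x| <= r) = [forall i, `|x 0 i| <= r].
Proof.
move=> r0; apply/idP/forallP => [xr i|H].
  apply: le_trans xr; rewrite /Num.Def.normr/= mx_normrE.
  exact: (le_bigmax _ (fun i : 'I_1 * 'I_n => `|x i.1 i.2|) (0, i)).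
rewrite /Num.Def.normr/= mx_normrE; apply: bigmax_le => //= -[i j] _ /=.
by rewrite (ord1 i).
Qed.

Lemma rV_norm_coord n (x : 'rV[R]_n) i : `|x 0 i| <= `|x|.
Proof. by have := rV_normE x (normr_ge0 x); rewrite lexx => /esym/forallP. Qed.

Lemma rV_norm_lt n (x : 'rV[R]_n) (r : R) : 0 < r -> (forall i, `|x 0 i| < r) -> `|x| < r.
Proof.
move=> r0 H; rewrite /Num.Def.normr/= mx_normrE; apply: bigmax_lt => //= -[i j] _ /=.
by rewrite (ord1 i).
Qed.

Lemma cubeE n (c : 'rV[R]_n) (d : R) : 0 <= d -> cube c d = [set x | `|x - c| <= d / 2].
Proof.
move=> d0; apply/seteqP; split => x /=; rewrite rV_normE ?divr_ge0//.
  by move=> H; apply/forallP => i; rewrite !mxE.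
by move=> /forallP H i; have := H i; rewrite !mxE.
Qed.

Lemma measurable_rV_box n (A : 'I_n -> set R) : (forall i, measurable (A i)) ->
  measurable [set x : 'rV[R]_n | forall i, A i (x 0 i)].
Proof.
move=> mA.
have -> : [set x : 'rV[R]_n | forall i, A i (x 0 i)] =
    \bigcap_(i in [set: 'I_n]) ((fun x : 'rV[R]_n => x 0 i) @^-1` A i).
  by apply/seteqP; split => x /= H i; [move=> _|]; exact: H.
apply: fin_bigcap_measurable => // i _.
rewrite -[X in measurable X]setTI.
exact: (measurable_rV_coord (n := n) i measurableT (mA i)).
Qed.

Lemma measurable_cube n (c : 'rV[R]_n) d : measurable (cube c d).
Proof.
apply: (@measurable_rV_box n (fun i => [set t | `|t - c 0 i| <= d / 2])) => i.
have -> : [set t | `|t - c 0 i| <= d / 2] = `[c 0 i - d / 2, c 0 i + d / 2]%classic.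
  by apply/seteqP; split => t /=; rewrite in_itv/= ler_distl.
exact: measurable_itv.
Qed.

(** The measurable sets are generated by the coordinates, so an open set is written as the countable
    union of the boxes it contains that have a rational center and half-edge [1/(k+1)]. *)
Lemma open_measurable_rV n (U : set 'rV[R]_n) : open U -> measurable U.
Proof.
move=> oU.
pose B (p : 'rV[rat]_n * nat) : set 'rV[R]_n :=
  [set x | forall i, [set t | `|t - ratr (p.1 0 i)| < p.2.+1%:R^-1] (x 0 i)].
pose F p := if pselect (B p `<=` U) then B p else set0.
have -> : U = \bigcup_p F p.
  apply/seteqP; split => [x Ux|x [p _]]; last first.
    by rewrite /F; case: pselect => // BU; exact: BU.
  have /nbhs_ballP[e /= e0 eU] := oU x Ux.
  (* Half of the radius, because a point of the box is reached from [x] through the rational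
     center. *)
  have [k ke] : exists k : nat, k.+1%:R^-1 < e / 2.
    have /cvgrPdist_lt/(_ (e / 2)) := @cvg_harmonic R.
    rewrite divr_gt0// => /(_ isT)[N _ /(_ N (leqnn N))] /=.
    by rewrite sub0r normrN ger0_norm ?invr_ge0//; exists N.
  have /choice[q qP] : forall i : 'I_n, exists q : rat, `|x 0 i - ratr q| < k.+1%:R^-1.
    move=> i; have lt : x 0 i - k.+1%:R^-1 < x 0 i + k.+1%:R^-1.
      by rewrite ltrD2l gtrN// invr_gt0.
    have [q] := rat_in_itvoo lt; rewrite in_itv/= => /andP[a b]; exists q.
    by rewrite distrC ltr_distl a b.
  exists (\row_i q i, k) => //; rewrite /F; case: pselect => [BU|nBU]; last first.
    exfalso; apply: nBU => y By; apply: eU; rewrite mx_norm_ball /ball_/=.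
    apply: rV_norm_lt => // i; rewrite !mxE.
    have := By i; rewrite /= mxE => By'; have := qP i => xq.
    rewrite -[X in X - _](subrK (ratr (q i))) -addrA.
    apply: (le_lt_trans (ler_normD _ _)); rewrite (distrC (ratr _)).
    apply: lt_trans (ltrD xq By') _.
    by move: (k.+1%:R^-1) ke => ek; lra.
  by move=> i /=; rewrite mxE; exact: qP.
apply: countable_bigcupT_measurable => [|p]; first exact: countableP.
rewrite /F; case: pselect => [BU|nBU]; last exact: measurable0.
apply: (@measurable_rV_box n (fun i => [set t : R | `|t - ratr (p.1 0 i)| < p.2.+1%:R^-1])) => i.
have -> : [set t : R | `|t - ratr (p.1 0 i)| < p.2.+1%:R^-1] = ball (ratr (p.1 0 i) : R) p.2.+1%:R^-1.
  by apply/seteqP; split => t; rewrite /ball/= distrC.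
exact: measurable_ball.
Qed.

Lemma continuous_measurable_rV n (f : 'rV[R]_n -> R) : continuous f -> measurable_fun setT f.
Proof.
move=> /continuousP cf; apply: (measurability _ (RGenOpens.measurableE R)).
move=> _ [_ [a [b ->] <-]]; rewrite setTI; apply: open_measurable_rV.
exact/cf/interval_open.
Qed.

Lemma measurable_rV_shift n (v : 'rV[R]_n) : measurable_fun setT (fun x : 'rV[R]_n => x + v).
Proof.
apply: measurable_fun_rVP => i.
rewrite (_ : (fun t => _) = (fun x : 'rV[R]_n => x 0 i + v 0 i)); last first.
  by apply/funext => x; rewrite mxE.
by apply: measurable_funD => //; exact: measurable_rV_coord.
Qed.

Local Notation mu n := (@lebesgue_rV R n).

Lemma integral_rV_cons n (f : 'rV[R]_n.+1 -> \bar R) : measurable_fun setT f ->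
  (forall x, 0 <= f x)%E ->
  (\int[mu n.+1]_x f x = \int[lebesgue_measure]_x \int[mu n]_y f (rV_cons (x, y)))%E.
Proof.
move=> mf f0; rewrite [LHS]/=.
have mc := @measurable_rV_cons R n.
rewrite (@ge0_integral_pushforward _ _ _ _ R _ mc _ setT f)//.
rewrite preimage_setT fubini_tonelli1//=.
exact: measurableT_comp.
Qed.

(** The translated measure gives half-open intervals their length, which characterizes Lebesgue
    measure. *)
Lemma lebesgue_shift (c : R) (f : measurableTypeR R -> \bar R) : measurable_fun setT f -> (forall x, 0 <= f x)%E ->
  (\int[lebesgue_measure]_x f (x + c)%R = \int[lebesgue_measure]_x f x)%E.
Proof.
move=> mf f0.
have ms : @measurable_fun _ _ (measurableTypeR R) (measurableTypeR R) setT (fun x : R => x + c).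
  by apply: measurable_funD.
have e (A : set R) : measurable A -> lebesgue_measure A = pushforward lebesgue_measure (fun x => x + c) A.
  move=> mA; pose g : {mfun measurableTypeR R >-> measurableTypeR R} := @mfun_Sub _ _ (measurableTypeR R) (measurableTypeR R) _ (mem_set ms).
  apply: (@lebesgue_measure_unique R (pushforward lebesgue_measure g) _ A mA).
  move=> X [[a b] /= _ <-]; rewrite /pushforward.
  rewrite (_ : _ @^-1` _ = `]a - c, b - c]%classic); last first.
    by apply/seteqP; split => x /=; rewrite !in_itv/= ltrBlDr lerBrDr.
  rewrite !lebesgue_measure_itv/= !lte_fin ltrD2r; case: ifP => // _.
  by rewrite -!EFinB; congr (_%:E); ring.
transitivity (\int[pushforward lebesgue_measure (fun x : measurableTypeR R => (x + c)%R : measurableTypeR R)]_x f x)%E.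
  by rewrite ge0_integral_pushforward// preimage_setT.
by apply: eq_measure_integral => A mA _; first [exact: e|exact/esym/e].
Qed.

Lemma integral_rV_shift n (v : 'rV[R]_n) (f : 'rV[R]_n -> \bar R) :
  measurable_fun setT f -> (forall x, 0 <= f x)%E ->
  (\int[mu n]_x f (x + v)%R = \int[mu n]_x f x)%E.
Proof.
elim: n v f => [|n IH] v f mf f0.
  by apply: eq_integral => x _; congr f; apply/rowP => -[].
rewrite !integral_rV_cons//; last first.
  exact: measurableT_comp mf (measurable_rV_shift v).
have vc : v = rV_cons (v 0 0, \row_i v 0 (lift 0 i)).
  apply/rowP => i; case: (unliftP 0 i) => [j|] ->; first by rewrite rV_consS mxE.
  by rewrite rV_cons0.
have addc (x y : R) (p q : 'rV[R]_n) : rV_cons (x, p) + rV_cons (y, q) = rV_cons (x + y, p + q).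
  apply/rowP => i; rewrite mxE; case: (unliftP 0 i) => [j|] ->; first by rewrite !rV_consS mxE.
  by rewrite !rV_cons0.
pose g x := (\int[mu n]_y f (rV_cons (x, y)))%E.
have mfc : measurable_fun setT (f \o @rV_cons R n).
  by apply: measurableT_comp mf _; exact: measurable_rV_cons.
transitivity (\int[lebesgue_measure]_x g (x + v 0 0)%R)%E; last first.
  rewrite lebesgue_shift//; last by move=> x; exact: integral_ge0.
  apply: (measurable_fun_fubini_tonelli_F (m2 := mu n) (f \o @rV_cons R n)) => // x; exact: f0.
apply: eq_integral => x _; rewrite /g.
rewrite [in LHS]vc.
under eq_integral do rewrite addc.
rewrite (IH _ (fun y => f (rV_cons (x + v 0 0, y))))//.
by apply: (measurableT_comp mfc); exact: measurable_pair1.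
Qed.

Lemma lebesgue_cube n (c : 'rV[R]_n) (d : R) : 0 <= d -> mu n (cube c d) = (d ^+ n)%:E.
Proof.
move=> d0; elim: n c => [|n IH] c.
  rewrite /= diracE mem_set ?expr0//.
  by case.
rewrite /= /rV_measureS /pushforward.
have -> : @rV_cons R n @^-1` cube c d =
   `[c 0 0 - d / 2, c 0 0 + d / 2]%classic `*` cube (\row_i c 0 (lift 0 i)) d.
  apply/seteqP; split => -[x y] /=.
    move=> H; split.
      by have := H 0; rewrite rV_cons0/= in_itv/= ler_distl.
    by move=> i; have := H (lift 0 i); rewrite rV_consS/= mxE.
  move=> [/= xi H] i; case: (unliftP 0 i) => [j|] ->.
    by rewrite rV_consS/=; have := H j; rewrite mxE.
  by rewrite rV_cons0/=; move: xi; rewrite in_itv/= ler_distl.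
rewrite product_measure1E//; [|exact: measurable_cube].
suff L : lebesgue_measure (`[c 0 0 - d / 2, c 0 0 + d / 2]%classic : set R) = d%:E.
  by rewrite IH [X in (X * _)%E](_ : _ = d%:E) ?exprS ?EFinM.
have e : c 0 0 + d / 2 - (c 0 0 - d / 2) = d by lra.
rewrite lebesgue_measure_itv/= lte_fin; case: ifPn => [_|]; first by rewrite -EFinB e.
by rewrite -leNgt => H; congr (_%:E); apply/eqP; rewrite eq_le d0; lra.
Qed.

End rV_measure.

Section null_lines.
Context {R : realType} (n : nat).
Local Notation mu := (@lebesgue_rV R n).

(* Translation invariance gives [mu A = \int_x \1_A (x + t v)] for every [t];
   integrating over [t] in [0, 1] and swapping the integrals yields 0. *)
Lemma null_lines (A : set 'rV[R]_n) (v : 'rV[R]_n) : measurable A ->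
  (forall x, lebesgue_measure [set t : R | A (x + t *: v)] = 0%E) -> mu A = 0%E.
Proof.
move=> mA A0.
pose phi (p : measurableTypeR R * 'rV[R]_n) : 'rV[R]_n := p.2 + p.1 *: v.
have mphi : measurable_fun setT phi.
  apply: measurable_fun_rVP => i.
  rewrite (_ : (fun t => _) = (fun p : measurableTypeR R * 'rV[R]_n => p.2 0 i + p.1 * v 0 i)); last first.
    by apply/funext => p; rewrite /phi !mxE.
  apply: measurable_funD.
    exact: (measurableT_comp (measurable_rV_coord i) measurable_snd).
  by apply: measurable_funM => //; exact: measurable_fst.
pose I : set (measurableTypeR R) := `[0, 1]%classic.
pose f (p : measurableTypeR R * 'rV[R]_n) : \bar R := (\1_A (phi p) * \1_I p.1)%:E.
have f0 p : (0 <= f p)%E by rewrite lee_fin mulr_ge0.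
have mf : measurable_fun setT f.
  apply/measurable_EFinP; apply: measurable_funM.
    by apply: measurableT_comp => //; exact: measurable_indic.
  have mI : measurable_fun setT (\1_I : measurableTypeR R -> R).
    by apply: measurable_indic; exact: measurable_itv.
  exact: (measurableT_comp mI measurable_fst).
have e1 : (\int[lebesgue_measure]_t \int[mu]_x f (t, x) = mu A)%E.
  transitivity (\int[lebesgue_measure]_t (mu A * (\1_I t)%:E))%E.
    apply: eq_integral => t _; rewrite /f/=.
    under eq_integral do rewrite mulrC EFinM.
    rewrite ge0_integralZl//; last first.
      have mIA : measurable_fun setT (\1_A : 'rV[R]_n -> R) by exact: measurable_indic.
      by apply/measurable_EFinP; exact: (measurableT_comp mIA (measurable_rV_shift (t *: v))).
    rewrite muleC; congr (_ * _)%E.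
    rewrite /phi/= (integral_rV_shift (t *: v) (f := fun x => (\1_A x)%:E)).
      by rewrite integral_indic// setIT.
      by apply/measurable_EFinP; exact: measurable_indic.
    by move=> x; rewrite lee_fin.
  rewrite ge0_integralZl//; last first.
    by apply/measurable_EFinP; apply: measurable_indic; exact: measurable_itv.
  rewrite integral_indic ?setIT//; last exact: measurable_itv.
  have mI : lebesgue_measure I = 1%E.
    by rewrite /I lebesgue_measure_itv/= lte_fin ltr01 -EFinB subr0.
  by rewrite [X in (_ * X)%E](_ : _ = 1%E) ?mule1.
rewrite -e1 (fubini_tonelli (m1 := lebesgue_measure) (m2 := mu) f)//.
apply: integral0_eq => x _.
have mt : measurable [set t : measurableTypeR R | A (x + t *: v)].
  have := measurableT_comp mphi (measurable_pair2 x) => mc.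
  by rewrite -[X in measurable X]setTI; exact: mc.
apply/eqP; rewrite eq_le integral_ge0// andbT -(A0 x).
rewrite -[X in (_ <= lebesgue_measure X)%E]setIT -(integral_indic _ measurableT mt).
apply: ge0_le_integral => //.
- by apply: (measurableT_comp mf); exact: measurable_pair2.
- by apply/measurable_EFinP; exact: measurable_indic.
- move=> t _; by rewrite /f /phi lee_fin/= ler_piMr.
Qed.

End null_lines.

(** * Bounded measurable functions of bounded support *)

Section bounded_compact_support.
Context {R : realType} {n : nat}.
Local Notation mu := (@lebesgue_rV R n).
Implicit Types f g : 'rV[R]_n -> R.

(** All real integrals below are taken over this class or over square-integrable functions. It is
    stable under sums, products, translations and, for C^1 functions, partial derivatives, so
    integrability reduces to the shape of the integrand. *)
Definition bcs f := [/\ measurable_fun setT f, exists M, forall x, `|f x| <= M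
  & exists r, forall x, r < `|x| -> f x = 0].

Definition locally_bounded f := forall r, exists M, forall x, `|x| <= r -> `|f x| <= M.

Lemma bcs0 : bcs (fun=> 0).
Proof. by split=> //; exists 0 => // x; rewrite normr0. Qed.

Lemma bcsD f g : bcs f -> bcs g -> bcs (fun x => f x + g x).
Proof.
move=> [mf [M fM] [r fr]] [mg [N gN] [s gs]]; split; first exact: measurable_funD.
  exists (M + N) => x; apply: le_trans (ler_normD _ _) _; exact: lerD.
by exists (Num.max r s) => x; rewrite gt_max => /andP[? ?]; rewrite fr ?gs ?addr0.
Qed.

Lemma bcsM f g : bcs f -> measurable_fun setT g -> locally_bounded g -> bcs (fun x => f x * g x).
Proof.
move=> [mf [M fM] [r fr]] mg lg; split; first exact: measurable_funM.
  have [N gN] := lg r; exists (M * Num.max N 0) => x.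
  have M0 : 0 <= M by apply: le_trans (fM 0).
  have [xr|xr] := leP `|x| r; last by rewrite fr// mul0r normr0 mulr_ge0// le_max lexx orbT.
  by rewrite normrM ler_pM// le_max gN.
by exists r => x xr; rewrite fr// mul0r.
Qed.

Lemma bcsZ k f : bcs f -> bcs (fun x => k * f x).
Proof.
move=> [mf [M fM] [r fr]]; split; first exact: measurable_funM.
  by exists (`|k| * M) => x; rewrite normrM ler_wpM2l.
by exists r => x xr; rewrite fr// mulr0.
Qed.

Lemma bcsN f : bcs f -> bcs (fun x => - f x).
Proof. by move=> /(bcsZ (-1)); under eq_fun do rewrite mulN1r. Qed.

Lemma bcsB f g : bcs f -> bcs g -> bcs (fun x => f x - g x).
Proof. by move=> bf /bcsN; exact: bcsD. Qed.

Lemma bcs_sum (I : Type) (s : seq I) (F : I -> 'rV[R]_n -> R) :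
  (forall i, bcs (F i)) -> bcs (fun x => \sum_(i <- s) F i x).
Proof.
move=> bF; elim: s => [|i s IH].
  by under eq_fun do rewrite big_nil; exact: bcs0.
by under eq_fun do rewrite big_cons; exact: bcsD.
Qed.

Lemma bcs_locally_bounded f : bcs f -> locally_bounded f.
Proof. by move=> [_ [M fM] _] r; exists M. Qed.

Lemma bcs_measurable f : bcs f -> measurable_fun setT f.
Proof. by case. Qed.

Lemma bcsMb f g : bcs f -> bcs g -> bcs (fun x => f x * g x).
Proof. by move=> bf bg; apply: bcsM => //; [exact: bcs_measurable|exact: bcs_locally_bounded]. Qed.

Lemma bcs_indic_cube f (c : 'rV[R]_n) d : measurable_fun setT f -> locally_bounded f ->
  0 <= d -> bcs (fun x => \1_(cube c d) x * f x).
Proof.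
move=> mf lf d0; apply: bcsM => //; split.
- by apply: measurable_indic; exact: measurable_cube.
- by exists 1 => x; rewrite indicE; case: (_ \in _); rewrite ?normr1 ?normr0.
- exists (`|c| + d / 2) => x xr; rewrite indicE memNset// cubeE//= => H.
  have := ler_normD (x - c) c; rewrite subrK; lra.
Qed.

Lemma bcs_integrable f : bcs f -> mu.-integrable setT (EFin \o f).
Proof.
move=> [mf [M fM] [r fr]].
have M0 : 0 <= M by apply: le_trans (fM 0).
pose d := 2 * Num.max r 0.
have d0 : 0 <= d by rewrite mulr_ge0// le_max lexx orbT.
apply/integrableP; split; first exact/measurable_EFinP.
apply: (@le_lt_trans _ _ (\int[mu]_x (M * \1_(cube 0 d) x)%:E)%E); last first.
  under eq_integral do rewrite EFinM.
  rewrite ge0_integralZl//; last first.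
    by apply/measurable_EFinP; apply: measurable_indic; exact: measurable_cube.
  have V := lebesgue_cube (0 : 'rV[R]_n) d0.
  rewrite (integral_indic mu measurableT (measurable_cube 0 d)) setIT.
  by rewrite [X in (_ * X)%E](_ : _ = (d ^+ n)%:E) -?EFinM ?ltry//.
apply: ge0_le_integral => //.
- by apply/measurable_EFinP; exact: measurableT_comp.
- apply/measurable_EFinP; apply: measurable_funM => //.
  by apply: measurable_indic; exact: measurable_cube.
- move=> x _; rewrite lee_fin indicE.
  case: (boolP (x \in _)) => [_|]; first by rewrite mulr1.
  rewrite notin_setE cubeE//= subr0 => /negP; rewrite -ltNge => xd.
  rewrite fr ?normr0 ?mulr0//; apply: le_lt_trans xd.
  by rewrite /d mulrAC divff// mul1r le_max lexx.
Qed.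

Lemma continuous_locally_bounded f : continuous f -> locally_bounded f.
Proof.
move=> cf r; have [r0|r0] := leP 0 r; last first.
  by exists 0 => x xr; have := le_trans (normr_ge0 x) xr; rewrite leNgt r0.
have cK : compact (cube (0 : 'rV[R]_n) (2 * r)).
  rewrite cubeE ?mulr_ge0//; apply: bounded_closed_compact.
    exists (2 * r / 2); split; first by rewrite num_real.
    by move=> M rM x /=; rewrite subr0 => /le_trans; apply; exact: ltW.
  have -> : [set x : 'rV[R]_n | `|x - 0| <= 2 * r / 2] = (fun x => `|x|) @^-1` [set t | t <= 2 * r / 2].
    by apply/seteqP; split => x /=; rewrite subr0.
  apply: closed_comp; last exact: closed_le.
  by move=> x _; exact: norm_continuous.
have := continuous_compact (A := cube (0 : 'rV[R]_n) (2 * r)) (f := f) _ cK.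
move=> /(_ (continuous_subspaceT cf)) /compact_bounded[M [_ HM]].
exists (M + 1) => x xr; apply: (HM (M + 1)); first by rewrite ltrDl.
exists x => //; rewrite cubeE ?mulr_ge0//= subr0 mulrAC divff// mul1r //.
Qed.

Lemma continuous_bcs f : continuous f -> (exists r, forall x, r < `|x| -> f x = 0) -> bcs f.
Proof.
move=> cf [r fr]; split; [exact: continuous_measurable_rV| |by exists r].
have [M fM] := continuous_locally_bounded cf r.
exists (Num.max M 0) => x; have [xr|xr] := leP `|x| r; first by rewrite le_max fM.
by rewrite fr// normr0 le_max lexx orbT.
Qed.

Definition RI f : R := (\int[mu]_x f x)%R.

Lemma RI_D f g : bcs f -> bcs g -> RI (fun x => f x + g x) = RI f + RI g.
Proof. by move=> bf bg; rewrite /RI RintegralD//; exact: bcs_integrable. Qed.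

Lemma RI_B f g : bcs f -> bcs g -> RI (fun x => f x - g x) = RI f - RI g.
Proof. by move=> bf bg; rewrite /RI RintegralB//; exact: bcs_integrable. Qed.

Lemma RI_Z k f : bcs f -> RI (fun x => k * f x) = k * RI f.
Proof. by move=> bf; rewrite /RI RintegralZl//; exact: bcs_integrable. Qed.

Lemma RI_le f g : bcs f -> bcs g -> (forall x, f x <= g x) -> RI f <= RI g.
Proof. by move=> bf bg fg; apply: le_Rintegral => //; exact: bcs_integrable. Qed.

Lemma RI_ge0 f : (forall x, 0 <= f x) -> 0 <= RI f.
Proof. by move=> f0; apply: Rintegral_ge0. Qed.

Lemma RI_0 : RI (fun=> 0) = 0.
Proof. by rewrite /RI /Rintegral integral0. Qed.

Lemma RI_sum (I : Type) (s : seq I) (F : I -> 'rV[R]_n -> R) :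
  (forall i, bcs (F i)) -> RI (fun x => \sum_(i <- s) F i x) = \sum_(i <- s) RI (F i).
Proof.
move=> bF; elim: s => [|i s IH].
  rewrite big_nil (_ : (fun x => _) = (fun=> 0)) ?RI_0//.
  by apply/funext => x; rewrite big_nil.
rewrite big_cons -IH -RI_D//; last exact: bcs_sum.
by congr RI; apply/funext => x; rewrite big_cons.
Qed.

Lemma RI_EFin f : bcs f -> (RI f)%:E = (\int[mu]_x (f x)%:E)%E.
Proof.
move=> bf; rewrite /RI /Rintegral fineK//.
exact: integrable_fin_num (bcs_integrable bf).
Qed.

End bounded_compact_support.

(** * Continuously differentiable functions *)

Section directional.
Context {R : realType} {n : nat}.
Implicit Types (f g : 'rV[R]_n -> R) (x v : 'rV[R]_n).

(** Reduces directional derivatives to calculus in one real variable. *)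
Lemma is_derive_line f x v (t d : R) :
  is_derive (x + t *: v) v f d <-> is_derive t 1 (fun s : R => f (x + s *: v)) d.
Proof.
have E : (fun h : R => h^-1 *: ((f \o shift (x + t *: v)) (h *: v) - f (x + t *: v))) =
    (fun h : R => h^-1 *: (((fun s : R => f (x + s *: v)) \o shift t) (h *: 1) - f (x + t *: v))).
  apply/funext => h /=; congr (_ *: (f _ - _)).
  by rewrite [h *: 1]mulr1 scalerDl addrCA.
split=> -[D E']; split; first by rewrite /derivable -E.
- by rewrite -E' /derive -E.
- by rewrite /derivable E.
- by rewrite -E' /derive E.
Qed.

Lemma is_derive_line0 f x v (d : R) :
  is_derive x v f d <-> is_derive (0 : R) 1 (fun s : R => f (x + s *: v)) d.
Proof. by rewrite -is_derive_line scale0r addr0. Qed.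

Lemma is_derive_cont1 (f : R -> R) (t d : R) : is_derive t 1 f d -> {for t, continuous f}.
Proof. by move=> [/derivable1_diffP/differentiable_continuous]. Qed.

Lemma line_mvt f (df : 'rV[R]_n -> R) x v (h : R) :
  (forall y, is_derive y v f (df y)) ->
  exists2 c : R, `|c| <= `|h| & f (x + h *: v) - f x = h * df (x + c *: v).
Proof.
move=> fd.
have ld (t : R) : is_derive t 1 (fun s : R => f (x + s *: v)) (df (x + t *: v)).
  by apply/is_derive_line; exact: fd.
have cn : continuous (fun s : R => f (x + s *: v)) by move=> t; exact: is_derive_cont1 (ld t).
have [->|h0] := eqVneq h 0.
  by exists 0; rewrite ?normr0// scale0r addr0 subrr mul0r.
have [hp|hn] := ltP 0 h.
  have [|c] := MVT hp (fun t _ => ld t); first exact: continuous_subspaceT.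
  rewrite in_itv/= => /andP[c0 ch]; rewrite scale0r addr0 subr0 => E; exists c.
    by rewrite !ger0_norm// ltW.
  by rewrite E mulrC.
have {}hn : h < 0 by rewrite lt_neqAle h0.
have [|c] := MVT hn (fun t _ => ld t); first exact: continuous_subspaceT.
rewrite in_itv/= => /andP[c0 ch]; rewrite scale0r addr0 => E; exists c.
  by rewrite !ler0_norm ?lerN2 ltW.
by rewrite -opprB E sub0r mulrN opprK mulrC.
Qed.

Lemma pd_derive j f x d : is_derive x (delta_mx 0 j) f d -> pd j f x = d.
Proof. by case. Qed.

Definition C1 f := continuous f /\ forall j,
  (forall x, is_derive x (delta_mx 0 j) f (pd j f x)) /\ continuous (pd j f).

(** Regularity and the value of the partial derivatives are proved together, so that the rules below
    can be chained. *)
Lemma C1_intro f (df : 'I_n -> 'rV[R]_n -> R) : continuous f ->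
  (forall j x, is_derive x (delta_mx 0 j) f (df j x)) -> (forall j, continuous (df j)) ->
  C1 f /\ forall j, pd j f = df j.
Proof.
move=> cf fd cd; have pdE j : pd j f = df j by apply/funext => x; exact: pd_derive.
by split=> //; split=> // j; rewrite pdE; split => // x; exact: fd.
Qed.

Lemma C1_cst (c : R) : C1 (fun=> c) /\ forall j : 'I_n, pd j (fun=> c) = (fun=> 0).
Proof.
apply: (@C1_intro (fun=> c) (fun _ _ => 0)); first exact: cst_continuous.
by move=> j; exact: cst_continuous.
Qed.

Lemma C1D f g : C1 f -> C1 g ->
  C1 (fun x => f x + g x) /\ forall j, pd j (fun x => f x + g x) = (fun x => pd j f x + pd j g x).
Proof.
move=> [cf Df] [cg Dg]; apply: C1_intro.
- by move=> x; apply: continuousD; [exact: cf|exact: cg].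
- by move=> j x; apply: is_deriveD; [exact: (Df j).1|exact: (Dg j).1].
- by move=> j x; apply: continuousD; [exact: (Df j).2|exact: (Dg j).2].
Qed.

Lemma C1M f g : C1 f -> C1 g ->
  C1 (fun x => f x * g x) /\
  forall j, pd j (fun x => f x * g x) = (fun x => f x * pd j g x + g x * pd j f x).
Proof.
move=> [cf Df] [cg Dg]; apply: C1_intro.
- by move=> x; apply: continuousM; [exact: cf|exact: cg].
- by move=> j x; apply: is_deriveM; [exact: (Df j).1|exact: (Dg j).1].
- move=> j x.
  have c1 : {for x, continuous (fun x => f x * pd j g x)}.
    by apply: continuousM; [exact: cf|exact: (Dg j).2].
  have c2 : {for x, continuous (fun x => g x * pd j f x)}.
    by apply: continuousM; [exact: cg|exact: (Df j).2].
  exact: (continuousD c1 c2).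
Qed.

Lemma C1Z (k : R) f : C1 f ->
  C1 (fun x => k * f x) /\ forall j, pd j (fun x => k * f x) = (fun x => k * pd j f x).
Proof.
move=> C; have [Ck pk] := C1_cst k; have [CM pM] := C1M Ck C; split => // j.
by rewrite pM pk; apply/funext => x; rewrite mulr0 addr0.
Qed.

Lemma C1_comp (phi dphi : R -> R) f : C1 f -> (forall t : R, is_derive t 1 phi (dphi t)) ->
  continuous dphi ->
  C1 (fun x => phi (f x)) /\ forall j, pd j (fun x => phi (f x)) = (fun x => dphi (f x) * pd j f x).
Proof.
move=> [cf Df] Dp cdp.
have cp : continuous phi by move=> t; exact: is_derive_cont1 (Dp t).
apply: C1_intro.
- by move=> x; apply: (@continuous_comp _ _ _ f phi); [exact: cf|exact: cp].
- move=> j x; apply/is_derive_line0.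
  apply: (is_derive1_comp (f := phi) (g := fun s : R => f (x + s *: delta_mx 0 j))).
    by rewrite scale0r addr0.
  by apply/is_derive_line0; exact: (Df j).1.
- move=> j x; apply: continuousM; last exact: (Df j).2.
  by apply: (@continuous_comp _ _ _ f dphi); [exact: cf|exact: cdp].
Qed.

Lemma C1_coord (i : 'I_n) :
  C1 (fun x => x 0 i) /\ forall j, pd j (fun x => x 0 i) = (fun=> (i == j)%:R).
Proof.
apply: C1_intro; first by move=> x; exact: coord_continuous.
  move=> j x; apply/is_derive_line0.
  rewrite (_ : (fun s => _) = (fun s : R => x 0 i + s * (i == j)%:R)); last first.
    by apply/funext => s; rewrite !mxE eqxx.
  rewrite -[X in is_derive _ _ _ X]add0r; apply: is_deriveD.
  rewrite (_ : (fun s => _) = (fun s : R => (i == j)%:R *: s)); last first.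
    by apply/funext => s; rewrite mulrC.
  rewrite -[X in is_derive _ _ _ X]mulr1; apply: is_deriveZ.
by move=> j; exact: cst_continuous.
Qed.

Lemma C1_sum (I : Type) (r : seq I) (F : I -> 'rV[R]_n -> R) : (forall i, C1 (F i)) ->
  C1 (fun x => \sum_(i <- r) F i x) /\
  forall j, pd j (fun x => \sum_(i <- r) F i x) = (fun x => \sum_(i <- r) pd j (F i) x).
Proof.
move=> CF; elim: r => [|i r [IH1 IH2]].
  rewrite (_ : (fun x => _) = (fun=> 0)); last by apply/funext => x; rewrite big_nil.
  have [C p] := C1_cst 0; split => // j; rewrite p.
  by apply/funext => x; rewrite big_nil.
rewrite (_ : (fun x => _) = (fun x => F i x + \sum_(i <- r) F i x)); last first.
  by apply/funext => x; rewrite big_cons.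
have [C p] := C1D (CF i) IH1; split => // j; rewrite p IH2.
by apply/funext => x; rewrite big_cons.
Qed.

(** Meant for [weight], a product whose number of factors varies with the region. *)
Lemma C1_local f : (forall r : R, exists2 g, C1 g & forall x, `|x| < r -> f x = g x) -> C1 f.
Proof.
move=> H.
have N x : exists2 g, C1 g & \forall y \near x, f y = g y.
  have [g Cg fg] := H (`|x| + 1); exists g => //.
  have : \forall y \near x, `|y| < `|x| + 1.
    have := @norm_continuous _ _ x => /cvgrPdist_lt/(_ 1 ltr01).
    apply: filterS => y /=; rewrite ltr_distlC => /andP[_ ->] //.
  by apply: filterS => y; exact: fg.
have fE x g : (\forall y \near x, f y = g y) -> C1 g -> forall j, is_derive x (delta_mx 0 j) f (pd j g x).
  move=> fg [_ Dg] j; have [D1 D2] := (Dg j).1 x; split.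
    by apply: near_eq_derivable D1; apply: filterS fg => y ->.
  by rewrite (near_eq_derive _ fg).
split.
  move=> x; have [g [cg _] fg] := N x.
  have fgx : f x = g x by exact: nbhs_singleton fg.
  move=> A nA; have gA : nbhs x (g @^-1` A) by apply: cg; rewrite -fgx.
  by apply: filterS2 fg gA => y; rewrite /preimage/= => ->.
move=> j; split => x; have [g Cg fg] := N x.
  by rewrite (pd_derive (fE _ _ fg Cg j)); exact: fE.
have pfg : \forall y \near x, pd j f y = pd j g y.
  have := nbhs_interior fg; apply: filterS => y fgy.
  by apply: pd_derive; exact: fE.
have pfgx : pd j f x = pd j g x by exact: nbhs_singleton pfg.
move=> A nA; have gA : nbhs x (pd j g @^-1` A) by apply: (Cg.2 j).2; rewrite -pfgx.
by apply: filterS2 pfg gA => y; rewrite /preimage/= => ->.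
Qed.

Lemma delta_norm (j : 'I_n) : `|delta_mx 0 j : 'rV[R]_n| <= 1.
Proof.
rewrite rV_normE//; apply/forallP => i; rewrite mxE eqxx/=.
by case: (i == j); rewrite ?normr1 ?normr0.
Qed.

Lemma pd_support j f (r : R) : (forall x, r < `|x| -> f x = 0) -> forall x, r < `|x| -> pd j f x = 0.
Proof.
move=> fr x rx.
have : \forall y \near x, f y = cst 0 y.
  have : \forall y \near x, r < `|y|.
    have := @norm_continuous _ _ x => /cvgr_gt/(_ _ rx).
    by [].
  by apply: filterS => y; exact: fr.
by rewrite /pd => /near_eq_derive ->; rewrite derive_cst.
Qed.

Lemma C1_pd_bcs f j : C1 f -> bcs f -> bcs (pd j f).
Proof.
move=> [_ Df] [_ _ [r fr]]; apply: continuous_bcs; first exact: (Df j).2.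
by exists r; exact: pd_support.
Qed.

Lemma C1_lipschitz_dir f j : C1 f -> bcs f ->
  exists M, forall x (h : R), `|f (x + h *: delta_mx 0 j) - f x| <= M * `|h|.
Proof.
move=> Cf bf; have [_ [M HM] _] := C1_pd_bcs j Cf bf.
exists M => x h; have [c _ ->] := line_mvt x h (Cf.2 j).1.
by rewrite normrM mulrC ler_wpM2r.
Qed.

Lemma bcs_shift f v : bcs f -> bcs (fun x => f (x + v)).
Proof.
move=> [mf [M fM] [r fr]]; split.
- exact: (measurableT_comp mf (measurable_rV_shift v)).
- by exists M.
- exists (r + `|v|) => x xr; apply: fr.
  have := ler_normB (x + v) v; rewrite addrK; lra.
Qed.

Lemma RI_shift f v : bcs f -> RI (fun x => f (x + v)) = RI f.
Proof.
move=> bf; rewrite /RI /Rintegral; congr fine.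
have mf : measurable_fun setT (EFin \o f) by apply/measurable_EFinP; exact: bcs_measurable.
rewrite integralE [RHS]integralE.
have e1 := integral_rV_shift v (measurable_funepos mf) (funepos_ge0 _).
have e2 := integral_rV_shift v (measurable_funeneg mf) (funeneg_ge0 _).
have p1 : (\int[lebesgue_rV n]_x (fun x0 : 'rV[R]_n => (f (x0 + v))%:E)^\+ x =
    \int[lebesgue_rV n]_x (EFin \o f)^\+ x)%E.
  by rewrite -e1; apply: eq_integral => x _; rewrite !funepos.unlock.
have p2 : (\int[lebesgue_rV n]_x (fun x0 : 'rV[R]_n => (f (x0 + v))%:E)^\- x =
    \int[lebesgue_rV n]_x (EFin \o f)^\- x)%E.
  by rewrite -e2; apply: eq_integral => x _; rewrite !funeneg.unlock.
by rewrite p1 p2.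
Qed.

(** Difference quotients have integral 0 by translation invariance, and dominated convergence
    transfers this to [g]. Convergence is only required almost everywhere, so that Lipschitz
    functions are covered too. *)
Lemma RI_difference_quotient f g v (M : R) : bcs f ->
  (forall x (h : R), `|f (x + h *: v) - f x| <= M * `|h|) -> bcs g ->
  {ae lebesgue_rV n, forall x,
     k.+1%:R * (f (x + k.+1%:R^-1 *: v) - f x) @[k --> \oo] --> g x} ->
  RI g = 0.
Proof.
move=> bf fM bg fg.
have [mf _ [r fr]] := bf.
pose F (k : nat) x := k.+1%:R * (f (x + k.+1%:R^-1 *: v) - f x).
have bF k : bcs (F k) by apply: bcsZ; apply: bcsB => //; exact: bcs_shift.
have IF k : RI (F k) = 0.
  rewrite RI_Z ?RI_B ?RI_shift ?subrr ?mulr0//; first exact: bcs_shift.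
  by apply: bcsB => //; exact: bcs_shift.
(* The cube of edge [d] about 0 contains the supports of all the quotients, as the shifts are at
   most [v] in norm. *)
pose d := 2 * (Num.max r 0 + `|v|).
have d0 : 0 <= d by rewrite mulr_ge0// addr_ge0// le_max lexx orbT.
pose G x := \1_(cube (0 : 'rV[R]_n) d) x * M.
have bG : bcs G.
  apply: bcs_indic_cube => //; by move=> s; exists `|M|.
have FG k x : `|F k x| <= G x.
  rewrite /G indicE; case: (boolP (x \in _)) => [_|].
    rewrite mul1r normrM ger0_norm//; apply: le_trans (ler_wpM2l _ (fM x _)) _ => //.
    by rewrite ger0_norm ?invr_ge0// mulrCA mulfV ?mulr1.
  rewrite notin_setE cubeE//= subr0 => /negP; rewrite -ltNge => xd.
  have dE : d / 2 = Num.max r 0 + `|v| by rewrite /d mulrAC divff// mul1r.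
  rewrite dE in xd.
  have r1 : r <= Num.max r 0 by rewrite le_max lexx.
  have v0 := normr_ge0 v.
  have k1 : `|k.+1%:R^-1 *: v| <= `|v|.
    by rewrite normrZ ler_piMl// ger0_norm ?invr_ge0// invf_le1// ler1n.
  rewrite /F (fr x) ?(fr (x + _)) ?subrr ?mulr0 ?normr0 ?mul0r//.
    have := ler_normB (x + k.+1%:R^-1 *: v) (k.+1%:R^-1 *: v); rewrite addrK; lra.
  lra.
have [|||||] := @dominated_convergence _ _ _ (lebesgue_rV n) setT measurableT
  (fun k => EFin \o F k) (EFin \o g) (EFin \o G).
- by move=> k; apply/measurable_EFinP; exact: bcs_measurable.
- by apply/measurable_EFinP; exact: bcs_measurable.
- by apply: filterS fg => x H _; apply/fine_cvgP; split; [exact: nearW|exact: H].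
- exact: bcs_integrable.
- by apply: nearW => x k _ /=; rewrite lee_fin.
move=> _ _; rewrite (_ : (fun k => _) = cst 0%E); last first.
  apply/funext => k /=; rewrite -(RI_EFin (bF k)) IF//.
move=> H; have E : (\int[lebesgue_rV n]_x (g x)%:E)%E = 0%E.
  exact: (cvg_unique _ H (@cvg_cst _ _ _ _ _)).
by move: E; rewrite -(RI_EFin bg) => -[].
Qed.

Lemma is_derive_quotient f x v d : is_derive x v f d ->
  k.+1%:R * (f (x + k.+1%:R^-1 *: v) - f x) @[k --> \oo] --> d.
Proof.
move=> [D <-]; have := D; rewrite /derivable -/(derive f x v) => c.
have h0 : (fun k : nat => k.+1%:R^-1 : R) @ \oo --> 0^'.
  move=> A [e /= e0 eA].
  have /cvgrPdist_lt/(_ e e0)[N _ HN] := @cvg_harmonic R.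
  exists N => // k Nk /=; apply: eA; last by rewrite invr_eq0.
  exact: HN.
have := cvg_comp _ _ h0 c.
rewrite (_ : _ \o _ = (fun k => k.+1%:R * (f (x + k.+1%:R^-1 *: v) - f x)))//.
by apply/funext => k /=; rewrite invrK [_ *: v + x]addrC.
Qed.

Lemma RI_pd f j : C1 f -> bcs f -> RI (pd j f) = 0.
Proof.
move=> Cf bf; have [M HM] := C1_lipschitz_dir j Cf bf.
apply: (RI_difference_quotient bf HM); first exact: C1_pd_bcs.
by apply: nearW => x; apply: is_derive_quotient; exact: (Cf.2 j).1.
Qed.

Lemma C1_measurable f : C1 f -> measurable_fun setT f.
Proof. by move=> [/continuous_measurable_rV]. Qed.

Lemma C1_locally_bounded f : C1 f -> locally_bounded f.
Proof. by move=> [/continuous_locally_bounded]. Qed.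

Lemma C1_bcsM f g : bcs f -> C1 g -> bcs (fun x => f x * g x).
Proof. by move=> bf Cg; apply: bcsM => //; [exact: C1_measurable|exact: C1_locally_bounded]. Qed.

Lemma pd_measurable f j : C1 f -> measurable_fun setT (pd j f).
Proof. by move=> [_ /(_ j)[_ /continuous_measurable_rV]]. Qed.

Lemma pd_locally_bounded f j : C1 f -> locally_bounded (pd j f).
Proof. by move=> [_ /(_ j)[_ /continuous_locally_bounded]]. Qed.

Lemma integration_by_parts_rV f g j : C1 f -> C1 g -> bcs f ->
  RI (fun x => f x * pd j g x) = - RI (fun x => pd j f x * g x).
Proof.
move=> Cf Cg bf; have [Cfg pfg] := C1M Cf Cg.
have := RI_pd j Cfg (C1_bcsM bf Cg); rewrite pfg RI_D.
- move/eqP; rewrite addr_eq0 => /eqP ->; congr (- RI _).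
  by apply/funext => x; rewrite mulrC.
- by apply: bcsM => //; [exact: pd_measurable|exact: pd_locally_bounded].
- have := C1_bcsM (C1_pd_bcs j Cf bf) Cg.
  by under eq_fun do rewrite mulrC.
Qed.

Local Opaque pd.

(** The second difference over a square of side [s] is evaluated by the mean value theorem in both
    orders, so the two mixed derivatives take a common value at points as near to [x] as desired. *)
Lemma pd_comm f i j : C1 f -> C1 (pd i f) -> C1 (pd j f) -> pd i (pd j f) = pd j (pd i f).
Proof.
move=> Cf Ci Cj; apply/funext => x; apply/eqP/negPn/negP => ne.
pose e := `|pd i (pd j f) x - pd j (pd i f) x| / 2.
have e0 : 0 < e by rewrite divr_gt0// normr_gt0 subr_eq0.
clear ne.
have near0 (F : 'rV[R]_n -> R) : continuous F ->
    exists2 d : R, 0 < d & forall y, `|x - y| < d -> `|F x - F y| < e.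
  move=> cF; have /cvgrPdist_lt/(_ e e0)/nbhs_ballP[d /= d0 H] := cF x.
  by exists d => // y xy; apply: H; rewrite mx_norm_ball.
have [d1 d10 H1] := near0 _ (Cj.2 i).2.
have [d2 d20 H2] := near0 _ (Ci.2 j).2.
(* All intermediate points lie within 2 s of [x], inside both neighbourhoods. *)
have [s s0 sE] : exists2 s, 0 < s & s = Num.min d1 d2 / 4.
  by eexists; last reflexivity; rewrite divr_gt0// lt_min d10.
have der_diff (k : 'I_n) (w : 'rV[R]_n) y : 
    is_derive y (delta_mx 0 k) (fun z => f (z + w) - f z) (pd k f (y + w) - pd k f y).
  apply: is_deriveB; last exact: (Cf.2 k).1.
  apply/is_derive_line0; have := (Cf.2 k).1 (y + w) => /is_derive_line0.
  by under [X in is_derive _ _ X _ -> _]eq_fun do rewrite addrAC.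
have [a1 a1s E1] := line_mvt x s (der_diff i (s *: (delta_mx 0 j : 'rV[R]_n))).
have [b1 b1s F1] := line_mvt (x + a1 *: (delta_mx 0 i : 'rV[R]_n)) s (Ci.2 j).1.
have [a2 a2s E2] := line_mvt x s (der_diff j (s *: (delta_mx 0 i : 'rV[R]_n))).
have [b2 b2s F2] := line_mvt (x + a2 *: (delta_mx 0 j : 'rV[R]_n)) s (Cj.2 i).1.
rewrite F1 in E1; rewrite F2 in E2.
have eq : pd j (pd i f) (x + a1 *: (delta_mx 0 i : 'rV[R]_n) + b1 *: (delta_mx 0 j : 'rV[R]_n)) = pd i (pd j f) (x + a2 *: (delta_mx 0 j : 'rV[R]_n) + b2 *: (delta_mx 0 i : 'rV[R]_n)).
  have sN0 : s != 0 by rewrite gt_eqF.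
  apply: (mulfI sN0); apply: (mulfI sN0); apply: (etrans (esym E1)); apply: (etrans _ E2).
  by rewrite (addrAC x (s *: (delta_mx 0 j : 'rV[R]_n))); move: (f _) (f _) (f _) (f x) => A B C D; ring.
have small (u v : R) (k l : 'I_n) : `|u| <= `|s| -> `|v| <= `|s| ->
    `|x - (x + u *: (delta_mx 0 k : 'rV[R]_n) + v *: delta_mx 0 l)| < Num.min d1 d2.
  move=> us vs; rewrite -addrA opprD addNKr normrN.
  apply: le_lt_trans (ler_normD _ _) _; rewrite !normrZ.
  have mul_le (a b : R) : 0 <= a -> a <= s -> b <= 1 -> a * b <= s.
    by move=> a0 as_ bb1; apply: le_trans as_; rewrite ler_piMr.
  have sn : `|s| = s := ger0_norm (ltW s0).
  rewrite sn in us vs; clear E1 E2 F1 F2 eq der_diff near0 H1 H2 Cf Ci Cj.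
  have A1 := mul_le _ _ (normr_ge0 u) us (delta_norm k).
  have A2 := mul_le _ _ (normr_ge0 v) vs (delta_norm l).
  have m0 : 0 < Num.min d1 d2 by rewrite lt_min d10.
  move: A1 A2; rewrite sE; lra.
have := small a2 b2 j i a2s b2s; rewrite lt_min => /andP[t1 _].
have := small a1 b1 i j a1s b1s; rewrite lt_min => /andP[_ t2].
have B1 := H1 _ t1; have B2 := H2 _ t2; clear small E1 E2 F1 F2 der_diff near0 H1 H2.
rewrite eq distrC in B2.
have : `|pd i (pd j f) x - pd j (pd i f) x| < e + e.
  have := ler_distD (pd i (pd j f) (x + a2 *: (delta_mx 0 j : 'rV[R]_n) + b2 *: (delta_mx 0 i : 'rV[R]_n)))
    (pd i (pd j f) x) (pd j (pd i f) x).
  by move=> H; exact: (le_lt_trans H (ltrD B1 B2)).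
by rewrite /e -splitr ltxx.
Qed.

End directional.

(** * The Rellich inequality *)

Section rellich.
Context {R : realType} {n : nat}.
Implicit Types (f g w : 'rV[R]_n -> R) (x v : 'rV[R]_n).
Local Notation e_ j := (delta_mx 0 j : 'rV[R]_n).
Local Opaque pd.

Lemma sqr_sum_le N (d : nat -> R) : (\sum_(i < N) d i) ^+ 2 <= N%:R * \sum_(i < N) d i ^+ 2.
Proof.
have aux M (t : R) : 2 * (\sum_(i < M) d i) * t <= \sum_(i < M) d i ^+ 2 + M%:R * t ^+ 2.
  elim: M => [|M IH]; first by rewrite !big_ord0 mulr0 !mul0r addr0.
  rewrite !big_ord_recr/= -natr1; have := sqr_ge0 (d M - t); nra.
elim: N => [|N IH]; first by rewrite !big_ord0 expr0n mulr0.
rewrite !big_ord_recr/= -natr1; have := aux N (d N); nra.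
Qed.

Lemma bcs_diff f v : bcs f -> bcs (fun x => f (x + v) - f x).
Proof. by move=> bf; apply: bcsB => //; exact: bcs_shift. Qed.

Lemma bcs_sqr f : bcs f -> bcs (fun x => f x ^+ 2).
Proof. by move=> bf; under eq_fun do rewrite expr2; exact: bcsMb. Qed.

Lemma RI_ext f g : f =1 g -> RI f = RI g.
Proof. by move=> /funext ->. Qed.

Lemma RI_shift_eq f g v : bcs g -> (forall x, f x = g (x + v)) -> RI f = RI g.
Proof. by move=> bg fg; rewrite -(RI_shift v bg); exact: RI_ext. Qed.

Lemma bcs_indic (y : 'rV[R]_n) (t : R) : 0 <= t -> bcs (\1_(cube y t) : 'rV[R]_n -> R).
Proof.
move=> t0; rewrite (_ : \1_(cube y t) = (fun x => \1_(cube y t) x * 1)); last first.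
  by apply/funext => x; rewrite mulr1.
by apply: bcs_indic_cube => // r; exists 1 => x _; rewrite normr1.
Qed.

Lemma RI_indic_cube (x : 'rV[R]_n) d : 0 <= d -> RI (\1_(cube x d) : 'rV[R]_n -> R) = d ^+ n.
Proof.
move=> d0; rewrite /RI /Rintegral integral_indic//; last exact: measurable_cube.
by rewrite setIT [X in fine X](_ : _ = (d ^+ n)%:E) //; exact: lebesgue_cube.
Qed.

(** A translation by [N v] is split into [N] translations by [v], whose increments all have the same
    norm. Letting [N] grow with [N v] fixed is how [translate_coord] reaches the derivative. *)
Lemma translate_telescope f v N : bcs f ->
  RI (fun x => (f (x + N%:R *: v) - f x) ^+ 2) <= N%:R ^+ 2 * RI (fun x => (f (x + v) - f x) ^+ 2).
Proof.
move=> bf; have bd := bcs_sqr (bcs_diff v bf).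
pose d x (i : nat) := f (x + i.+1%:R *: v) - f (x + i%:R *: v).
have dE x : f (x + N%:R *: v) - f x = \sum_(i < N) d x i.
  elim: N => [|N IH]; first by rewrite big_ord0 scale0r addr0 subrr.
  by rewrite big_ord_recr/= -IH /d; ring.
have dS i x : d x i ^+ 2 = (fun y => (f (y + v) - f y) ^+ 2) (x + i%:R *: v).
  by rewrite /d -natr1 scalerDl scale1r addrA.
have bdi i : bcs (fun x => d x i ^+ 2).
  rewrite (_ : (fun x => d x i ^+ 2) = (fun x => (fun y => (f (y + v) - f y) ^+ 2) (x + i%:R *: v))).
    exact: (bcs_shift (i%:R *: v) bd).
  by apply/funext => x; exact: dS.
apply: (@le_trans _ _ (RI (fun x => N%:R * \sum_(i < N) d x i ^+ 2))).
  apply: RI_le.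
  - by apply: bcs_sqr; exact: bcs_diff.
  - by apply: bcsZ; apply: bcs_sum => i; exact: bdi.
  - by move=> x; rewrite dE; exact: sqr_sum_le.
rewrite RI_Z; last by apply: bcs_sum => i; exact: bdi.
rewrite RI_sum; last by move=> i; exact: bdi.
rewrite (eq_bigr (fun=> RI (fun x => (f (x + v) - f x) ^+ 2))); last first.
  by move=> i _; apply: (RI_shift_eq (v := i%:R *: v) bd) => x; exact: dS.
by rewrite sumr_const card_ord -[X in _ * X]mulr_natl mulrA expr2.
Qed.

Lemma bcs_cvg (F : nat -> 'rV[R]_n -> R) g (M r : R) : (forall k, bcs (F k)) -> bcs g ->
  (forall k x, `|F k x| <= M) -> (forall k x, r < `|x| -> F k x = 0) ->
  (forall x, F k x @[k --> \oo] --> g x) -> RI (F k) @[k --> \oo] --> RI g.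
Proof.
move=> bF bg FM Fr Fg.
pose d := 2 * Num.max r 0.
have d0 : 0 <= d by rewrite mulr_ge0// le_max lexx orbT.
pose G x := \1_(cube (0 : 'rV[R]_n) d) x * M.
have bG : bcs G.
  by apply: bcs_indic_cube => //; move=> s; exists `|M|.
have FG k x : `|F k x| <= G x.
  rewrite /G indicE; case: (boolP (x \in _)) => [_|]; first by rewrite mul1r.
  rewrite notin_setE cubeE//= subr0 => /negP; rewrite -ltNge => xd.
  rewrite mul0r Fr ?normr0//; apply: le_lt_trans xd.
  by rewrite /d mulrAC divff// mul1r le_max lexx.
have [|||||_ _] := @dominated_convergence _ _ _ (lebesgue_rV n) setT measurableT
  (fun k => EFin \o F k) (EFin \o g) (EFin \o G).
- by move=> k; apply/measurable_EFinP; exact: bcs_measurable.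
- by apply/measurable_EFinP; exact: bcs_measurable.
- by apply: nearW => x _; apply/fine_cvgP; split; [exact: nearW|exact: Fg].
- exact: bcs_integrable.
- by apply: nearW => x k _ /=; rewrite lee_fin.
rewrite (_ : (fun k => _) = (fun k => (RI (F k))%:E)); last first.
  by apply/funext => k; rewrite (RI_EFin (bF k)).
move=> H; have : (fun k => (RI (F k))%:E) @ \oo --> (RI g)%:E by rewrite RI_EFin.
by move=> /fine_cvgP[_].
Qed.

Lemma is_derive_scale w j x (h : R) : C1 w -> is_derive x (h *: e_ j) w (h * pd j w x).
Proof.
move=> Cw; apply/is_derive_line0.
have := (Cw.2 j).1 x => /is_derive_line0 D.
have E : (fun s : R => w (x + s *: (h *: e_ j))) =
    (fun s : R => w (x + s *: e_ j)) \o (fun s : R => h *: s).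
  by apply/funext => s /=; rewrite scalerA mulrC.
rewrite E mulrC; apply: is_derive1_comp; first by rewrite scaler0.
rewrite -[X in is_derive _ _ _ X]mulr1; exact: is_deriveZ.
Qed.

(** Cut the step into k+1 equal parts: [translate_telescope] bounds the left-hand side by integrals
    of squared difference quotients, which converge to the right-hand side. *)
Lemma translate_coord w j (h : R) : C1 w -> bcs w ->
  RI (fun x => (w (x + h *: e_ j) - w x) ^+ 2) <= h ^+ 2 * RI (fun x => pd j w x ^+ 2).
Proof.
move=> Cw bw.
have [M HM] := C1_lipschitz_dir j Cw bw; have bp := C1_pd_bcs j Cw bw.
have [_ _ [r wr]] := bw.
pose F (k : nat) x := (k.+1%:R * (w (x + k.+1%:R^-1 *: (h *: e_ j)) - w x)) ^+ 2.
have bF k : bcs (F k) by apply: bcs_sqr; apply: bcsZ; exact: bcs_diff.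
have M0 : 0 <= M by have := HM 0 1; rewrite normr1 mulr1; apply: le_trans.
rewrite -RI_Z; last exact: bcs_sqr.
have kinv (k : nat) : k.+1%:R * k.+1%:R^-1 = 1 :> R by rewrite mulfV.
have FM k x : `|F k x| <= (M * `|h|) ^+ 2.
  rewrite ger0_norm ?sqr_ge0// /F -[X in X <= _]real_normK ?num_real//.
  rewrite lerXn2r// ?nnegrE ?mulr_ge0//.
  rewrite normrM scalerA; apply: le_trans (ler_wpM2l (normr_ge0 _) (HM _ _)) _.
  by rewrite normrM mulrCA (mulrA `|k.+1%:R|) -normrM kinv normr1 mul1r.
have Fr k x : r + `|h| < `|x| -> F k x = 0.
  move=> rx; have k1 : `|k.+1%:R^-1 *: (h *: e_ j)| <= `|h|.
    rewrite !normrZ mulrA; apply: le_trans (ler_wpM2l _ (delta_norm j)) _; first by rewrite mulr_ge0.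
    by rewrite mulr1 ler_piMl// ger0_norm ?invr_ge0// invf_le1// ler1n.
  have h0 := normr_ge0 h.
  have x1 : r < `|x| by lra.
  have x2 : r < `|x + k.+1%:R^-1 *: (h *: e_ j)|.
    have := ler_normB (x + k.+1%:R^-1 *: (h *: e_ j)) (k.+1%:R^-1 *: (h *: e_ j)); rewrite addrK; lra.
  by rewrite /F (wr _ x1) (wr _ x2) subrr mulr0 expr0n.
have Fcv x : F k x @[k --> \oo] --> h ^+ 2 * pd j w x ^+ 2.
  rewrite -exprMn expr2.
  have q := is_derive_quotient (is_derive_scale j x h Cw).
  rewrite (_ : (fun k => _) = (fun k : nat =>
    (k.+1%:R * (w (x + k.+1%:R^-1 *: (h *: e_ j)) - w x)) *
    (k.+1%:R * (w (x + k.+1%:R^-1 *: (h *: e_ j)) - w x)))); last first.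
    by apply/funext => k; rewrite /F expr2.
  exact: (cvgM q q).
have cF := bcs_cvg bF (bcsZ (h ^+ 2) (bcs_sqr bp)) FM Fr Fcv.
apply: (cvgr_to_ge cF); apply: nearW => k.
have := translate_telescope (k.+1%:R^-1 *: (h *: e_ j)) k.+1 bw.
rewrite (_ : k.+1%:R *: (k.+1%:R^-1 *: (h *: e_ j)) = h *: e_ j); last first.
  by rewrite scalerA kinv scale1r.
move=> T; apply: (le_trans T); rewrite -RI_Z; last by apply: bcs_sqr; exact: bcs_diff.
by rewrite (RI_ext (g := F k)) ?lexx// => x; rewrite /F exprMn.
Qed.

Definition grad2 w : R := \sum_(j < n) RI (fun x => pd j w x ^+ 2).

Lemma grad2_ge0 w : 0 <= grad2 w.
Proof. by apply: sumr_ge0 => j _; apply: RI_ge0 => x; exact: sqr_ge0. Qed.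

(** One coordinate is moved at a time; the square of a sum of n increments costs the factor n. *)
Lemma translate w v : C1 w -> bcs w ->
  RI (fun x => (w (x + v) - w x) ^+ 2) <= n%:R * `|v| ^+ 2 * grad2 w.
Proof.
move=> Cw bw.
pose vk (k : nat) : 'rV[R]_n := \row_(i < n) (if (i < k)%N then v 0 i else 0).
pose d x (k : nat) := w (x + vk k.+1) - w (x + vk k).
have vkS (k : 'I_n) : vk k.+1 = vk k + v 0 k *: e_ k.
  apply/rowP => i; rewrite !mxE eqxx/= ltnS leq_eqVlt.
  have [->|ne] := eqVneq i k; first by rewrite eqxx ltnn add0r mulr1.
  by rewrite mulr0 addr0; have -> : (i == k :> nat) = false by exact/negbTE.
have dE x : w (x + v) - w x = \sum_(k < n) d x k.
  have H m : w (x + vk m) - w x = \sum_(k < m) d x k.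
    elim: m => [|m IH].
      rewrite big_ord0 (_ : vk 0%N = 0) ?addr0 ?subrr//.
      by apply/rowP => i; rewrite !mxE.
    by rewrite big_ord_recr/= -IH /d; ring.
  rewrite -H; congr (w (_ + _) - _).
  by apply/rowP => i; rewrite mxE ltn_ord.
have dS (k : 'I_n) x : d x k ^+ 2 = (fun y => (w (y + v 0 k *: e_ k) - w y) ^+ 2) (x + vk k).
  by rewrite /d vkS addrA.
have bdk (k : 'I_n) : bcs (fun y => (w (y + v 0 k *: e_ k) - w y) ^+ 2).
  by apply: bcs_sqr; exact: bcs_diff.
have bd (k : 'I_n) : bcs (fun x => d x k ^+ 2).
  rewrite (_ : (fun x => d x k ^+ 2) =
     (fun x => (fun y => (w (y + v 0 k *: e_ k) - w y) ^+ 2) (x + vk k))).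
    exact: (bcs_shift (vk k) (bdk k)).
  by apply/funext => x; exact: dS.
apply: (@le_trans _ _ (RI (fun x => n%:R * \sum_(k < n) d x k ^+ 2))).
  apply: RI_le.
  - by apply: bcs_sqr; exact: bcs_diff.
  - by apply: bcsZ; exact: bcs_sum.
  - by move=> x; rewrite dE; exact: sqr_sum_le.
rewrite RI_Z; last exact: bcs_sum.
rewrite -mulrA ler_wpM2l// RI_sum// /grad2 mulr_sumr; apply: ler_sum => k _.
rewrite (RI_shift_eq (v := vk k) (bdk k)); last by move=> x; exact: dS.
apply: le_trans (translate_coord _ _ Cw bw) _.
apply: ler_wpM2r; first by apply: RI_ge0 => x; exact: sqr_ge0.
by rewrite -[X in X <= _]real_normK ?num_real// lerXn2r ?nnegrE// rV_norm_coord.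
Qed.

Section average.
Variable h : R.
Hypothesis h0 : 0 < h.
Let Q := cube (0 : 'rV[R]_n) h.
Let V := h ^+ n.
Let V0 : 0 < V. Proof. by rewrite exprn_gt0. Qed.

Lemma bcs_indicM f : bcs f -> bcs (fun y => \1_Q y * f y).
Proof.
move=> bf; apply: bcs_indic_cube; [exact: bcs_measurable|exact: bcs_locally_bounded|exact: ltW].
Qed.

Definition average w x := V^-1 * RI (fun y => \1_Q y * w (y + x)).

(** The variance of [g] over the cube is nonnegative. *)
Lemma jensen g : bcs g -> (V^-1 * RI (fun y => \1_Q y * g y)) ^+ 2 <=
  V^-1 * RI (fun y => \1_Q y * g y ^+ 2).
Proof.
move=> bg; pose c := V^-1 * RI (fun y => \1_Q y * g y).
have b1 : bcs (\1_Q : 'rV[R]_n -> R) by apply: bcs_indic; exact: ltW.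
have bg1 := bcs_indicM bg; have bg2 := bcs_indicM (bcs_sqr bg).
have key (r : R) : 0 <= r - 2 * c * (V * c) + c ^+ 2 * V -> c ^+ 2 <= V^-1 * r.
  by move=> H; rewrite -(ler_pM2l V0) (mulrA V V^-1) divff ?gt_eqF// mul1r; lra.
rewrite -/c; apply: key.
have Ec : V * c = RI (fun y => \1_Q y * g y) by rewrite /c mulrA divff ?mul1r// gt_eqF.
have EV : V = RI (\1_Q : 'rV[R]_n -> R) by rewrite RI_indic_cube// ltW.
rewrite Ec [X in c ^+ 2 * X]EV -!RI_Z// -RI_B//; last exact: bcsZ.
rewrite -RI_D; [|by apply: bcsB => //; exact: bcsZ|exact: bcsZ].
apply: RI_ge0 => y.
have -> : \1_Q y * g y ^+ 2 - 2 * c * (\1_Q y * g y) + c ^+ 2 * \1_Q y = \1_Q y * (g y - c) ^+ 2 by ring.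
by rewrite mulr_ge0// ?sqr_ge0// indicE.
Qed.

Lemma average_diff w x x' : C1 w -> bcs w ->
  (average w x - average w x') ^+ 2 <= V^-1 * (n%:R * `|x - x'| ^+ 2 * grad2 w).
Proof.
move=> Cw bw; rewrite /average -mulrBr.
have bx := bcs_shift x bw; have bx' := bcs_shift x' bw.
rewrite -RI_B; [|exact: bcs_indicM..].
rewrite (RI_ext (g := fun y => \1_Q y * (w (y + x) - w (y + x')))); last by move=> y; rewrite mulrBr.
have bd : bcs (fun y => w (y + x) - w (y + x')) by exact: bcsB.
apply: le_trans (jensen bd) _.
rewrite ler_pM2l ?invr_gt0//.
apply: le_trans (translate (x - x') Cw bw).
rewrite -(RI_shift x' (bcs_sqr (bcs_diff (x - x') bw))).
apply: RI_le; first exact/bcs_indicM/bcs_sqr.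
  exact: (bcs_shift x' (bcs_sqr (bcs_diff (x - x') bw))).
move=> y; rewrite -addrA (addrC x') subrK.
by rewrite ler_piMl ?sqr_ge0// indicE; case: (_ \in _).
Qed.

Lemma average_test w x : bcs w ->
  average w x = RI (fun y => w y * (V^-1 * \1_(cube x h) y)).
Proof.
move=> bw; rewrite /average -RI_Z; last exact/bcs_indicM/bcs_shift.
have bt : bcs (fun y => w y * (V^-1 * \1_(cube x h) y)).
  by apply: bcsMb => //; apply: bcsZ; apply: bcs_indic; exact: ltW.
apply: (RI_shift_eq (v := x)) => // y.
rewrite [RHS]mulrC -mulrA; congr (_ * (_ * _)).
rewrite !indicE; congr (_%:R); congr (nat_of_bool _).
by apply/idP/idP; rewrite !inE /Q !cubeE ?ltW//= ?subr0 ?addrK.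
Qed.

Lemma bcs_average_sqr w x : bcs w -> bcs (fun y => \1_Q y * (w x - w (y + x)) ^+ 2).
Proof.
move=> bw; apply: bcs_indic_cube; last exact: ltW.
  apply: measurable_funX; apply: measurable_funB => //.
  exact: bcs_measurable (bcs_shift x bw).
have [_ [M HM] _] := bw; move=> r; exists ((2 * M) ^+ 2) => y _.
rewrite ger0_norm ?sqr_ge0// -[X in X <= _]real_normK ?num_real//.
have M0 : 0 <= M by apply: le_trans (HM 0).
rewrite lerXn2r ?nnegrE ?mulr_ge0//; apply: le_trans (ler_normB _ _) _.
by rewrite mulrDl mul1r lerD.
Qed.

(** Tonelli exchanges the position x and the displacement y; for each y in the cube, [translate]
    bounds the integral over x. *)
Lemma average_approx w : C1 w -> bcs w ->
  measurable_fun setT (fun x => V^-1 * RI (fun y => \1_Q y * (w x - w (y + x)) ^+ 2)) /\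
  (\int[lebesgue_rV n]_x (V^-1 * RI (fun y => \1_Q y * (w x - w (y + x)) ^+ 2))%:E <=
   (n%:R * h ^+ 2 * grad2 w)%:E)%E.
Proof.
move=> Cw bw.
have [mw _ _] := bw.
pose F (p : 'rV[R]_n * 'rV[R]_n) : \bar R := (V^-1 * (\1_Q p.2 * (w p.1 - w (p.2 + p.1)) ^+ 2))%:E.
have F0 p : (0 <= F p)%E.
  rewrite /F lee_fin; apply: mulr_ge0; first by rewrite invr_ge0 ltW.
  by apply: mulr_ge0; [rewrite indicE|exact: sqr_ge0].
have madd : measurable_fun setT (fun p : 'rV[R]_n * 'rV[R]_n => p.2 + p.1).
  apply: measurable_fun_rVP => i.
  rewrite (_ : (fun t => _) = (fun p : 'rV[R]_n * 'rV[R]_n => p.2 0 i + p.1 0 i)); last first.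
    by apply/funext => p; rewrite mxE.
  apply: measurable_funD.
    exact: (measurableT_comp (measurable_rV_coord i) measurable_snd).
  exact: (measurableT_comp (measurable_rV_coord i) measurable_fst).
have mQ : measurable_fun setT (\1_Q : 'rV[R]_n -> R).
  by apply: measurable_indic; exact: measurable_cube.
have mF : measurable_fun setT F.
  apply/measurable_EFinP; apply: measurable_funM => //; apply: measurable_funM.
    exact: (measurableT_comp mQ measurable_snd).
  apply: measurable_funX; apply: measurable_funB.
    exact: (measurableT_comp mw measurable_fst).
  exact: (measurableT_comp mw madd).
have bx x := bcs_average_sqr x bw.
have FE x : (V^-1 * RI (fun y => \1_Q y * (w x - w (y + x)) ^+ 2))%:E =
    (\int[lebesgue_rV n]_y F (x, y))%E.
  by rewrite -RI_Z// RI_EFin//; exact: bcsZ.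
split.
  apply/measurable_EFinP.
  have := measurable_fun_fubini_tonelli_F (m2 := lebesgue_rV n) F mF F0.
  congr (measurable_fun _ _); apply/funext => x /=; rewrite FE //.
rewrite (eq_integral (fun x => \int[lebesgue_rV n]_y F (x, y))%E); last by move=> x _; exact: FE.
rewrite (fubini_tonelli (m1 := lebesgue_rV n) (m2 := lebesgue_rV n) F)//.
pose K := n%:R * h ^+ 2 * grad2 w.
have K0 : 0 <= K by rewrite mulr_ge0 ?grad2_ge0// mulr_ge0// sqr_ge0.
apply: (@le_trans _ _ (\int[lebesgue_rV n]_y ((V^-1 * K) * \1_Q y)%:E)%E); last first.
  have bQ : bcs (\1_Q : 'rV[R]_n -> R) by apply: bcs_indic; exact: ltW.
  rewrite -(RI_EFin (bcsZ (V^-1 * K) bQ)) (RI_Z _ bQ) (RI_indic_cube 0 (ltW h0)) -/V.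
  by rewrite mulrAC mulVf ?gt_eqF// mul1r.
apply: ge0_le_integral => //.
- by move=> y _; apply: integral_ge0.
- exact: (measurable_fun_fubini_tonelli_G (m1 := lebesgue_rV n) F).
- apply/measurable_EFinP; exact: measurable_funM.
- move=> y _; rewrite /F/=.
  have [yQ|yQ] := boolP (y \in Q); last first.
    rewrite integral0_eq; first by rewrite indicE (negbTE yQ) mulr0.
    by move=> x _; rewrite indicE (negbTE yQ) mul0r mulr0.
  have bd : bcs (fun x => (w x - w (y + x)) ^+ 2).
    apply: bcs_sqr; apply: bcsB => //; under eq_fun do rewrite addrC; exact: bcs_shift.
  rewrite (eq_integral (fun x => (V^-1 * (w x - w (y + x)) ^+ 2)%:E)); last first.
    by move=> x _; rewrite indicE yQ mul1r.
  rewrite indicE yQ mulr1 -(RI_EFin (bcsZ V^-1 bd)) lee_fin RI_Z// ler_pM2l ?invr_gt0//.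
  rewrite (RI_ext (g := fun x => (w (x + y) - w x) ^+ 2)); last first.
    by move=> x; rewrite (addrC y) -sqrrN opprB.
  apply: le_trans (translate _ Cw bw) _; apply: ler_wpM2r; first exact: grad2_ge0.
  rewrite ler_wpM2l// lerXn2r ?nnegrE ?normr_ge0 ?(ltW h0)//.
  move: yQ; rewrite inE /Q cubeE ?(ltW h0)//= subr0 => H.
  by apply: (le_trans H); have := h0; lra.
Qed.

End average.

Lemma cube_cover (rho d : R) : 0 <= rho -> 0 < d ->
  exists s : seq 'rV[R]_n, forall x, `|x| <= rho -> exists2 y, y \in s & `|x - y| <= d.
Proof.
move=> r0 d0.
have cK : compact [set x : 'rV[R]_n | `|x| <= rho].
  apply: bounded_closed_compact.
    by exists rho; split; [rewrite num_real|move=> M rM x /= /le_trans; apply; exact: ltW].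
  apply: (@closed_comp _ _ (fun x : 'rV[R]_n => `|x|) [set t | t <= rho]); last exact: closed_le.
  by move=> x _; exact: norm_continuous.
have := cK; rewrite compact_cover => /(_ _ setT (fun y : 'rV[R]_n => ball y d)).
case.
- by move=> y _; exact: ball_open.
- by move=> x _; exists x => //; exact: ballxx.
move=> D _ cov; exists (finmap.enum_fset D) => x xr.
have [y yD xy] := cov x xr; exists y => //.
by move: xy; rewrite mx_norm_ball /ball_/= distrC => /ltW.
Qed.

(** Averages over cubes of edge [h] are close to [w] in the mean, and vary so slowly that their
    values on a finite net of mesh [d] determine them up to a small error; these values are the
    functionals. Both errors are small multiples of [grad2 w]; [h] is chosen first, then [d]
    depending on it. *)
Lemma rellich_bound (rho e : R) : 0 <= rho -> 0 < e ->
  exists2 s : seq ('rV[R]_n -> R), forall b, b \in s -> bcs b &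
  forall w, C1 w -> bcs w -> (forall x, rho < `|x| -> w x = 0) ->
    RI (fun x => w x ^+ 2) <= e * grad2 w + \sum_(b <- s) RI (fun x => w x * b x) ^+ 2.
Proof.
move=> rho0 e0.
have n1 : 0 < n%:R + 1 :> R by rewrite ltr_wpDl.
have [h h0 hh] : exists2 h : R, 0 < h & 2 * (n%:R * h ^+ 2) <= e / 2.
  exists (Num.min 1 (e / (4 * (n%:R + 1)))); first by rewrite lt_min ltr01 divr_gt0// mulr_gt0.
  set h := Num.min _ _.
  have h0 : 0 < h by rewrite lt_min ltr01 divr_gt0// mulr_gt0.
  have h1 : h <= 1 by rewrite ge_min lexx.
  have h2 : h <= e / (4 * (n%:R + 1)) by rewrite ge_min lexx orbT.
  move: h2; rewrite ler_pdivlMr ?mulr_gt0// => h2.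
  have nn : 0 <= n%:R :> R by [].
  have : h ^+ 2 <= h by rewrite expr2 ler_piMl// ltW.
  clearbody h; nra.
pose V := h ^+ n; have V0 : 0 < V by rewrite exprn_gt0.
pose W := (2 * rho) ^+ n; have W0 : 0 <= W by rewrite exprn_ge0// mulr_ge0.
have [d d0 dd] : exists2 d : R, 0 < d & W * (4 * V^-1 * (n%:R * d ^+ 2)) <= e / 2.
  pose k0 := 4 * V^-1 * (n%:R + 1) * (W + 1).
  have k00 : 0 < k0 by rewrite !mulr_gt0 ?invr_gt0// ltr_wpDl.
  exists (Num.min 1 (e / (2 * k0))); first by rewrite lt_min ltr01 divr_gt0// mulr_gt0.
  set d := Num.min _ _.
  have d0 : 0 < d by rewrite lt_min ltr01 divr_gt0// mulr_gt0.
  have d1 : d <= 1 by rewrite ge_min lexx.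
  have d2 : d <= e / (2 * k0) by rewrite ge_min lexx orbT.
  have dsq : d ^+ 2 <= d by rewrite expr2 ler_piMl// ltW.
  have kd : k0 * d <= e / 2.
    have k20 : 0 < 2 * k0 by exact: mulr_gt0.
    by move: d2; rewrite (ler_pdivlMr _ _ k20) => d2; lra.
  apply: le_trans kd.
  have -> : W * (4 * V^-1 * (n%:R * d ^+ 2)) = 4 * V^-1 * (n%:R * W * d ^+ 2) by ring.
  have -> : k0 * d = 4 * V^-1 * ((n%:R + 1) * (W + 1) * d) by rewrite /k0; ring.
  have V4 : 0 <= 4 * V^-1 by rewrite mulr_ge0// invr_ge0 ltW.
  apply: (ler_wpM2l V4).
  have nn : 0 <= n%:R :> R by [].
  have nW : 0 <= n%:R * W by rewrite mulr_ge0.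
  have A : n%:R * W * d ^+ 2 <= n%:R * W * d by rewrite ler_wpM2l.
  have B : n%:R * W <= (n%:R + 1) * (W + 1) by nra.
  exact: (le_trans A (ler_wpM2r (ltW d0) B)).
have [s sP] := cube_cover rho0 d0.
(* The square of [c] is the factor 4 of the pointwise estimate times the volume of a cube of the
   cover. *)
pose c := 2 * Num.sqrt ((2 * d) ^+ n).
exists [seq (fun y => c * (V^-1 * \1_(cube x h) y)) | x <- s].
  by move=> b /mapP[x _ ->]; apply: bcsZ; apply: bcsZ; apply: bcs_indic; exact: ltW.
move=> w Cw bw wr.
have G0 := grad2_ge0 w.
pose Q := cube (0 : 'rV[R]_n) h.
pose A := average h w.
pose K := 4 * V^-1 * (n%:R * d ^+ 2) * grad2 w.
have K0 : 0 <= K.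
  by rewrite mulr_ge0// mulr_ge0// ?mulr_ge0 ?invr_ge0 ?sqr_ge0// ltW.
pose B x := V^-1 * RI (fun y => \1_Q y * (w x - w (y + x)) ^+ 2).
have B0 x : 0 <= B x.
  apply: mulr_ge0; first by rewrite invr_ge0 ltW.
  apply: RI_ge0 => y.
  by rewrite mulr_ge0 ?sqr_ge0// indicE.
(* What is left besides the oscillation [B]: each point of the ball lies in the cube of some net
   point y and picks up [4 A y ^+ 2], while [K] pays for replacing the average at x by that at y. *)
pose S x := \sum_(y <- s) (4 * A y ^+ 2) * \1_(cube y (2 * d)) x + K * \1_(cube (0 : 'rV[R]_n) (2 * rho)) x.
have d20 : 0 <= 2 * d by rewrite mulr_ge0// ltW.
have r20 : 0 <= 2 * rho by rewrite mulr_ge0.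
have bS : bcs S.
  by apply: bcsD; [apply: bcs_sum => y; apply: bcsZ; exact: bcs_indic|apply: bcsZ; exact: bcs_indic].
have S0 x : 0 <= S x.
  apply: addr_ge0; last by rewrite mulr_ge0// indicE.
  by apply: sumr_ge0 => y _; rewrite mulr_ge0 ?indicE// mulr_ge0 ?sqr_ge0.
have pw x : w x ^+ 2 <= 2 * B x + S x.
  have [xr|xr] := leP `|x| rho; last first.
    by rewrite wr// expr0n/= addr_ge0// mulr_ge0.
  have [y ys xy] := sP x xr.
  have J : (w x - A x) ^+ 2 <= B x.
    have bQ : bcs (\1_Q : 'rV[R]_n -> R) by apply: bcs_indic; exact: ltW.
    have bd2 : bcs (fun y => w x * \1_Q y - \1_Q y * w (y + x)).
      by apply: bcsB; [exact: bcsZ|exact/bcs_indicM/bcs_shift].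
    have -> : w x - A x = V^-1 * RI (fun y => w x * \1_Q y - \1_Q y * w (y + x)).
      rewrite RI_B; [|exact: bcsZ|exact/bcs_indicM/bcs_shift].
      rewrite RI_Z ?RI_indic_cube ?ltW//.
      by rewrite mulrBr mulrCA mulVf ?mulr1// gt_eqF.
    have E z : \1_Q z * (w x * \1_Q z - \1_Q z * w (z + x)) = w x * \1_Q z - \1_Q z * w (z + x).
      by rewrite indicE; case: (_ \in _); rewrite ?mul1r ?mulr1// !mul0r mulr0 subr0.
    have E2 z : \1_Q z * (w x * \1_Q z - \1_Q z * w (z + x)) ^+ 2 = \1_Q z * (w x - w (z + x)) ^+ 2.
      by rewrite indicE; case: (_ \in _); rewrite ?mul1r ?mulr1// !mul0r.
    by have := jensen h0 bd2; rewrite (RI_ext E) (RI_ext E2).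
  have D : (A x - A y) ^+ 2 <= V^-1 * (n%:R * d ^+ 2 * grad2 w).
    apply: le_trans (average_diff h0 x y Cw bw) _.
    by rewrite ler_pM2l ?invr_gt0// ler_wpM2r// ler_wpM2l// lerXn2r ?nnegrE// ltW.
  have Sx : 4 * A y ^+ 2 + K <= S x.
    rewrite /S [X in _ <= _ + X](_ : _ = K); last first.
      by rewrite indicE mem_set ?mulr1// cubeE//= subr0 mulrAC divff// mul1r.
    rewrite lerD2r (big_rem y)//= [X in _ <= X + _](_ : _ = 4 * A y ^+ 2); last first.
      by rewrite indicE mem_set ?mulr1// cubeE//= mulrAC divff// mul1r.
    rewrite lerDl; apply: sumr_ge0 => z _; rewrite mulr_ge0 ?indicE//.
    by rewrite mulr_ge0 ?sqr_ge0.
  have KE : K = 4 * (V^-1 * (n%:R * d ^+ 2 * grad2 w)) by rewrite /K; ring.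
  have : w x ^+ 2 <= 2 * (w x - A x) ^+ 2 + 4 * (A x - A y) ^+ 2 + 4 * A y ^+ 2.
    have := sqr_ge0 (w x - 2 * A x); have := sqr_ge0 (A x - 2 * A y).
    move: (w x) (A x) (A y) => a b c'; nra.
  move: (w x ^+ 2) ((w x - A x) ^+ 2) ((A x - A y) ^+ 2) (A y ^+ 2) J D Sx; rewrite KE.
  move: (V^-1 * _) (B x) (S x) => *; lra.
have bw2 := bcs_sqr bw.
rewrite -lee_fin RI_EFin//.
have [mB IB] := average_approx h0 Cw bw.
apply: (@le_trans _ _ (\int[lebesgue_rV n]_x ((2 * B x)%:E + (S x)%:E))%E).
  apply: ge0_le_integral => //.
  - by move=> x _; rewrite lee_fin sqr_ge0.
  - by apply/measurable_EFinP; exact: bcs_measurable.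
  - apply: emeasurable_funD; apply/measurable_EFinP; first exact: measurable_funM.
    exact: bcs_measurable.
  - by move=> x _; rewrite -EFinD lee_fin.
rewrite ge0_integralD//; last 4 first.
- by move=> x _; rewrite lee_fin mulr_ge0.
- by apply/measurable_EFinP; exact: measurable_funM.
- by move=> x _; rewrite lee_fin.
- by apply/measurable_EFinP; exact: bcs_measurable.
rewrite (eq_integral (fun x => (2%:E * (B x)%:E)%E)); last by move=> x _; rewrite EFinM.
rewrite ge0_integralZl//; last 2 first.
- exact/measurable_EFinP.
- by move=> x _; rewrite lee_fin.
rewrite -(RI_EFin bS).
apply: (@le_trans _ _ (2%:E * (n%:R * h ^+ 2 * grad2 w)%:E + (RI S)%:E)%E).
  by rewrite leeD2r// lee_wpmul2l ?lee_fin.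
rewrite -EFinM -EFinD lee_fin.
rewrite RI_D; [|by apply: bcs_sum => y; apply: bcsZ; exact: bcs_indic|by apply: bcsZ; exact: bcs_indic].
rewrite RI_sum; last by move=> y; apply: bcsZ; exact: bcs_indic.
rewrite RI_Z ?RI_indic_cube//; last exact: bcs_indic.
rewrite big_map.
have -> : \sum_(y <- s) RI (fun x => 4 * A y ^+ 2 * \1_(cube y (2 * d)) x) =
   \sum_(y <- s) RI (fun x => w x * (c * (V^-1 * \1_(cube y h) x))) ^+ 2.
  apply: eq_bigr => y _; rewrite RI_Z ?RI_indic_cube//; last exact: bcs_indic.
  have -> : RI (fun x => w x * (c * (V^-1 * \1_(cube y h) x))) = c * A y.
    rewrite /A average_test// -RI_Z.
      by apply: RI_ext => z; rewrite mulrCA.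
    by apply: bcsMb => //; apply: bcsZ; apply: bcs_indic; exact: ltW.
  have cs : c ^+ 2 = 4 * (2 * d) ^+ n.
    by rewrite /c exprMn sqr_sqrtr ?exprn_ge0// -natrX.
  by rewrite [(c * A y) ^+ 2]exprMn cs; ring.
rewrite -/W -/K; have -> : K * W = W * (4 * V^-1 * (n%:R * d ^+ 2)) * grad2 w by rewrite /K; ring.
have A1 := ler_wpM2r G0 hh; have A2 := ler_wpM2r G0 dd.
move: A1 A2; move: (W * _) => WW; move: (n%:R * h ^+ 2) (\sum_(_ <- _) _) => a b; lra.
Qed.

End rellich.

(** * Square-integrable functions *)

Section real_L2.
Context {R : realType} {n : nat}.
Local Notation mu := (@lebesgue_rV R n).
Implicit Types f g h : 'rV[R]_n -> R.

Definition sqi f : \bar R := (\int[mu]_x (f x ^+ 2)%:E)%E.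

Arguments sqi f%_R.

Definition l2 f := measurable_fun setT f /\ (sqi f < +oo)%E.

Lemma sqi_ge0 f : (0 <= sqi f)%E.
Proof. by apply: integral_ge0 => x _; rewrite lee_fin sqr_ge0. Qed.

Lemma msqr f : measurable_fun setT f -> measurable_fun setT (fun x => (f x ^+ 2)%:E).
Proof. by move=> mf; apply/measurable_EFinP; exact: measurable_funX. Qed.

Lemma sqi_bound f g h (a b : R) : measurable_fun setT f -> measurable_fun setT g ->
  measurable_fun setT h -> 0 <= a -> 0 <= b ->
  (forall x, h x ^+ 2 <= a * f x ^+ 2 + b * g x ^+ 2) ->
  (sqi h <= a%:E * sqi f + b%:E * sqi g)%E.
Proof.
move=> mf mg mh a0 b0 H.
have msc (k : R) (u : 'rV[R]_n -> R) : measurable_fun setT u -> measurable_fun setT (fun x => (k * u x ^+ 2)%:E).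
  by move=> mu'; apply/measurable_EFinP; apply: measurable_funM => //; exact: measurable_funX.
apply: (@le_trans _ _ (\int[mu]_x ((a * f x ^+ 2)%:E + (b * g x ^+ 2)%:E))%E).
  apply: ge0_le_integral => //.
  - by move=> x _; rewrite lee_fin sqr_ge0.
  - exact: msqr.
  - by apply: emeasurable_funD; exact: msc.
  - by move=> x _; rewrite -EFinD lee_fin.
rewrite ge0_integralD//; last 4 first.
- by move=> x _; rewrite lee_fin mulr_ge0 ?sqr_ge0.
- exact: msc.
- by move=> x _; rewrite lee_fin mulr_ge0 ?sqr_ge0.
- exact: msc.
apply: leeD.
  under eq_integral do rewrite EFinM.
  rewrite ge0_integralZl//; first exact: msqr.
  by move=> x _; rewrite lee_fin sqr_ge0.
under eq_integral do rewrite EFinM.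
rewrite ge0_integralZl//; first exact: msqr.
by move=> x _; rewrite lee_fin sqr_ge0.
Qed.

Lemma l2D f g : l2 f -> l2 g -> l2 (fun x => f x + g x).
Proof.
move=> [mf f2] [mg g2]; have mh := measurable_funD mf mg; split => //.
apply: (@le_lt_trans _ _ (2%:E * sqi f + 2%:E * sqi g)%E).
  by apply: sqi_bound => // x; have := sqr_ge0 (f x - g x); rewrite /=; nra.
by apply: lte_add_pinfty; apply: lte_mul_pinfty.
Qed.

Lemma l2Z (k : R) f : l2 f -> l2 (fun x => k * f x).
Proof.
move=> [mf f2]; have mh : measurable_fun setT (fun x => k * f x) by exact: measurable_funM.
split => //; apply: (@le_lt_trans _ _ ((k ^+ 2)%:E * sqi f + 0%:E * sqi f)%E).
  by apply: sqi_bound => //; [exact: sqr_ge0|move=> x; rewrite exprMn mul0r addr0].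
by rewrite mul0e adde0; apply: lte_mul_pinfty; rewrite ?lee_fin ?sqr_ge0.
Qed.

Lemma l2N f : l2 f -> l2 (fun x => - f x).
Proof. by move=> /(l2Z (-1)); under eq_fun do rewrite mulN1r. Qed.

Lemma l2B f g : l2 f -> l2 g -> l2 (fun x => f x - g x).
Proof. by move=> lf /l2N; exact: l2D. Qed.

Lemma l2_0 : l2 (fun=> 0).
Proof.
split => //; rewrite /sqi integral0_eq ?ltry// => x _; by rewrite expr0n.
Qed.

Lemma l2_sqr_integrable f : l2 f -> mu.-integrable setT (fun x => (f x ^+ 2)%:E).
Proof.
move=> [mf f2]; apply/integrableP; split; first exact: msqr.
apply: le_lt_trans f2; apply: ge0_le_integral => //.
- by apply: measurableT_comp => //; exact: msqr.
- exact: msqr.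
- by move=> x _; rewrite /= ger0_norm ?sqr_ge0.
Qed.

Lemma l2_mul_integrable f g : l2 f -> l2 g -> mu.-integrable setT (fun x => (f x * g x)%:E).
Proof.
move=> lf lg.
have := integrableD measurableT (l2_sqr_integrable lf) (l2_sqr_integrable lg).
apply: le_integrable => //.
  by apply/measurable_EFinP; apply: measurable_funM; [case: lf|case: lg].
move=> x _ /=; rewrite lee_fin [X in _ <= X]ger0_norm ?addr_ge0 ?sqr_ge0// normrM.
rewrite -(real_normK (num_real (f x))) -(real_normK (num_real (g x))).
have := sqr_ge0 (`|f x| - `|g x|); have := normr_ge0 (f x); have := normr_ge0 (g x).
nra.
Qed.

Lemma bcs_l2 f : bcs f -> l2 f.
Proof.
move=> bf; split; first exact: bcs_measurable.
by rewrite /sqi -(RI_EFin (bcs_sqr bf)) ltry.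
Qed.

Lemma l2_RI_sqr f : l2 f -> (RI (fun x => f x ^+ 2))%:E = sqi f.
Proof.
move=> lf; rewrite /RI /Rintegral fineK//.
exact: integrable_fin_num (l2_sqr_integrable lf).
Qed.

Lemma l2_RI_D f f' g : l2 f -> l2 f' -> l2 g ->
  RI (fun x => (f x + f' x) * g x) = RI (fun x => f x * g x) + RI (fun x => f' x * g x).
Proof.
move=> lf lf' lg; rewrite /RI -RintegralD//; [|exact: l2_mul_integrable..].
by congr Rintegral; apply/funext => x; rewrite mulrDl.
Qed.

Lemma l2_RI_Z k f g : l2 f -> l2 g -> RI (fun x => (k * f x) * g x) = k * RI (fun x => f x * g x).
Proof.
move=> lf lg; rewrite /RI -RintegralZl//; last exact: l2_mul_integrable.
by congr Rintegral; apply/funext => x; rewrite mulrA.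
Qed.

Lemma bound_geometric (c : nat -> \bar R) : (forall k, 0 <= c k)%E ->
  (forall k, c k <= (2^-1 ^+ k)%:E)%E -> (\sum_(0 <= k <oo) c k <= 2%:E)%E.
Proof.
move=> c0 cb; apply: lime_le; first exact: is_cvg_nneseries.
apply: nearW => N.
suff : (\sum_(0 <= k < N) c k <= (2 - 2 * 2^-1 ^+ N)%:E)%E.
  move=> /le_trans; apply; rewrite lee_fin gerBl mulr_ge0// exprn_ge0//.
elim: N => [|N IH].
  by rewrite big_geq// expr0 mulr1 subrr.
rewrite big_nat_recr//=; apply: le_trans (leeD IH (cb N)) _.
by rewrite -EFinD lee_fin exprS; lra.
Qed.

(** With the weights 4^k the integral of [S] is at most the sum of the 2^-k. Hence [S] is finite
    almost everywhere, and where it is the increments are O(2^-k). *)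
Lemma fast_cauchy_limit (g : nat -> 'rV[R]_n -> R) : (forall k, measurable_fun setT (g k)) ->
  (forall k, sqi (fun x => (g k.+1 x - g k x)%R) <= (8^-1 ^+ k)%:E)%E ->
  exists2 f : 'rV[R]_n -> R, measurable_fun setT f & {ae mu, forall x, g k x @[k --> \oo] --> f x}.
Proof.
move=> mg gb.
pose d k x := (4 ^+ k * (g k.+1 x - g k x) ^+ 2)%:E.
have md k : measurable_fun setT (d k).
  apply/measurable_EFinP; apply: measurable_funM => //; apply: measurable_funX.
  exact: measurable_funB.
have d0 k x : (0 <= d k x)%E by rewrite lee_fin mulr_ge0 ?sqr_ge0// exprn_ge0.
pose S x := (\sum_(0 <= k <oo) d k x)%E.
have iS : (\int[mu]_x S x <= 2%:E)%E.
  rewrite /S integral_nneseries//; apply: bound_geometric => k.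
    exact: integral_ge0.
  under eq_integral do rewrite /d EFinM.
  have m2 : measurable_fun setT (fun x => ((g k.+1 x - g k x) ^+ 2)%:E).
    by apply: (msqr (f := fun x => g k.+1 x - g k x)); exact: measurable_funB.
  rewrite ge0_integralZl//;
    try by [rewrite lee_fin exprn_ge0|move=> x _; rewrite lee_fin sqr_ge0|exact: m2].
  apply: le_trans (lee_wpmul2l _ (gb k)) _; first by rewrite lee_fin exprn_ge0.
  by rewrite -EFinM lee_fin -exprMn (_ : 4 * 8^-1 = 2^-1 :> R)//; lra.
have mS : measurable_fun setT S by apply: ge0_emeasurable_sum.
have S0 x : (0 <= S x)%E by apply: nneseries_ge0.
have intS : mu.-integrable setT S.
  apply/integrableP; split => //; apply: le_lt_trans (ltry 2).
  apply: le_trans iS; apply: ge0_le_integral => //.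
  - exact: measurableT_comp.
  - by move=> x _; rewrite gee0_abs.
have conv x : S x \is a fin_num -> cvgn (fun k => g k x).
  move=> Sf; pose M := fine (S x) + 1.
  have M0 : 0 <= fine (S x) by apply: fine_ge0.
  have dM k : (g k.+1 x - g k x) ^+ 2 <= M * 4^-1 ^+ k.
    have : (d k x <= S x)%E.
      have := @nneseries_lim_ge R (fun i => d i x) xpredT 0%N k.+1 (fun i _ _ => d0 i x).
      apply: le_trans; rewrite big_nat_recr//= leeDr//.
      by apply: sume_ge0 => i _; exact: d0.
    rewrite -(fineK Sf) lee_fin => H.
    rewrite exprVn ler_pdivlMr ?exprn_gt0// mulrC; apply: le_trans H _.
    by rewrite /M lerDl.
  have M1 : 0 < M by rewrite /M ltr_wpDl.
  (* [M <= C ^+ 2] dispenses with a square root. *)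
  pose C := M + 1.
  have step k : `|g k.+1 x - g k x| <= C * 2^-1 ^+ k.
    have C0 : 0 <= C * 2^-1 ^+ k by rewrite mulr_ge0 ?exprn_ge0// /C; lra.
    rewrite -(@ler_pXn2r _ 2)// ?nnegrE// real_normK ?num_real//.
    apply: le_trans (dM k) _; rewrite exprMn -exprM mulnC exprM.
    rewrite [2^-1 ^+ 2](_ : _ = 4^-1); last by lra.
    rewrite ler_wpM2r ?exprn_ge0//; rewrite /C; nra.
  have tail k j : `|g (k + j)%N x - g k x| <= 2 * C * 2^-1 ^+ k.
    suff : `|g (k + j)%N x - g k x| <= 2 * C * 2^-1 ^+ k - 2 * C * 2^-1 ^+ (k + j).
      move=> /le_trans; apply; rewrite gerBl mulr_ge0 ?exprn_ge0// /C; lra.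
    elim: j => [|j IH]; first by rewrite addn0 !subrr normr0.
    rewrite addnS; have := ler_distD (g (k + j)%N x) (g (k + j).+1 x) (g k x).
    have := step (k + j)%N; rewrite [2^-1 ^+ (k + j).+1]exprS.
    move: IH; move: (2^-1 ^+ (k + j)) (2^-1 ^+ k) => a b; lra.
  apply: real_cauchy_cvg => e e0.
  have C0 : 0 < 4 * C by rewrite /C; lra.
  have /cvg0P/(_ (e / (4 * C))) : (fun k => 2^-1 ^+ k) @ \oo --> (0 : R).
    by apply: cvg_expr; rewrite ger0_norm//; lra.
  rewrite divr_gt0// => /(_ isT)[N HN].
  exists N => k l Nk Nl.
  have := HN N (leqnn _); rewrite ger0_norm ?exprn_ge0// ltr_pdivlMr// => HN'.
  have := tail N (k - N)%N; have := tail N (l - N)%N; rewrite !subnKC//.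
  have := ler_distD (g N x) (g k x) (g l x); rewrite (distrC (g N x)).
  move: HN'; move: (2^-1 ^+ N) => a; lra.
(* The upper limit is measurable whatever happens on the exceptional null set. *)
exists (fun x => fine (limn_esup (fun k => (g k x)%:E))).
  apply: measurableT_comp; first exact: fine_measurable.
  by apply: measurable_fun_limn_esup => k; apply/measurable_EFinP.
have := integrable_ae measurableT intS; apply: filterS => x /(_ Logic.I) Sf.
have cg := conv x Sf.
rewrite (_ : limn_esup _ = (limn (fun k => g k x))%:E) //.
have : (fun k => (g k x)%:E) @ \oo --> (limn (fun k => g k x))%:E.
  by apply/fine_cvgP; split; [exact: nearW|exact: cg].
by move=> /cvg_limn_einf_sup[_].
Qed.

(** Fatou's lemma for [h - g k]: it converts the Cauchy property in mean into convergence in mean to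
    the pointwise limit. *)
Lemma fatou_sqi (g : nat -> 'rV[R]_n -> R) f h (e : \bar R) : measurable_fun setT f ->
  measurable_fun setT h -> (forall k, measurable_fun setT (g k)) ->
  {ae mu, forall x, g k x @[k --> \oo] --> f x} ->
  (\forall k \near \oo, sqi (fun x => (h x - g k x)%R) <= e)%E ->
  (sqi (fun x => (h x - f x)%R) <= e)%E.
Proof.
move=> mf mh mg gf ge.
have md k : measurable_fun setT (fun x => ((h x - g k x) ^+ 2)%:E).
  by apply: msqr; exact: measurable_funB.
have d0 k x : (0 <= ((h x - g k x) ^+ 2)%:E :> \bar R)%E by rewrite lee_fin sqr_ge0.
have E : (sqi (fun x => (h x - f x)%R) = \int[mu]_x limn_einf (fun k => ((h x - g k x) ^+ 2)%:E))%E.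
  apply: ge0_ae_eq_integral => //.
  - by apply: msqr; exact: measurable_funB.
  - rewrite (_ : (fun x => _) =
        (fun x => - limn_esup (-%E \o (fun k => ((h x - g k x) ^+ 2)%:E)))%E); last first.
      by apply/funext => x; rewrite limn_esupN oppeK.
    apply: (measurableT_comp (f := -%E)) => //; apply: measurable_fun_limn_esup => k.
    exact: (measurableT_comp (f := -%E) _ (md k)).
  - by move=> x _; rewrite lee_fin sqr_ge0.
  - move=> x _; rewrite limn_einf_lim; apply: lime_ge; first exact: is_cvg_einfs.
    apply: nearW => k; apply: le_ereal_inf_tmp => _ [j _ <-]; exact: d0.
  - apply: filterS gf => x gx _.
    have : (fun k => ((h x - g k x) ^+ 2)%:E) @ \oo --> ((h x - f x) ^+ 2)%:E.
      apply/fine_cvgP; split; first exact: nearW.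
      rewrite (_ : _ \o _ = (fun k => (h x - g k x) * (h x - g k x))); last first.
        by apply/funext => k /=; rewrite expr2.
      rewrite expr2; have c : (fun k => h x - g k x) @ \oo --> h x - f x.
        by apply: seq_cvgB => //; exact: cvg_cst.
      exact: (cvgM c c).
    by move=> /cvg_limn_einf_sup[->].
rewrite E; apply: le_trans (fatou mu measurableT md (fun k x _ => d0 k x)) _.
have [N _ HN] := ge.
rewrite limn_einf_lim; apply: lime_le; first exact: is_cvg_einfs.
apply: nearW => k; apply: le_trans (HN (maxn k N) (leq_maxr _ _)).
by apply: ereal_inf_lbound; exists (maxn k N) => //=; exact: leq_maxl.
Qed.

Lemma l2_complete (f : nat -> 'rV[R]_n -> R) : (forall k, l2 (f k)) ->
  (forall e : R, 0 < e -> exists N, forall k l, (N <= k)%N -> (N <= l)%N ->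
     RI (fun x => (f k x - f l x) ^+ 2) < e) ->
  exists2 g : 'rV[R]_n -> R, l2 g & (fun k => RI (fun x => (f k x - g x) ^+ 2)) @ \oo --> (0 : R).
Proof.
move=> lf cf.
have mf k : measurable_fun setT (f k) by case: (lf k).
have sE k l : sqi (fun x => (f k x - f l x)%R) = (RI (fun x => (f k x - f l x) ^+ 2))%:E.
  by rewrite (l2_RI_sqr (l2B (lf k) (lf l))).
have /choice[N NP] : forall j : nat, exists N, forall k l, (N <= k)%N -> (N <= l)%N ->
    RI (fun x => (f k x - f l x) ^+ 2) < 8^-1 ^+ j.
  by move=> j; apply: cf; rewrite exprn_gt0.
(* Strictly increasing indices beyond [N k], so that consecutive terms satisfy the bound of
   [fast_cauchy_limit]. *)
pose sg := fix F (k : nat) : nat := if k is k'.+1 then maxn (N k'.+1) (F k').+1 else N 0%N.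
have sgN k : (N k <= sg k)%N by case: k => [|k] //=; exact: leq_maxl.
have sgS k : (sg k < sg k.+1)%N by rewrite /=; exact: leq_maxr.
have sgk k : (k <= sg k)%N by elim: k => // k IH; exact: leq_ltn_trans IH (sgS k).
have [g mg gP] : exists2 g : 'rV[R]_n -> R, measurable_fun setT g & {ae mu, forall x, f (sg k) x @[k --> \oo] --> g x}.
  apply: fast_cauchy_limit => [k|k]; first exact: mf.
  rewrite sE lee_fin ltW//; apply: NP; last exact: sgN.
  exact: leq_trans (sgN k) (ltnW (sgS k)).
have bnd (e : R) : 0 < e -> exists M, forall k, (M <= k)%N -> (sqi (fun x => (f k x - g x)%R) <= e%:E)%E.
  move=> e0; have [M HM] := cf e e0; exists M => k Mk.
  apply: (@fatou_sqi (fun j => f (sg j))) => //.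
  exists M => // j /= Mj; rewrite sE lee_fin ltW//; apply: HM => //.
  exact: leq_trans Mj (sgk j).
have ld k : (exists e : R, (sqi (fun x => (f k x - g x)%R) <= e%:E)%E) -> l2 (fun x => f k x - g x).
  move=> [e He]; split; first exact: measurable_funB.
  exact: le_lt_trans He (ltry _).
have lg : l2 g.
  have [M HM] := bnd 1 ltr01.
  have lM : l2 (fun x => f M x - g x) by apply: ld; exists 1; exact: HM.
  have := l2B (lf M) lM.
  by rewrite (_ : (fun x => f M x - (f M x - g x)) = g)//; apply/funext => x; rewrite subKr.
exists g => //; apply/cvg0P => e e0.
have [|M HM] := bnd (e / 2); first by rewrite divr_gt0.
exists M => k Mk; rewrite ger0_norm; last by apply: RI_ge0 => x; exact: sqr_ge0.
have := HM k Mk; rewrite -(l2_RI_sqr (l2B (lf k) lg)) lee_fin; lra.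
Qed.

End real_L2.

Section complex_L2.
Context {R : realType} {n : nat}.
Local Notation E := ('rV[R]_n -> R[i]^o).
Implicit Types (u v : E).

Definition re_inner u v : R := RI (fun x => re_fun u x * re_fun v x + im_fun u x * im_fun v x).

Definition L2 : set E := [set u | L2_on setT u].

Lemma re_funP (z : R[i]) u v : re_fun (z *: u + v : E) =
  (fun x => complex.Re z * re_fun u x - complex.Im z * im_fun u x + re_fun v x).
Proof.
apply/funext => x; rewrite /re_fun/= /im_fun.
rewrite [(z *: u + v) x](_ : _ = z * u x + v x)//.
by case: z (u x) (v x) => a b [c d] [e f].
Qed.

Lemma im_funP (z : R[i]) u v : im_fun (z *: u + v : E) =
  (fun x => complex.Re z * im_fun u x + complex.Im z * re_fun u x + im_fun v x).
Proof.
apply/funext => x; rewrite /re_fun/= /im_fun.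
rewrite [(z *: u + v) x](_ : _ = z * u x + v x)//.
by case: z (u x) (v x) => a b [c d] [e f].
Qed.

Lemma re_funD u v : re_fun (u + v : E) = (fun x => re_fun u x + re_fun v x).
Proof. by apply/funext => x; rewrite /re_fun [(u + v) x](_ : _ = u x + v x)//; case: (u x) (v x) => a b []. Qed.

Lemma im_funD u v : im_fun (u + v : E) = (fun x => im_fun u x + im_fun v x).
Proof. by apply/funext => x; rewrite /im_fun [(u + v) x](_ : _ = u x + v x)//; case: (u x) (v x) => a b []. Qed.

Lemma re_funB u v : re_fun (u - v : E) = (fun x => re_fun u x - re_fun v x).
Proof. by apply/funext => x; rewrite /re_fun [(u - v) x](_ : _ = u x - v x)//; case: (u x) (v x) => a b []. Qed.

Lemma im_funB u v : im_fun (u - v : E) = (fun x => im_fun u x - im_fun v x).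
Proof. by apply/funext => x; rewrite /im_fun [(u - v) x](_ : _ = u x - v x)//; case: (u x) (v x) => a b []. Qed.

Lemma re_funZ (r : R) u : re_fun (r%:C%C *: u : E) = (fun x => r * re_fun u x).
Proof.
apply/funext => x; rewrite /re_fun [(_ *: u) x](_ : _ = r%:C%C * u x)//.
by case: (u x) => a b /=; rewrite mul0r subr0.
Qed.

Lemma im_funZ (r : R) u : im_fun (r%:C%C *: u : E) = (fun x => r * im_fun u x).
Proof.
apply/funext => x; rewrite /im_fun [(_ *: u) x](_ : _ = r%:C%C * u x)//.
by case: (u x) => a b /=; rewrite mul0r addr0.
Qed.

Lemma re_funi u : re_fun ('i%C *: u : E) = (fun x => - im_fun u x).
Proof.
apply/funext => x; rewrite /re_fun /im_fun [(_ *: u) x](_ : _ = 'i%C * u x)//.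
by case: (u x) => a b /=; rewrite mul0r mul1r sub0r.
Qed.

Lemma im_funi u : im_fun ('i%C *: u : E) = re_fun u.
Proof.
apply/funext => x; rewrite /re_fun /im_fun [(_ *: u) x](_ : _ = 'i%C * u x)//.
by case: (u x) => a b /=; rewrite mul0r mul1r add0r.
Qed.

Lemma sqnormE u : measurable_fun setT (re_fun u) -> measurable_fun setT (im_fun u) ->
  sqnorm_on setT u = (sqi (re_fun u) + sqi (im_fun u))%E.
Proof.
move=> mr mi; rewrite /sqnorm_on /sqi -ge0_integralD//.
- by move=> x _; rewrite lee_fin sqr_ge0.
- exact: msqr.
- by move=> x _; rewrite lee_fin sqr_ge0.
- exact: msqr.
Qed.

Lemma L2P u : L2 u <-> l2 (re_fun u) /\ l2 (im_fun u).
Proof.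
split=> [[mr mi fin]|[[mr r2] [mi i2]]].
  move: fin; rewrite sqnormE// => fin.
  have r0 := sqi_ge0 (re_fun u); have i0 := sqi_ge0 (im_fun u).
  by split; split => //; apply: le_lt_trans fin; rewrite ?leeDl ?leeDr.
by split => //; rewrite sqnormE//; exact: lte_add_pinfty.
Qed.

Lemma re_innerE u v : L2 u -> L2 v -> re_inner u v =
  RI (fun x => re_fun u x * re_fun v x) + RI (fun x => im_fun u x * im_fun v x).
Proof.
move=> /L2P[ru iu] /L2P[rv iv]; rewrite /re_inner /RI RintegralD//; exact: l2_mul_integrable.
Qed.

Lemma L2_sqnorm u : L2 u -> sqnorm_on setT u = (re_inner u u)%:E.
Proof.
move=> Lu; have /L2P[ru iu] := Lu.
rewrite sqnormE; [|by case: ru|by case: iu].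
by rewrite re_innerE// EFinD -!l2_RI_sqr.
Qed.

Lemma re_inner_inner u v : complex.Re (inner u v) = re_inner u v.
Proof.
rewrite /inner/= /re_inner /RI; apply: eq_Rintegral => x _; rewrite /re_fun /im_fun.
by case: (u x) (v x) => a b [c d] /=; ring.
Qed.

Lemma im_inner_inner u v : complex.Im (inner u v) = re_inner u ('i%C *: v : E).
Proof.
rewrite /inner/= /re_inner /RI; apply: eq_Rintegral => x _; rewrite re_funi im_funi /re_fun /im_fun.
by case: (u x) (v x) => a b [c d] /=; ring.
Qed.

Lemma L2_semi_inner : semi_inner L2 re_inner.
Proof.
have LP (z : R[i]) u v : L2 u -> L2 v -> L2 (z *: u + v).
  move=> /L2P[ru iu] /L2P[rv iv]; apply/L2P; rewrite re_funP im_funP; split.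
    by apply: l2D => //; apply: l2B; exact: l2Z.
  by apply: l2D => //; apply: l2D; exact: l2Z.
have L0 : L2 0.
  have r0 : re_fun (0 : E) = (fun=> 0) by [].
  have i0 : im_fun (0 : E) = (fun=> 0) by [].
  by apply/L2P; rewrite r0 i0; split; exact: l2_0.
have LZ z u : L2 u -> L2 (z *: u) by move=> Lu; rewrite -[_ *: _]addr0; exact: LP.
have LD u v : L2 u -> L2 v -> L2 (u + v) by move=> Lu Lv; rewrite -[u]scale1r; exact: LP.
split => //.
- by move=> u v _ _; apply: RI_ext => x; rewrite mulrC (mulrC (im_fun u x)).
- move=> u v w Lu Lv Lw; rewrite !re_innerE//; last exact: LD.
  move: Lu Lv Lw => /L2P[ru iu] /L2P[rv iv] /L2P[rw iw].
  by rewrite re_funD im_funD !l2_RI_D//; ring.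
- move=> r u v Lu Lv; rewrite !re_innerE//; last exact: LZ.
  move: Lu Lv => /L2P[ru iu] /L2P[rv iv].
  by rewrite re_funZ im_funZ !l2_RI_Z//; ring.
- move=> u v Lu Lv; rewrite !re_innerE//; [|exact: LZ..].
  move: Lu Lv => /L2P[ru iu] /L2P[rv iv].
  rewrite !re_funi !im_funi.
  rewrite (RI_ext (g := fun x => (-1 * im_fun u x) * re_fun v x)); last by move=> x; rewrite mulN1r.
  rewrite [in RHS](RI_ext (f := fun x => re_fun u x * - im_fun v x)
    (g := fun x => (-1 * im_fun v x) * re_fun u x)); last by move=> x; ring.
  rewrite !l2_RI_Z//; rewrite (RI_ext (f := fun x => re_fun u x * im_fun v x)
    (g := fun x => im_fun v x * re_fun u x)); last by move=> x; rewrite mulrC.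
  ring.
- move=> u _; apply: RI_ge0 => x; rewrite addr_ge0// -expr2 sqr_ge0//.
Qed.

Lemma L2_complete : complete_in L2 re_inner.
Proof.
move=> u_ Lu cu.
have ru k : l2 (re_fun (u_ k)) by have /L2P[] := Lu k.
have iu k : l2 (im_fun (u_ k)) by have /L2P[] := Lu k.
have E1 (u v : E) : L2 u -> L2 v -> re_inner (u - v) (u - v) =
   RI (fun x => (re_fun u x - re_fun v x) ^+ 2) + RI (fun x => (im_fun u x - im_fun v x) ^+ 2).
  move=> Lu' Lv'; rewrite re_innerE; [|exact: (in_B L2_semi_inner)..].
  by rewrite re_funB im_funB.
have [|f lf cf] := l2_complete ru.
  move=> e e0; have [N HN] := cu e e0; exists N => k l Nk Nl.
  apply: le_lt_trans (HN k l Nk Nl); rewrite E1// lerDl.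
  by apply: RI_ge0 => x; exact: sqr_ge0.
have [|g lg cg] := l2_complete iu.
  move=> e e0; have [N HN] := cu e e0; exists N => k l Nk Nl.
  apply: le_lt_trans (HN k l Nk Nl); rewrite E1// lerDr.
  by apply: RI_ge0 => x; exact: sqr_ge0.
pose w : E := fun x => (f x +i* g x)%C.
have Lw : L2 w by apply/L2P.
exists w => //; have := seq_cvgD cf cg; rewrite addr0 /cvg_in.
by rewrite (_ : (fun k => re_inner _ _) = (fun k => RI (fun x => (re_fun (u_ k) x - f x) ^+ 2) +
   RI (fun x => (im_fun (u_ k) x - g x) ^+ 2)))//; apply/funext => k; rewrite E1.
Qed.

Lemma re_inner0_ae u : L2 u -> re_inner u u = 0 -> {ae lebesgue_rV n, forall x, u x = 0}.
Proof.
move=> Lu u0; have := L2_sqnorm Lu; rewrite u0.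
have [mr mi _] := Lu.
have ms : measurable_fun setT (fun x => (sqmod (u x))%:E).
  apply/measurable_EFinP; apply: measurable_funD; exact: measurable_funX.
move=> E0; have : (\int[lebesgue_rV n]_x `|(sqmod (u x))%:E| = 0)%E.
  transitivity (sqnorm_on setT u); last by rewrite E0.
  rewrite /sqnorm_on; apply: eq_integral => x _; rewrite gee0_abs// lee_fin.
  by rewrite addr_ge0// sqr_ge0.
move=> /(ae_eq_integral_abs _ measurableT ms).
apply: filterS => x /(_ Logic.I) [] /eqP; rewrite /sqmod paddr_eq0 ?sqr_ge0// !sqrf_eq0.
by case: (u x) => a b /= /andP[/eqP -> /eqP ->].
Qed.

End complex_L2.

(** * Lipschitz functions *)

Section lipschitz_derivable.
Context {R : realType}.
Local Notation leb := (@lebesgue_measure R).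

Section stieltjes.
Variables (f : R -> R) (K : R).
Hypothesis (ndf : {homo f : x y / x <= y}) (rf : right_continuous f).
Hypothesis (Kf : forall x y, x <= y -> f y - f x <= K * (y - x)).

HB.instance Definition _ := isCumulative.Build R _ R f ndf rf.

Let mu := lebesgue_stieltjes_measure f.

Lemma stieltjes_oc a b : a <= b -> mu `]a, b]%classic = (f b - f a)%:E.
Proof.
move=> ab; rewrite /mu /lebesgue_stieltjes_measure /measure_extension.
rewrite measurable_mu_extE; last exact: is_ocitv.
have := @wlength_itv_bnd R f a b false false ab.
by [].
Qed.

(** A null set is covered by half-open intervals of small total length, and the Stieltjes measure of
    each is at most [K] times its length. *)
Lemma stieltjes_dominated : mu `<< leb.
Proof.
apply/null_content_dominatesP => A mA A0.
have K0 : 0 <= K.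
  have := Kf ler01; have := ndf ler01; rewrite subr0 mulr1; lra.
apply/eqP; rewrite eq_le; apply/andP; split => //.
apply/lee_addgt0Pr => e e0; rewrite add0e.
have K1 : 0 < K + 1 by lra.
have /lb_ereal_inf_adherent : leb A \is a fin_num by rewrite A0.
move=> /(_ (e / (K + 1))); rewrite divr_gt0// => /(_ isT)[_ [F [mF AF] <-]].
rewrite -/(leb A) [X in (_ < X + _)%E -> _]A0 add0e => lt.
apply: (@le_trans _ _ (\sum_(0 <= i <oo) wlength f (F i)))%E.
  by apply: ereal_inf_lbound; exists F.
apply: (@le_trans _ _ (\sum_(0 <= i <oo) (K + 1)%:E * wlength idfun (F i)))%E.
  apply: lee_nneseries => i _ //.
  have [->|[[a b] /= ab ->]] := (ocitvP _).1 (mF i); first by rewrite !wlength0 mule0.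
  rewrite !wlength_itv_bnd ?(ltW ab)// -EFinM lee_fin.
  have := Kf (ltW ab); move: ab; rewrite /=; nra.
rewrite nneseriesZl; last by move=> i _; exact: wlength_ge0.
move: lt => /ltW lt; apply: le_trans (lee_wpmul2l _ lt) _; first by rewrite lee_fin ltW.
by rewrite -EFinM lee_fin mulrC divfK// gt_eqF.
Qed.

(** On a bounded interval the Stieltjes measure is finite and has a Radon-Nikodym density; [f] is an
    integral of it up to a constant, hence differentiable almost everywhere. *)
Lemma stieltjes_derivable_ae (N : nat) :
  {ae leb, forall x, - N%:R < x < N%:R -> derivable f x 1}.
Proof.
pose D : set (measurableTypeR R) := `]- N%:R, N%:R]%classic.
have mD : measurable D by exact: measurable_itv.
have NN : (- N%:R <= N%:R :> R) by have := ler0n R N; lra.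
have fD : (mu D < +oo)%E by rewrite /D stieltjes_oc// ltry.
pose nu : {finite_measure set (measurableTypeR R) -> \bar R} := mfrestr mD fD.
have [|g [g0 gf ig gE]] := @radon_nikodym_sigma_finite _ (measurableTypeR R) R leb nu.
  apply/null_content_dominatesP => A mA A0; rewrite /nu /= /mfrestr /mrestr.
  have /null_content_dominatesP := stieltjes_dominated; apply.
    exact: measurableI.
  by apply: (subset_measure0 _ mA _ A0) => //; exact: measurableI.
have ig' : leb.-integrable setT (EFin \o (fine \o g)).
  by apply: eq_integrable ig => // x _; rewrite /= fineK.
have := @FTC1 R (fine \o g) (BRight (- N%:R)).
case.
- by move=> y; apply: integrableS ig' => //; exact: measurable_itv.
- exact: open_integrable_locally openT ig'.
move=> B [mB B0 BP]; exists B; split => // x /= nd; apply: BP => /= FP.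
apply: nd => /andP[xl xr].
have [|dF _] := FP.
  by rewrite lte_fin.
move: dF; set F := (X in derivable X).
have FE y : - N%:R <= y <= N%:R -> F y = f y - f (- N%:R).
  move=> /andP[y1 y2]; rewrite /F /Rintegral.
  have -> : (\int[leb]_(t in `](- N%:R)%R, y]) ((fine \o g) t)%:E)%E = nu `](- N%:R), y]%classic.
    rewrite gE; last exact: measurable_itv.
    by apply: eq_integral => t _; rewrite /= fineK.
  rewrite /nu /= /mfrestr /mrestr setIidl; last first.
    by move=> t /=; rewrite !in_itv/= => /andP[t1 t2]; rewrite /D /= in_itv/=; apply/andP; split; [exact: t1|exact: le_trans t2 y2].
  have := stieltjes_oc y1; rewrite /mu => E1; rewrite E1 //.
move=> dF; have dG : derivable (fun y => F y + f (- N%:R)) x 1 by apply: derivableD.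
apply: (near_eq_derivable _ dG).
have : \forall y \near x, y \in `]- N%:R, N%:R[%R by by apply: near_in_itvoo; rewrite in_itv/=; apply/andP.
apply: filterS => y; rewrite in_itv/= => /andP[yl yr]; rewrite FE ?subrK//.
by rewrite !ltW.
Qed.

End stieltjes.

(** [f x + k x] is nondecreasing and again Lipschitz, so the results on Stieltjes measures apply to
    it. *)
Lemma lipschitz_derivable_ae (f : R -> R) (k : R) :
  (forall x y, `|f x - f y| <= k * `|x - y|) ->
  {ae leb, forall x, derivable f x 1}.
Proof.
move=> fk.
pose g x := f x + k * x.
have cf : continuous f.
  move=> x; apply/cvgrPdist_le => e e0.
  have k0 : 0 <= k by have := fk 1 0; rewrite subr0 normr1 mulr1; apply: le_trans.
  near=> y; apply: le_trans (fk _ _) _.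
  apply: (@le_trans _ _ ((k + 1) * `|x - y|)); first by rewrite ler_wpM2r// lerDl.
  rewrite mulrC -ler_pdivlMr; last by lra.
  near: y; apply: cvgr_dist_le => //; rewrite divr_gt0//; lra.
have ndg : {homo g : x y / x <= y}.
  move=> x y xy; have := fk x y; rewrite ler_distl => /andP[].
  rewrite distrC ger0_norm ?subr_ge0// /g; lra.
have rg : right_continuous g.
  apply: right_continuousW => x; apply: cvgD; first exact: cf.
  by apply: cvgM; [exact: cvg_cst|exact: cvg_id].
have Kg x y : x <= y -> g y - g x <= (2 * k) * (y - x).
  move=> xy; have := fk y x; rewrite ler_distl => /andP[].
  rewrite ger0_norm ?subr_ge0// /g; lra.
have : {ae leb, forall x (N : nat), - N%:R < x < N%:R -> derivable g x 1}.
  by apply/ae_foralln => N; exact: (stieltjes_derivable_ae ndg rg Kg).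
apply: filterS; first exact: (ae_filter_ringOfSetsType leb).
move=> x /(_ (Num.truncn `|x|).+1).
have := truncnS_gt `|x|; rewrite ltr_norml => -> /(_ isT) dg.
rewrite (_ : f = (fun x => g x - k * x)); last by apply/funext => y; rewrite /g addrK.
by apply: derivableB => //; apply: derivableM => //.
Unshelve. all: by end_near.
Qed.

End lipschitz_derivable.

(** * Lipschitz functions of several variables *)

Section lipschitz_rV.
Context {R : realType} {n : nat}.
Local Notation mu := (lebesgue_rV n).
Implicit Types (u f : 'rV[R]_n -> R).

Lemma pd_not_derivable u x j : ~ derivable u x (delta_mx 0 j) -> pd j u x = 0.
Proof. by move=> nd; rewrite /pd /derive dvgP. Qed.

(** Differentiability is expressed by the Cauchy criterion for difference quotients. For continuous
    [u] each instance is a closed condition, so the intersection over uncountably many pairs of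
    increments stays measurable. *)
Lemma measurable_derivable u v : continuous u -> measurable [set x | derivable u x v].
Proof.
move=> cu.
pose q (h : R) x := h^-1 *: ((u \o shift x) (h *: v) - u x).
have cq h : continuous (q h).
  move=> x; apply: (@continuous_comp _ _ _ (fun y => u (h *: v + y) - u y) (fun t : R => h^-1 * t)); last exact: mulrl_continuous.
  apply: continuousB; last exact: cu.
  apply: (@continuous_comp _ _ _ (fun y => h *: v + y) u); last exact: cu.
  by apply: (@continuousD _ _ _ (fun=> h *: v) id x); [exact: cst_continuous|exact: cvg_id].
pose C (m N : nat) := \bigcap_(p in [set p : R * R | [/\ p.1 != 0, p.2 != 0, `|p.1| < N.+1%:R^-1 & `|p.2| < N.+1%:R^-1]])
   [set x | `|q p.1 x - q p.2 x| <= m.+1%:R^-1].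
have mC m N : measurable (C m N).
  rewrite -[C m N]setCK; apply: measurableC; apply: open_measurable_rV.
  apply: closed_openC; apply: closed_bigI => p _.
  apply: (@closed_comp _ _ (fun x => `|q p.1 x - q p.2 x|) [set t | t <= m.+1%:R^-1]); last exact: closed_le.
  move=> x _; apply: (@continuous_comp _ _ _ (fun y => q p.1 y - q p.2 y) Num.norm); last exact: norm_continuous.
  by apply: continuousB; exact: cq.
rewrite (_ : [set x | _] = \bigcap_m \bigcup_N C m N).
  by apply: bigcap_measurable => // m _; exact: bigcup_measurable.
apply/seteqP; split => x /=.
  rewrite /derivable => /cvg_ex[l /cvgrPdist_le ql] m _.
  have m0 : (0 : R) < m.+1%:R^-1 / 2 by rewrite divr_gt0.
  have [e /= e0 He] := ql _ m0.
  exists (Num.truncn e^-1) => // -[h h'] /= [h0 h0' hN hN'].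
  have Ne : (Num.truncn e^-1).+1%:R^-1 < e by rewrite invf_plt ?posrE// truncnS_gt.
  have H1 : `|l - q h x| <= m.+1%:R^-1 / 2.
    by apply: He => //=; rewrite sub0r normrN; exact: lt_trans hN Ne.
  have H2 : `|l - q h' x| <= m.+1%:R^-1 / 2.
    by apply: He => //=; rewrite sub0r normrN; exact: lt_trans hN' Ne.
  have := ler_distD l (q h x) (q h' x); rewrite (distrC (q h x) l).
  by move: H1 H2; move: m.+1%:R^-1 => a; lra.
move=> Hx; apply/cauchy_cvgP; apply: cauchy_exP => e e0.
have [N _ HN] := Hx (Num.truncn e^-1) Logic.I.
have Ne : (Num.truncn e^-1).+1%:R^-1 < e by rewrite invf_plt ?posrE// truncnS_gt.
pose h0 : R := N.+1%:R^-1 / 2.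
have N0 : (0 : R) < N.+1%:R^-1 by rewrite invr_gt0.
have h00 : 0 < h0 by rewrite /h0 divr_gt0.
have h0N : h0 < N.+1%:R^-1 by rewrite /h0; move: N0; move: N.+1%:R^-1 => a; lra.
exists (q h0 x); exists N.+1%:R^-1 => // h /=; rewrite sub0r normrN => hN hn0.
apply: le_lt_trans Ne; apply: (HN (h0, h)) => /=; split => //.
  by rewrite gt_eqF.
by rewrite gtr0_norm.
Qed.

Section lipschitz.
Variables (u : 'rV[R]_n -> R) (k r : R).
Hypothesis uk : forall x y, `|u x - u y| <= k * `|x - y|.
Hypothesis ur : forall x, r < `|x| -> u x = 0.

Lemma lipschitz_continuous_rV : continuous u.
Proof.
move=> x; apply/(@cvgrPdist_le _ _ _ (nbhs x) (nbhs_filter x)) => e e0.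
have k0 : 0 < `|k| + 1 by rewrite ltr_wpDl.
have := @nbhs_ball_norm R 'rV[R]_n x (PosNum (divr_gt0 e0 k0)).
apply: filterS => y /= /ltW xy; apply: le_trans (uk _ _) _.
apply: (@le_trans _ _ ((`|k| + 1) * `|x - y|)).
  by rewrite ler_wpM2r//; have := ler_norm k; lra.
by rewrite mulrC -ler_pdivlMr.
Qed.

Lemma lipschitz_bcs : bcs u.
Proof. by apply: continuous_bcs lipschitz_continuous_rV _; exists r. Qed.

(** By the one-dimensional result every line in the direction [v] meets the exceptional set in a
    null set; [null_lines] concludes. *)
Lemma lipschitz_derivable_rV_ae j : {ae mu, forall x, derivable u x (delta_mx 0 j)}.
Proof.
set v : 'rV[R]_n := delta_mx 0 j.
have mD := measurable_derivable v lipschitz_continuous_rV.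
exists (~` [set x | derivable u x v]); split => //; first exact: measurableC.
apply: (@null_lines _ _ _ v); first exact: measurableC.
move=> x; apply/negligibleP.
  rewrite -[X in measurable X]setTI.
  apply: (measurable_fun_rVP (f := fun t : measurableTypeR R => x + t *: v)) => //.
    move=> i; under eq_fun do rewrite !mxE.
    by apply: measurable_funD => //; apply: measurable_funM.
  exact: measurableC.
have [|A [mA A0 AP]] := @lipschitz_derivable_ae R (fun t : R => u (x + t *: v)) `|k|.
  move=> s t; apply: le_trans (uk _ _) _.
  rewrite opprD addrACA subrr add0r -scalerBl normrZ mulrA.
  have := @delta_norm R n j; rewrite -/v => dn.
  apply: le_trans (_ : `|k| * `|s - t| * `|v| <= _); first by rewrite !ler_wpM2r// ler_norm.
  by rewrite -[leRHS]mulr1 ler_wpM2l// mulr_ge0.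
exists A; split; [exact: mA|exact: A0|apply: subset_trans AP => t /= nd d; apply: nd].
have /derivableP : derivable (fun t : R => u (x + t *: v)) t 1 by [].
by move=> /is_derive_line[].
Qed.

Lemma lipschitz_pd_bcs j : bcs (pd j u).
Proof.
set v : 'rV[R]_n := delta_mx 0 j.
have mD := measurable_derivable v lipschitz_continuous_rV.
pose D := [set x | derivable u x v].
(* The indicator makes the quotients converge everywhere: where the derivative does not exist they
   are 0, the default value of [pd]. *)
pose q (m : nat) x := \1_D x * (m.+1%:R * (u (x + m.+1%:R^-1 *: v) - u x)).
have qP x : q m x @[m --> \oo] --> pd j u x.
  rewrite /q indicE; have [xD|xD] := boolP (x \in D).
    under eq_fun do rewrite mul1r.
    apply: is_derive_quotient; have /set_mem/derivableP := xD; exact.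
  have -> : pd j u x = 0.
    by apply: pd_not_derivable => xd; move/negP: xD; apply; exact/mem_set.
  by under eq_fun do rewrite mul0r; exact: cvg_cst.
have qk m x : `|q m x| <= `|k|.
  rewrite /q normrM normrM; apply: le_trans (_ : 1 * (m.+1%:R * (k * (m.+1%:R^-1 * `|v|))) <= _).
    apply: ler_pM => //; first by rewrite indicE; case: (_ \in _); rewrite ?normr1 ?normr0.
    rewrite normr_nat ler_wpM2l//; apply: le_trans (uk _ _) _.
    by rewrite addrAC subrr add0r normrZ gtr0_norm ?invr_gt0.
  rewrite mul1r mulrCA mulVKf ?pnatr_eq0//.
  apply: le_trans (_ : `|k| * `|v| <= _); first by rewrite ler_wpM2r// ler_norm.
  by rewrite -[leRHS]mulr1 ler_wpM2l// delta_norm.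
split.
- apply: (measurable_fun_cvg (h := q)) => // m.
  apply: measurable_funM; first exact: measurable_indic.
  apply: measurable_funM => //; apply: measurable_funB.
    have mu_ := continuous_measurable_rV lipschitz_continuous_rV.
    exact: (measurableT_comp mu_ (measurable_rV_shift _)).
  exact: continuous_measurable_rV lipschitz_continuous_rV.
- exists `|k| => x; have /cvg_norm := qP x.
  by move=> c; apply: (cvgr_to_le c); apply: nearW => m.
- by exists r; apply: pd_support.
Qed.

(** [RI_difference_quotient] applied to u^2 F, which is Lipschitz along the axis and differentiable
    almost everywhere. *)
Lemma lipschitz_ibp (F : 'rV[R]_n -> R) (B : R) j : C1 F -> (forall x, `|F x| <= B) ->
  (forall x, `|pd j F x| <= B) ->
  RI (fun x => 2 * (F x * (u x * pd j u x))) = - RI (fun x => pd j F x * (u x * u x)).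
Proof.
move=> CF FB dFB; set v : 'rV[R]_n := delta_mx 0 j.
have bu := lipschitz_bcs; have bp := lipschitz_pd_bcs j.
have [_ [M uM] _] := bu.
have M0 : 0 <= M by apply: le_trans (uM 0).
have B0 : 0 <= B by apply: le_trans (FB 0).
have b1 : bcs (fun x => u x * u x) by exact: bcsMb.
have b2 : bcs (fun x => u x * pd j u x) by exact: bcsMb.
have b3 : bcs (fun x => u x * u x * F x) by exact: C1_bcsM.
have b4 : bcs (fun x => pd j F x * (u x * u x)).
  under eq_fun do rewrite mulrC.
  by apply: bcsM => //; [exact: pd_measurable|exact: pd_locally_bounded].
have b5 : bcs (fun x => 2 * (F x * (u x * pd j u x))).
  by apply: bcsZ; under eq_fun do rewrite mulrC; exact: C1_bcsM.
apply/eqP; rewrite -subr_eq0 opprK -RI_D//; apply/eqP.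
apply: (@RI_difference_quotient _ _ (fun x => u x * u x * F x) _ v (M * M * B + B * (2 * M * `|k|))) => //.
- move=> x h; set y := x + h *: v.
  have yx : `|u y - u x| <= `|k| * `|h|.
    apply: le_trans (uk _ _) _; rewrite /y addrAC subrr add0r normrZ mulrA.
    apply: le_trans (_ : `|k| * `|h| * `|v| <= _); first by rewrite !ler_wpM2r// ler_norm.
    by rewrite -[leRHS]mulr1 ler_wpM2l ?mulr_ge0// delta_norm.
  have Fyx : `|F y - F x| <= B * `|h|.
    have [c _ ->] := line_mvt x h (CF.2 j).1.
    by rewrite normrM mulrC ler_wpM2r.
  have -> : u y * u y * F y - u x * u x * F x =
     u y * u y * (F y - F x) + F x * ((u y + u x) * (u y - u x)) by ring.
  apply: le_trans (ler_normD _ _) _; rewrite [leRHS]mulrDl; apply: lerD.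
    rewrite !normrM -[leRHS]mulrA; apply: ler_pM; rewrite ?mulr_ge0//.
    by apply: ler_pM.
  rewrite !normrM -[leRHS]mulrA; apply: ler_pM; rewrite ?mulr_ge0//.
  rewrite -[leRHS]mulrA; apply: ler_pM => //.
  by apply: le_trans (ler_normD _ _) _; have := uM x; have := uM y; lra.
- exact: bcsD.
- have := lipschitz_derivable_rV_ae j; apply: filterS => x /derivableP du.
  have dF := (CF.2 j).1 x.
  have d2 : is_derive x v (fun x => u x * u x * F x) (2 * (F x * (u x * pd j u x)) + pd j F x * (u x * u x)).
    have d0 := @is_deriveM _ _ u u x v _ _ du du.
    have d1 := @is_deriveM _ _ _ F x v _ _ d0 dF.
    apply: (is_derive_eq d1).
    change (u x * u x * pd j F x + F x * (u x * pd j u x + u x * pd j u x) =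
      2 * (F x * (u x * pd j u x)) + pd j F x * (u x * u x)).
    by move: (u x) (F x) (pd j u x) (pd j F x) => a b c e; ring.
  exact: is_derive_quotient d2.
Qed.

End lipschitz.

(* Completing the square: (pd j u + F j u)^2 >= 0, and the cross term integrates to the divergence. *)
Lemma dirichlet_lower_bound u (k r B : R) (F : 'I_n -> 'rV[R]_n -> R) :
  (forall x y, `|u x - u y| <= k * `|x - y|) -> (forall x, r < `|x| -> u x = 0) ->
  (forall j, C1 (F j)) -> (forall j x, `|F j x| <= B) -> (forall j x, `|pd j (F j) x| <= B) ->
  RI (fun x => (\sum_(j < n) (pd j (F j) x - F j x ^+ 2)) * (u x * u x)) <=
  RI (fun x => \sum_(j < n) pd j u x ^+ 2).
Proof.
move=> uk ur CF FB dFB.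
have bu := lipschitz_bcs uk ur; have bp j := lipschitz_pd_bcs uk ur j.
have b1 : bcs (fun x => u x * u x) by exact: bcsMb.
have b2 j : bcs (fun x => pd j u x ^+ 2) by apply: bcsMb.
have b3 j : bcs (fun x => pd j (F j) x * (u x * u x)).
  under eq_fun do rewrite mulrC.
  by apply: bcsM => //; [exact: pd_measurable|exact: pd_locally_bounded].
have b4 j : bcs (fun x => F j x ^+ 2 * (u x * u x)).
  by under eq_fun do rewrite mulrC expr2 mulrA; do 2!apply: C1_bcsM => //.
have b5 j : bcs (fun x => 2 * (F j x * (u x * pd j u x))).
  by apply: bcsZ; under eq_fun do rewrite mulrC; apply: C1_bcsM => //; exact: bcsMb.
under [in leLHS]RI_ext do rewrite mulr_suml.
under [in leLHS]RI_ext do under eq_bigr do rewrite mulrBl.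
rewrite !RI_sum//; last by move=> j; exact: bcsB.
apply: ler_sum => j _; rewrite RI_B// lerBlDr -[X in X <= _]opprK.
rewrite -(@lipschitz_ibp _ k r uk ur _ B)// -subr_ge0 opprK.
rewrite -!RI_D//; last exact: bcsD.
apply: RI_ge0 => x.
by rewrite (_ : _ + _ = (pd j u x + F j x * u x) ^+ 2) ?sqr_ge0//; ring.
Qed.

End lipschitz_rV.

(** * Capacity *)

Section capacity.
Context {R : realType} {n : nat}.
Local Notation mu := (lebesgue_rV n).

Lemma support_of_bounded (T : nmodType) (u : 'rV[R]_n -> T) : compact (support_of u) ->
  exists r : R, forall x, r < `|x| -> u x = 0.
Proof.
move=> /compact_bounded [M [_ HM]]; exists (M + 1) => x Mx.
apply: contrapT => /eqP ux; have : support_of u x by apply: subset_closure.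
by move=> /(HM (M + 1)); rewrite ltrDl ltr01 => /(_ isT) H; have := le_lt_trans H Mx; rewrite ltxx.
Qed.

Lemma support_of_sub (T : nmodType) (u : 'rV[R]_n -> T) (C : set 'rV[R]_n) : closed C ->
  (forall x, ~ C x -> u x = 0) -> support_of u `<=` C.
Proof.
move=> cC uC; rewrite (closure_id C).1//; apply: closure_subset => x /= ux.
by apply: contrapT => /uC u0; rewrite u0 eqxx in ux.
Qed.

Lemma cube_closed (c : 'rV[R]_n) d : closed (cube c d).
Proof.
rewrite (_ : cube c d = \bigcap_(i in setT) [set x | `|x 0 i - c 0 i| <= d / 2]); last first.
  by apply/seteqP; split => x /= xc i; [move=> _; exact: xc|exact: (xc i Logic.I)].
apply: closed_bigI => i _.
apply: (@closed_comp _ _ (fun x : 'rV[R]_n => `|x 0 i - c 0 i|) [set t | t <= d / 2]); last exact: closed_le.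
move=> x _; apply: (@continuous_comp _ _ _ (fun y : 'rV[R]_n => y 0 i - c 0 i) Num.norm); last exact: norm_continuous.
by apply: continuousB; [exact: coord_continuous|exact: cst_continuous].
Qed.

Lemma cube_compact (c : 'rV[R]_n) d : 0 <= d -> compact (cube c d).
Proof.
move=> d0; apply: bounded_closed_compact; last exact: cube_closed.
rewrite cubeE//; exists (`|c| + d / 2); split; first by rewrite num_real.
move=> M cM x /= xc.
have := ler_distD 0 x c; have := ler_normD (x - c) c; rewrite subrK.
by move: xc cM; lra.
Qed.

Lemma support_of_compact (T : nmodType) (u : 'rV[R]_n -> T) (c : 'rV[R]_n) d : 0 <= d ->
  (forall x, ~ cube c d x -> u x = 0) -> compact (support_of u).
Proof.
move=> d0 uc; apply: (@subclosed_compact _ _ (cube c d)).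
- exact: closed_closure.
- exact: cube_compact.
- by apply: support_of_sub => //; exact: cube_closed.
Qed.

Lemma C1V (g : 'rV[R]_n -> R) : C1 g -> (forall x, g x != 0) ->
  C1 (fun x => (g x)^-1) /\ forall j, pd j (fun x => (g x)^-1) = (fun x => - (g x ^- 2 * pd j g x)).
Proof.
move=> Cg g0; have [cg Dg] := Cg.
have cV : continuous (fun x => (g x)^-1).
  by move=> x; apply: (@continuous_comp _ _ _ g GRing.inv); [exact: cg|exact: inv_continuous].
apply: C1_intro => //.
- move=> j x; apply/is_derive_line0.
  have /is_derive_line0 d0 := (Dg j).1 x.
  have := @is_deriveV R (fun s => g (x + s *: delta_mx 0 j)) 0 _ 1 (g0 _) d0.
  by rewrite /= scale0r addr0 scaleNr.
- move=> j x.
  have c1 : {for x, continuous (fun y => (g y)^-1 * (g y)^-1)} by apply: continuousM; exact: cV.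
  have c2 : {for x, continuous (fun y => (g y)^-1 * (g y)^-1 * pd j g y)}.
    by apply: continuousM; [exact: c1|exact: (Dg j).2].
  rewrite (_ : (fun x => _) = (fun y => - ((g y)^-1 * (g y)^-1 * pd j g y))); last first.
    by apply/funext => y; rewrite -invfM.
  exact: (cvgN c2).
Qed.

(** [dirichlet_lower_bound] for a field F whose density div F - |F|^2 is nonnegative wherever a
    competitor may live and at least [kappa] on the cube, where competitors equal 1. *)
Lemma capacity_ge (Omega : set 'rV[R]_n) (c : 'rV[R]_n) (d B kappa : R) (F : 'I_n -> 'rV[R]_n -> R) :
  0 <= d -> (forall j, C1 (F j)) -> (forall j x, `|F j x| <= B) ->
  (forall j x, `|pd j (F j) x| <= B) ->
  (forall x, Omega x -> 0 <= \sum_(j < n) (pd j (F j) x - F j x ^+ 2)) ->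
  (forall x, cube c d x -> kappa <= \sum_(j < n) (pd j (F j) x - F j x ^+ 2)) ->
  ((kappa * d ^+ n)%:E <= capacity Omega (cube c d))%E.
Proof.
move=> d0 CF FB dFB W0 Wk; apply: le_ereal_inf_tmp => _ [u [[k uk] cu suO u1] <-].
have ul x y : `|u x - u y| <= k * `|x - y| by exact: (uk (x, y)).
have [r ur] := support_of_bounded cu.
have bp j : bcs (fun x => pd j u x ^+ 2) by apply: bcsMb; exact: lipschitz_pd_bcs ul ur j.
rewrite -RI_EFin; last exact: bcs_sum.
rewrite lee_fin; apply: le_trans (dirichlet_lower_bound ul ur CF FB dFB).
have bW : bcs (fun x => (\sum_(j < n) (pd j (F j) x - F j x ^+ 2)) * (u x * u x)).
  have bu := lipschitz_bcs ul ur; have buu : bcs (fun x => u x * u x) by exact: bcsMb.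
  under eq_fun do rewrite mulr_suml; apply: bcs_sum => j.
  under eq_fun do rewrite mulrBl; apply: bcsB.
    under eq_fun do rewrite mulrC.
    by apply: bcsM => //; [exact: pd_measurable|exact: pd_locally_bounded].
  by under eq_fun do rewrite mulrC expr2 mulrA; do 2!apply: C1_bcsM => //.
rewrite -(RI_indic_cube c d0) -RI_Z; last exact: bcs_indic.
apply: RI_le => //; first by apply: bcsZ; exact: bcs_indic.
move=> x; rewrite indicE; have [xc|xc] := boolP (x \in cube c d).
  by rewrite u1 ?mulr1; [apply: Wk|]; exact/set_mem.
rewrite mulr0; have [->|ux] := eqVneq (u x) 0; first by rewrite !mulr0.
by apply: mulr_ge0; [apply: W0; apply: suO; exact: subset_closure|rewrite -expr2 sqr_ge0].
Qed.

End capacity.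

(** * Lower bound for the capacity of a cube *)

Section capacity_cube.
Context {R : realType}.

(* The vector field s (x - c) / (A + |x - c|^2) of Hardy's inequality: its divergence
   minus its squared length is nonnegative for s = n - 2, and also for s = 1, n = 2
   as long as |x - c|^2 <= 2 A. *)
Lemma hardy_weight m (c : 'rV[R]_m.+1) (s A : R) : 0 < s -> 0 < A ->
  let q x := A + \sum_(i < m.+1) (x 0 i - c 0 i) ^+ 2 in
  let F j x := s * ((x 0 j - c 0 j) * (q x)^-1) in
  exists B, [/\ forall j, C1 (F j), forall j x, `|F j x| <= B, forall j x, `|pd j (F j) x| <= B
   & forall j x, pd j (F j) x = s * (q x - 2 * (x 0 j - c 0 j) ^+ 2) / q x ^+ 2].
Proof.
move=> s0 A0 q F.
have Cy (j : 'I_m.+1) : C1 (fun x : 'rV[R]_m.+1 => x 0 j - c 0 j) /\ forall i, pd i (fun x => x 0 j - c 0 j) = (fun=> (j == i)%:R).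
  have [C p] := @C1_coord R m.+1 j; have [C' p'] := @C1_cst R m.+1 (- c 0 j).
  have [C2 p2] := C1D C C'; split => // i; rewrite p2 p p'.
  by apply/funext => x; rewrite addr0.
have Cy2 (j : 'I_m.+1) : C1 (fun x : 'rV[R]_m.+1 => (x 0 j - c 0 j) ^+ 2) /\ forall i, pd i (fun x => (x 0 j - c 0 j) ^+ 2) = (fun x => 2 * (x 0 j - c 0 j) * (j == i)%:R).
  have [C p] := Cy j; have [C2 p2] := C1M C C; split => // i; rewrite p2 p.
  by apply/funext => x; ring.
have [Cq pq] : C1 q /\ forall i, pd i q = (fun x => 2 * (x 0 i - c 0 i)).
  have [C p] := C1_sum (index_enum 'I_m.+1) (fun i => (Cy2 i).1).
  have [C' p'] := @C1_cst R m.+1 A; have [C2 p2] := C1D C' C; split => // i.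
  rewrite p2 p p'; apply/funext => x; rewrite add0r.
  rewrite (bigD1 i)//= big1 ?addr0; last by move=> j ji; rewrite (Cy2 j).2 (negbTE ji) mulr0.
  by rewrite (Cy2 i).2 eqxx mulr1.
have yq j x : A + (x 0 j - c 0 j) ^+ 2 <= q x.
  by rewrite /q (bigD1 j)//= addrA lerDl sumr_ge0// => i _; exact: sqr_ge0.
have q0 x : A <= q x by apply: le_trans (yq 0 x); rewrite lerDl sqr_ge0.
have qn0 x : q x != 0 by rewrite gt_eqF// (lt_le_trans A0).
have [CV pV] := C1V Cq qn0.
have CF j : C1 (F j) /\ forall x, pd j (F j) x = s * (q x - 2 * (x 0 j - c 0 j) ^+ 2) / q x ^+ 2.
  have [C p] := C1M (Cy j).1 CV; have [C2 p2] := C1Z s C; split => // x.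
  rewrite p2 p (Cy j).2 pV pq eqxx (_ : true%:R = 1 :> R)//; have := qn0 x; move: (q x) (x 0 j - c 0 j) => a y a0; field.
  by rewrite a0.
exists (s / A * (1 + A)); split.
- by move=> j; case: (CF j).
- move=> j x; have := yq j x; have := q0 x; rewrite /F; move: (q x) (x 0 j - c 0 j) => a y Aa ya.
  have a0 : 0 < a by exact: lt_le_trans A0 Aa.
  rewrite !normrM [in `|s|]gtr0_norm// -mulrA; apply: ler_wpM2l; first exact: ltW.
  rewrite [`|a^-1|]gtr0_norm ?invr_gt0// ler_pdivrMr//.
  rewrite (_ : A^-1 * (1 + A) * a = (1 + A) * (A^-1 * a)); last by ring.
  apply: le_trans (_ : (1 + A) * (A^-1 * (A + y ^+ 2)) <= _); last first.
    apply: ler_wpM2l; first by rewrite addr_ge0// ltW.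
    by apply: ler_wpM2l; first by rewrite invr_ge0 ltW.
  rewrite mulrDr mulVf ?gt_eqF//; have AV : 0 < A^-1 by rewrite invr_gt0.
  have E : A * A^-1 = 1 by rewrite divff// gt_eqF.
  have := sqr_ge0 (`|y| - 1); rewrite -(real_normK (num_real y)).
  have : 0 <= `|y| by []; move: `|y| AV E A0 => t; move: A^-1 => b; nra.
- move=> j x; rewrite (CF j).2.
  have := yq j x; have := q0 x; move: (q x) (x 0 j - c 0 j) => a y Aa ya.
  have a0 : 0 < a by exact: lt_le_trans A0 Aa.
  rewrite normrM normrM [in `|s|]gtr0_norm// -!mulrA; apply: ler_wpM2l; first exact: ltW.
  rewrite [X in _ * X]gtr0_norm ?invr_gt0 ?exprn_gt0// ler_pdivrMr ?exprn_gt0//.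
  apply: le_trans (_ : a <= _).
    rewrite ler_norml; have := sqr_ge0 y; move: A0 ya; lra.
  have AV : 0 < A^-1 by rewrite invr_gt0.
  have E : A * A^-1 = 1 by rewrite divff// gt_eqF.
  apply: le_trans (_ : A^-1 * a ^+ 2 <= _); last first.
    by rewrite ler_wpM2r ?sqr_ge0//; nra.
  rewrite expr2 mulrA -[leLHS]mul1r; apply: ler_wpM2r; first exact: ltW.
  by rewrite -E mulrC; apply: ler_wpM2l => //; exact: ltW.
- by move=> j x; rewrite (CF j).2.
Qed.

(** With n = m + 2, the squared distance [q - A] has coefficient [m%:R - s]: it vanishes for s = n -
    2 and is -1 for n = 2, s = 1. *)
Lemma hardy_weight_sum m (y : 'I_m.+2 -> R) (s A : R) : 0 < A ->
  let q := A + \sum_(i < m.+2) y i ^+ 2 in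
  \sum_(j < m.+2) (s * (q - 2 * y j ^+ 2) / q ^+ 2 - (s * (y j / q)) ^+ 2) =
  s * (m.+2%:R * A + (m%:R - s) * (q - A)) / q ^+ 2.
Proof.
move=> A0 q.
have q0 : q != 0 by rewrite gt_eqF// ltr_wpDr// sumr_ge0// => i _; exact: sqr_ge0.
transitivity (\sum_(j < m.+2) (s * q / q ^+ 2 - (2 * s + s ^+ 2) / q ^+ 2 * y j ^+ 2)).
  by apply: eq_bigr => j _; field.
rewrite sumrB sumr_const card_ord -mulr_sumr (_ : \sum_(i < m.+2) _ = q - A); last by rewrite /q addrAC subrr add0r.
rewrite -[_ *+ _]mulr_natr (_ : m.+2%:R = m%:R + 2 :> R); last by rewrite -addn2 natrD.
by field.
Qed.

Lemma sum_sqr_le m (y : 'I_m -> R) (b : R) : (forall i, `|y i| <= b) ->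
  0 <= \sum_(i < m) y i ^+ 2 <= m%:R * b ^+ 2.
Proof.
move=> yb; rewrite sumr_ge0; last by move=> i _; exact: sqr_ge0.
rewrite mulr_natl -[in leRHS](card_ord m) -sumr_const.
by apply: ler_sum => i _; have := yb i; rewrite ler_norml; nra.
Qed.

(** The bound is uniform in the center, since the cube is going to move to infinity. *)
Lemma cap_cube_gt0 m (d : R) : 0 < d ->
  exists2 kappa, 0 < kappa & forall c : 'rV[R]_m.+2, (kappa%:E <= cap_in_cube c d (cube c d))%E.
Proof.
move=> d0; rewrite /cap_in_cube; case: eqP => [[m0]|nm].
  (* On Q_{2d} the squared distance is at most A = 2 d^2, so the numerator 2 A - |x - c|^2 is at
     least A, and q is at most 4 d^2. *)
  subst m; exists ((2 * d ^+ 2) / (4 * d ^+ 2) ^+ 2 * d ^+ 2) => [|c].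
    by rewrite mulr_gt0 ?divr_gt0 ?mulr_gt0 ?exprn_gt0 ?mulr_gt0 ?exprn_gt0.
  have A0 : 0 < 2 * d ^+ 2 by rewrite mulr_gt0 ?exprn_gt0.
  have [B [CF FB dFB pF]] := hardy_weight c ltr01 A0.
  apply: (capacity_ge (ltW d0) CF FB dFB).
  - move=> x /interior_subset xc; under eq_bigr do rewrite pF.
    rewrite (hardy_weight_sum (fun i => x 0 i - c 0 i) 1 A0).
    have H i : `|x 0 i - c 0 i| <= d by have := xc i; lra.
    have /andP[] := sum_sqr_le H.
    move=> S0 S1; rewrite divr_ge0 ?sqr_ge0//; move: S0 S1; rewrite addrAC subrr add0r.
    by move: (\sum_(i < _) _) => S; lra.
  - move=> x xc; under [leRHS]eq_bigr do rewrite pF.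
    rewrite (hardy_weight_sum (fun i => x 0 i - c 0 i) 1 A0).
    have H i : `|x 0 i - c 0 i| <= d by have := xc i; lra.
    have /andP[] := sum_sqr_le H.
    move=> S0 S1; move: S0 S1; rewrite [X in (_ - _) * X]addrAC subrr add0r.
    move: (\sum_(i < _) _) => S S0 S1.
    apply: ler_pM; rewrite ?invr_ge0 ?exprn_ge0//; [lra|lra|lra|].
    rewrite lef_pV2 ?posrE ?exprn_gt0//; [|lra..].
    by rewrite ler_pXn2r ?nnegrE//; lra.
(* [s = n - 2] cancels the last term of [hardy_weight_sum]. It is positive because n = 2 has been
   dealt with. *)
pose s : R := m%:R.
have s0 : 0 < s by rewrite ltr0n lt0n; apply/eqP => m0; apply: nm; rewrite m0.
have q0 : 0 < 1 + m.+2%:R * d ^+ 2 by apply: ltr_wpDr => //; rewrite mulr_ge0// sqr_ge0.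
exists ((s * m.+2%:R) / (1 + m.+2%:R * d ^+ 2) ^+ 2 * d ^+ m.+2) => [|c].
  apply: mulr_gt0; last exact: exprn_gt0.
  apply: divr_gt0; [by apply: mulr_gt0 => //; exact: ltr0Sn|exact: exprn_gt0].
have [B [CF FB dFB pF]] := hardy_weight c s0 ltr01.
apply: (capacity_ge (ltW d0) CF FB dFB).
- move=> x _; under eq_bigr do rewrite pF.
  rewrite (hardy_weight_sum (fun i => x 0 i - c 0 i) s ltr01).
  by rewrite subrr mul0r addr0 mulr1; apply: divr_ge0; [apply: mulr_ge0; [exact: (ltW s0)|exact: ler0n]|exact: sqr_ge0].
- move=> x xc; under [leRHS]eq_bigr do rewrite pF.
  rewrite (hardy_weight_sum (fun i => x 0 i - c 0 i) s ltr01).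
  have H i : `|x 0 i - c 0 i| <= d by have := xc i; lra.
  have /andP[] := sum_sqr_le H.
  move=> S0 S1; rewrite subrr mul0r addr0 mulr1; apply: ler_wpM2l; first by apply: mulr_ge0; [exact: (ltW s0)|exact: ler0n].
  have q1 : 0 < 1 + \sum_(i < m.+2) (x 0 i - c 0 i) ^+ 2 by exact: ltr_wpDr.
  rewrite lef_pV2 ?posrE ?exprn_gt0//.
  by rewrite ler_pXn2r ?nnegrE ?(ltW q0) ?(ltW q1)// lerD2l.
Qed.

End capacity_cube.

(** * Upper bound for the capacity of a small cube *)

Section clamp.
Context {R : realType}.

Definition clamp (t : R) := Num.max 0 (Num.min 1 t).

Lemma clamp_lipschitz s t : `|clamp s - clamp t| <= `|s - t|.
Proof.
have H1 := ler_norm (s - t).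
have H2 : t - s <= `|s - t| by rewrite distrC ler_norm.
have H0 := normr_ge0 (s - t); move: `|s - t| H0 H1 H2 => d H0 H1 H2.
rewrite /clamp ler_norml; case: (leP 1 s) => s1; case: (leP 1 t) => t1;
  rewrite ?(max_r ler01); case: (leP 0 s) => s0; case: (leP 0 t) => t0; apply/andP; split; lra.
Qed.

Lemma clamp1 t : 1 <= t -> clamp t = 1.
Proof. by move=> t1; rewrite /clamp min_l// max_r. Qed.

Lemma clamp0 t : t <= 0 -> clamp t = 0.
Proof. by move=> t0; rewrite /clamp min_r ?max_l//; lra. Qed.

(** At ratio 4 the earlier terms add up to at most a third of the next one, so the squares control
    the cross terms. Such terms occur because the regions on which the cut-offs of [capacity_le]
    vary are enclosed in nested cubes. *)
Lemma geometric_square (b : nat -> R) (e : nat -> R) N : 0 <= b 0%N -> (forall i, b i.+1 = 4 * b i) ->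
  (forall i, e i = 0 \/ e i = 1) ->
  (\sum_(i < N) b i * e i) ^+ 2 <= 3 * \sum_(i < N) b i ^+ 2 * e i.
Proof.
move=> b0 bS e01.
have bge i : 0 <= b i by elim: i => // i IH; rewrite bS mulr_ge0.
have be i : 0 <= b i * e i <= b i.
  by case: (e01 i) => ->; rewrite ?mulr0 ?mulr1 ?lexx bge.
suff [] : (\sum_(i < N) b i * e i) ^+ 2 <= 3 * \sum_(i < N) b i ^+ 2 * e i /\
   0 <= 3 * (\sum_(i < N) b i * e i) <= b N by [].
elim: N => [|N [IH1 IH2]].
  by rewrite !big_ord0 expr2 !mulr0 lexx b0.
rewrite !big_ord_recr /= bS; move: IH1 IH2 (bge N).
move: (\sum_(i < N) _) (\sum_(i < N) _) (b N) => S T B H1 /andP[H2 H3] B0.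
by case: (e01 N) => ->; rewrite ?mulr0 ?mulr1 ?addr0; split; nra.
Qed.

End clamp.

Section capacity_le.
Context {R : realType} {n : nat}.

(** True also where the derivative does not exist, as [pd] is then 0. *)
Lemma pd_le_lipschitz (u : 'rV[R]_n -> R) j x (K : R) : 0 <= K ->
  (\forall y \near x, `|u y - u x| <= K * `|y - x|) -> `|pd j u x| <= K.
Proof.
move=> K0 uK; have [D|nD] := pselect (derivable u x (delta_mx 0 j)); last first.
  by rewrite pd_not_derivable// normr0.
have /derivableP := D; move=> /is_derive_quotient c.
have /cvg_norm c' := c; apply: (cvgr_to_le c').
have : (fun k : nat => x + k.+1%:R^-1 *: delta_mx 0 j) @ \oo --> x.
  rewrite -[X in _ --> X]addr0; apply: cvgD; first exact: cvg_cst.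
  rewrite -[X in _ --> X](scale0r (delta_mx 0 j : 'rV[R]_n)).
  by apply: cvgZr_tmp; exact: cvg_harmonic.
move=> cx; have [N0 _ HN] : \forall k \near \oo, `|u (x + k.+1%:R^-1 *: delta_mx 0 j) - u x| <=
  K * `|x + k.+1%:R^-1 *: delta_mx 0 j - x| by exact: cx uK.
exists N0 => // k /HN Hk.
rewrite normrM normr_nat -ler_pdivlMl// mulrC.
apply: le_trans Hk _; rewrite addrAC subrr add0r normrZ gtr0_norm ?invr_gt0//.
apply: ler_wpM2l => //; rewrite -[leRHS]mulr1; apply: ler_wpM2l; first by rewrite invr_ge0.
exact: delta_norm.
Qed.

(* The test function is the average of N+1 cut-offs at the scales r 4^-i: for n = 2
   each of them has energy O(1), so the average has energy O(1/N). *)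
Lemma capacity_le (Omega : set 'rV[R]_n) (p : 'rV[R]_n) (r : R) N : 0 < r ->
  cube p (4 * r) `<=` Omega ->
  (capacity Omega (cube p (2 * (r / 4 ^+ N))) <=
   (n%:R * (3 * (N.+1%:R ^- 2 * \sum_(i < N.+1) (4 ^+ i / r) ^+ 2 * (4 * (r / 4 ^+ i)) ^+ n)))%:E)%E.
Proof.
move=> r0 pO.
pose b (i : nat) : R := 4 ^+ i / r.
have b0 i : 0 < b i by rewrite divr_gt0// exprn_gt0.
have bS i : b i.+1 = 4 * b i by rewrite /b exprS mulrA.
(* Equal to 1 up to distance r 4^-i from [p] and to 0 beyond twice that distance. *)
pose phi (i : nat) (x : 'rV[R]_n) := clamp (2 - b i * `|x - p|).
pose B i := cube p (4 * (r / 4 ^+ i)).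
have r_gt i : 0 < r / 4 ^+ i by rewrite divr_gt0// exprn_gt0.
have bE i : b i * (r / 4 ^+ i) = 1.
  by rewrite /b; field; rewrite !gt_eqF// exprn_gt0.
have phiB i x y : `|phi i x - phi i y| <= b i * `|x - y|.
  apply: le_trans (clamp_lipschitz _ _) _.
  rewrite (_ : _ - _ = b i * (`|y - p| - `|x - p|)); last by ring.
  rewrite normrM gtr0_norm//; apply: ler_wpM2l; first exact: ltW.
  by apply: le_trans (ler_dist_dist _ _) _; rewrite opprB addrA subrK distrC.
pose u x := N.+1%:R^-1 * \sum_(i < N.+1) phi i x.
have NV : (0 : R) < N.+1%:R^-1 by rewrite invr_gt0.
have BE i x : B i x <-> `|x - p| <= 2 * (r / 4 ^+ i).
  rewrite /B cubeE/=; last by rewrite mulr_ge0// ltW.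
  by rewrite (_ : 4 * _ / 2 = 2 * (r / 4 ^+ i)); last by field.
have phi0 i x : ~ B i x -> phi i x = 0.
  move=> /BE/negP; rewrite -ltNge => H; apply: clamp0.
  by have := bE i; have := b0 i; have := H; move: (b i) (r / _) `|x - p| => a c t; nra.
have BO i x : B i x -> cube p (4 * r) x.
  move=> H k; apply: le_trans (H k) _; rewrite ler_wpM2r// ler_wpM2l// ler_pdivrMr ?exprn_gt0//.
  by rewrite ler_peMr ?(ltW r0)// exprn_ege1//; lra.
have u0 x : ~ cube p (4 * r) x -> u x = 0.
  move=> xO; rewrite /u big1 ?mulr0// => i _; apply: phi0 => /BO; exact: xO.
have u1 x : cube p (2 * (r / 4 ^+ N)) x -> u x = 1.
  rewrite cubeE/=; last by rewrite mulr_ge0// ltW.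
  move=> xp.
  have xp' : `|x - p| <= r / 4 ^+ N by move: xp; lra.
  rewrite /u (eq_bigr (fun=> 1)) => [|[i iN] _ /=].
    by rewrite sumr_const card_ord mulVf// pnatr_eq0.
  apply: clamp1; have : b i * `|x - p| <= 1; last by lra.
  rewrite -(bE i); apply: ler_wpM2l; first exact: ltW.
  apply: le_trans xp' _; rewrite ler_pM2l// lef_pV2 ?posrE ?exprn_gt0//.
  by apply: ler_weXn2l => //; lra.
have uB x y : `|u x - u y| <= N.+1%:R^-1 * (\sum_(i < N.+1) b i) * `|x - y|.
  rewrite /u -mulrBr -mulrA normrM gtr0_norm//; apply: ler_wpM2l; first exact: ltW.
  rewrite -sumrB mulr_suml; apply: le_trans (ler_norm_sum _ _ _) _.
  by apply: ler_sum => i _; exact: phiB.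
have suC : support_of u `<=` cube p (4 * r) by apply: support_of_sub => //; exact: cube_closed.
have [rho ur] : exists rho : R, forall x, rho < `|x| -> u x = 0.
  by apply: support_of_bounded; apply: support_of_compact u0; rewrite mulr_ge0// ltW.
have bp j : bcs (pd j u) by exact: lipschitz_pd_bcs uB ur j.
pose e i x : R := \1_(B i) x.
have e01 i x : e i x = 0 \/ e i x = 1 by rewrite /e indicE; case: (_ \in _); [right|left].
have e0 i x : 0 <= e i x by case: (e01 i x) => ->.
have pdu j x : `|pd j u x| <= N.+1%:R^-1 * \sum_(i < N.+1) b i * e i x.
  apply: pd_le_lipschitz.
    by rewrite mulr_ge0 ?(ltW NV)//; apply: sumr_ge0 => i _; rewrite mulr_ge0// ltW.
  (* Off the closed cube [B i] the i-th cut-off vanishes in a neighbourhood and adds nothing to the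
     local Lipschitz constant. *)
  have H (i : 'I_N.+1) : \forall y \near x, `|phi i y - phi i x| <= b i * e i x * `|y - x|.
    rewrite /e indicE; have [xB|xB] := boolP (x \in B i).
      by apply: filterS (@filterT _ (nbhs x) (nbhs_filter x)) => y _; rewrite mulr1; exact: phiB.
    have oB : open (~` B i) by apply: closed_openC; exact: cube_closed.
    have : nbhs x (~` B i) by apply: open_nbhs_nbhs; split => //= /mem_set; exact/negP.
    apply: filterS => y yB; rewrite !phi0//; last by move=> /mem_set; exact/negP.
    by rewrite subrr normr0 mulr0 mul0r.
  have := @filter_forall _ _ (fun (i : 'I_N.+1) y => `|phi i y - phi i x| <= b i * e i x * `|y - x|) (nbhs x) (nbhs_filter x) H; apply: filterS => y Hy.
  rewrite /u -mulrBr -mulrA normrM gtr0_norm//; apply: ler_wpM2l; first exact: ltW.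
  rewrite -sumrB mulr_suml; apply: le_trans (ler_norm_sum _ _ _) _.
  by apply: ler_sum => i _.
have pdu2 j x : pd j u x ^+ 2 <= 3 * (N.+1%:R ^- 2 * \sum_(i < N.+1) b i ^+ 2 * e i x).
  rewrite -(real_normK (num_real _)); apply: le_trans (_ : (N.+1%:R^-1 * \sum_(i < N.+1) b i * e i x) ^+ 2 <= _).
    rewrite ler_pXn2r ?nnegrE//.
    by rewrite mulr_ge0 ?(ltW NV)//; apply: sumr_ge0 => i _; rewrite mulr_ge0// ltW.
  rewrite exprMn exprVn [leRHS]mulrCA; apply: ler_wpM2l; first by rewrite invr_ge0 exprn_ge0.
  by apply: (@geometric_square R b (fun i => e i x) N.+1) => //; exact: ltW.
have be (i : nat) : bcs (fun x => b i ^+ 2 * e i x) by apply: bcsZ; apply: bcs_indic; rewrite mulr_ge0// ltW.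
have bS' : bcs (fun x => \sum_(i < N.+1) b i ^+ 2 * e i x) by apply: bcs_sum => i; exact: be.
apply: (@le_trans _ _ (\int[lebesgue_rV n]_x (\sum_(j < n) pd j u x ^+ 2)%:E)%E).
  apply: ereal_inf_lbound; exists u => //; split.
  - exists (N.+1%:R^-1 * (\sum_(i < N.+1) b i)) => -[x y] _ /=; exact: uB.
  - by apply: support_of_compact u0; rewrite mulr_ge0// ltW.
  - exact: subset_trans suC pO.
  - exact: u1.
have bp2 : bcs (fun x => \sum_(j < n) pd j u x ^+ 2) by apply: bcs_sum => j; exact: bcsMb.
rewrite -RI_EFin// lee_fin.
apply: le_trans (_ : RI (fun x => n%:R * (3 * (N.+1%:R ^- 2 * \sum_(i < N.+1) b i ^+ 2 * e i x))) <= _).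
  apply: RI_le => //; first by do 3!apply: bcsZ.
  move=> x; rewrite mulr_natl -[in leRHS](card_ord n) -sumr_const.
  by apply: ler_sum => j _; exact: pdu2.
rewrite !RI_Z//; [|by do ?apply: bcsZ..].
rewrite RI_sum//; do 3 (apply: ler_wpM2l; first by rewrite ?invr_ge0 ?exprn_ge0).
apply: ler_sum => i _; rewrite RI_Z; last by apply: bcs_indic; rewrite mulr_ge0// ltW.
by rewrite RI_indic_cube// mulr_ge0// ltW.
Qed.

End capacity_le.

(** * The magnetic form *)

Section semi_inner_pullback.
Context {R : realType} {E : lmodType R[i]}.

Lemma semi_inner_pull (T L : set E) (s : E -> E -> R) (A : E -> E) : semi_inner L s -> T 0 ->
  (forall (z : R[i]) u v, T u -> T v -> T (z *: u + v)) ->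
  (forall u, T u -> L (A u)) ->
  (forall (z : R[i]) u v, T u -> T v -> A (z *: u + v) = z *: A u + A v) ->
  semi_inner T (fun u v => s (A u) (A v)).
Proof.
move=> HL T0 TP AL AP.
have A0 : A 0 = 0.
  have := AP 1 0 0 T0 T0; rewrite !scale1r addr0 => /eqP.
  by rewrite -subr_eq subrr eq_sym => /eqP.
have AD u v : T u -> T v -> A (u + v) = A u + A v.
  by move=> Tu Tv; have := AP 1 u v Tu Tv; rewrite !scale1r.
have AZ z u : T u -> A (z *: u) = z *: A u.
  by move=> Tu; have := AP z u 0 Tu T0; rewrite !addr0 A0 addr0.
split => //.
- by move=> u v Tu Tv; rewrite (semi_innerC HL)//; exact: AL.
- by move=> u v w Tu Tv Tw; rewrite AD// (semi_innerDl HL)//; exact: AL.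
- by move=> r u v Tu Tv; rewrite AZ// (semi_innerZl HL)//; exact: AL.
- by move=> u v Tu Tv; rewrite !AZ// (semi_inneri HL)//; exact: AL.
- by move=> u Tu; rewrite (semi_inner_ge0 HL)//; exact: AL.
Qed.

Lemma semi_inner_sum (I : Type) (r : seq I) (T : set E) (h : E -> E -> R) (s : I -> E -> E -> R) :
  semi_inner T h -> (forall i, semi_inner T (s i)) ->
  semi_inner T (fun u v => \sum_(i <- r) s i u v + h u v).
Proof.
move=> Hh Hs; split.
- exact: (semi_inner0 Hh).
- exact: (semi_innerP Hh).
- move=> u v Tu Tv; congr (_ + _); last exact: (semi_innerC Hh).
  by apply: eq_bigr => i _; exact: (semi_innerC (Hs i)).
- move=> u v w Tu Tv Tw; rewrite (semi_innerDl Hh)// addrACA -big_split/=; congr (_ + _).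
  by apply: eq_bigr => i _; exact: (semi_innerDl (Hs i)).
- move=> k u v Tu Tv; rewrite (semi_innerZl Hh)// mulrDr mulr_sumr; congr (_ + _).
  by apply: eq_bigr => i _; exact: (semi_innerZl (Hs i)).
- move=> u v Tu Tv; rewrite (semi_inneri Hh)// opprD -sumrN; congr (_ + _).
  by apply: eq_bigr => i _; exact: (semi_inneri (Hs i)).
- move=> u Tu; rewrite addr_ge0 ?(semi_inner_ge0 Hh)// sumr_ge0// => i _.
  exact: (semi_inner_ge0 (Hs i)).
Qed.

Lemma semi_inner_sumr (D : set E) (h : E -> E -> R) u (I : Type) (r : seq I) (F : I -> E) :
  semi_inner D h -> D u -> (forall i, D (F i)) ->
  h u (\sum_(i <- r) F i) = \sum_(i <- r) h u (F i).
Proof.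
move=> H Du DF; elim: r => [|i r IH].
  rewrite !big_nil (semi_innerC H)//; last exact: (semi_inner0 H).
  by rewrite (h0l H).
by rewrite !big_cons (hDr H)// ?IH//; exact: (in_sum H).
Qed.

End semi_inner_pullback.

Section smooth.
Context {R : realType} {n : nat}.
Local Notation E := ('rV[R]_n -> R[i]^o).
Implicit Types (f g : 'rV[R]_n -> R) (u v : E).

Lemma smooth_C1 f s : smooth_on setT f -> C1 (foldr pd f s).
Proof.
move=> fs; split=> [x|j]; first by case: (fs s x Logic.I).
split=> x; last by case: (fs (j :: s) x Logic.I).
by have [_ /(_ j)/derivableP] := fs s x Logic.I.
Qed.

Lemma C1_lin f g h (c d : R) : C1 f -> C1 g -> C1 h ->
  C1 (fun x => c * f x - d * g x + h x) /\
  forall j, pd j (fun x => c * f x - d * g x + h x) = (fun x => c * pd j f x - d * pd j g x + pd j h x).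
Proof.
move=> Cf Cg Ch; have [C1f p1] := C1Z c Cf; have [C2 p2] := C1Z (- d) Cg.
have [C3 p3] := C1D C1f C2; have [C4 p4] := C1D C3 Ch.
have e : (fun x => c * f x - d * g x + h x) = (fun x => c * f x + - d * g x + h x).
  by apply/funext => x; rewrite mulNr.
rewrite e; split => // j; rewrite p4 p3 p1 p2; apply/funext => x; by rewrite mulNr.
Qed.

Lemma smooth_lin f g h (c d : R) : smooth_on setT f -> smooth_on setT g -> smooth_on setT h ->
  smooth_on setT (fun x => c * f x - d * g x + h x).
Proof.
move=> sf sg sh s.
have [C p] : C1 (foldr pd (fun x => c * f x - d * g x + h x) s) /\
    foldr pd (fun x => c * f x - d * g x + h x) s =
    (fun x => c * foldr pd f s x - d * foldr pd g s x + foldr pd h s x).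
  elim: s => [|j s [C IH]] /=.
    by split => //; apply: (C1_lin _ _ _ _ _).1; exact: (smooth_C1 [::]).
  rewrite IH; have H := C1_lin c d (smooth_C1 s sf) (smooth_C1 s sg) (smooth_C1 s sh).
  rewrite H.2; split => //; apply: (C1_lin _ _ _ _ _).1.
  - exact: (smooth_C1 (j :: s) sf).
  - exact: (smooth_C1 (j :: s) sg).
  - exact: (smooth_C1 (j :: s) sh).
by move=> x _; split; [exact: C.1|move=> j; case: ((C.2 j).1 x)].
Qed.

Lemma smooth_cst0 : smooth_on setT (fun _ : 'rV[R]_n => 0 : R).
Proof.
have e s : foldr pd (fun=> 0) s = (fun=> 0) :> ('rV[R]_n -> R).
  by elim: s => //= j s ->; rewrite (C1_cst 0).2.
have C0 := (C1_cst 0 : C1 (fun _ : 'rV[R]_n => 0 : R) /\ _).1.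
by move=> s x _; rewrite e; split; [exact: C0.1|move=> j; case: ((C0.2 j).1 x)].
Qed.

Lemma test_funP u : test_fun u <-> [/\ smooth_on setT (re_fun u), smooth_on setT (im_fun u)
  & exists r : R, forall x, r < `|x| -> u x = 0].
Proof.
split=> [[[su su'] /support_of_bounded//]|[su su' [r ur]]].
split=> //; apply: (@support_of_compact _ _ _ _ 0 (2 * Num.max r 0)).
  by rewrite mulr_ge0// le_max lexx orbT.
have r0 : 0 <= 2 * Num.max r 0 by rewrite mulr_ge0// le_max lexx orbT.
move=> x; rewrite cubeE//= subr0 => /negP; rewrite -ltNge => xr; apply: ur.
apply: le_lt_trans xr; rewrite (_ : 2 * _ / 2 = Num.max r 0); last by field.
by rewrite le_max lexx.
Qed.

Lemma test_fun0 : test_fun (0 : E).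
Proof. by apply/test_funP; split; [exact: smooth_cst0..|exists 0]. Qed.

Lemma test_fun_lin (z : R[i]) u v : test_fun u -> test_fun v -> test_fun (z *: u + v : E).
Proof.
move=> /test_funP[ru iu [r u0]] /test_funP[rv iv [s v0]]; apply/test_funP; split.
- by rewrite re_funP; exact: smooth_lin.
- rewrite im_funP (_ : (fun x => _) = (fun x => complex.Re z * im_fun u x - (- complex.Im z) * re_fun u x + im_fun v x)).
    exact: smooth_lin.
  by apply/funext => x; rewrite mulNr opprK.
- exists (Num.max r s) => x; rewrite gt_max => /andP[xr xs].
  by rewrite [LHS](_ : _ = z * u x + v x)// u0// v0// mulr0 addr0.
Qed.

(** Weaker than [test_fun]: as [a] is only of class C^1, a magnetic derivative of a test function
    need not be smooth, but it is [ccs] and can be differentiated once more. *)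
Definition ccs u := [/\ C1 (re_fun u), C1 (im_fun u), bcs (re_fun u) & bcs (im_fun u)].

Lemma test_fun_ccs u : test_fun u -> ccs u.
Proof.
move=> /test_funP[ru iu [r u0]].
have Cr := smooth_C1 [::] ru; have Ci := smooth_C1 [::] iu; split => //.
- by apply: continuous_bcs; [exact: Cr.1|exists r => x /u0 ux; rewrite /re_fun ux].
- by apply: continuous_bcs; [exact: Ci.1|exists r => x /u0 ux; rewrite /im_fun ux].
Qed.

Lemma bcs_L2 u : bcs (re_fun u) -> bcs (im_fun u) -> L2 u.
Proof. by move=> br bi; apply/L2P; split; exact: bcs_l2. Qed.

Lemma ccs_L2 u : ccs u -> L2 u.
Proof. by case=> _ _ br bi; exact: bcs_L2. Qed.

End smooth.

Section magnetic_form.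
Context {R : realType} {n : nat}.
Local Notation E := ('rV[R]_n -> R[i]^o).
Variables (a : 'rV[R]_n -> 'rV[R]_n) (V : 'rV[R]_n -> R).
Hypotheses (Ca : forall j, C1 (fun x => a x 0 j)) (cV : continuous V) (V0 : forall x, 0 <= V x).
Implicit Types (u v : E).

Lemma re_mgrad j u : re_fun (mgrad a j u) = (fun x => pd j (re_fun u) x - a x 0 j * im_fun u x).
Proof.
apply/funext => x; rewrite /re_fun /mgrad /cpd /im_fun/=.
by case: (u x) => p q /=; ring.
Qed.

Lemma im_mgrad j u : im_fun (mgrad a j u) = (fun x => pd j (im_fun u) x + a x 0 j * re_fun u x).
Proof.
apply/funext => x; rewrite /im_fun /mgrad /cpd /re_fun/=.
by case: (u x) => p q /=; ring.
Qed.

Lemma mgrad_bcs j u : ccs u -> bcs (re_fun (mgrad a j u)) /\ bcs (im_fun (mgrad a j u)).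
Proof.
move=> [Cr Ci br bi]; rewrite re_mgrad im_mgrad; split.
  apply: bcsB; first exact: C1_pd_bcs.
  by under eq_fun do rewrite mulrC; exact: C1_bcsM.
apply: bcsD; first exact: C1_pd_bcs.
by under eq_fun do rewrite mulrC; exact: C1_bcsM.
Qed.

Lemma mgrad_L2 j u : ccs u -> L2 (mgrad a j u : E).
Proof. by move=> /(mgrad_bcs j)[? ?]; exact: bcs_L2. Qed.

Lemma cfun_ext u v : re_fun u = re_fun v -> im_fun u = im_fun v -> u = v.
Proof.
move=> e1 e2; apply/funext => x; have := congr1 (fun f => f x) e1; have := congr1 (fun f => f x) e2.
by rewrite /re_fun /im_fun; case: (u x) (v x) => p q [p' q'] /= -> ->.
Qed.

Lemma mgrad_lin j (z : R[i]) u v : ccs u -> ccs v ->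
  mgrad a j (z *: u + v : E) = z *: (mgrad a j u : E) + mgrad a j v.
Proof.
move=> [Cru Ciu _ _] [Crv Civ _ _].
have [_ p1] := C1_lin (complex.Re z) (complex.Im z) Cru Ciu Crv.
have [_ p2] := C1_lin (complex.Re z) (- complex.Im z) Ciu Cru Civ.
have e : im_fun (z *: u + v : E) = (fun x => complex.Re z * im_fun u x - - complex.Im z * re_fun u x + im_fun v x).
  by rewrite im_funP; apply/funext => x; rewrite mulNr opprK.
apply: cfun_ext.
  rewrite re_funP !re_mgrad im_mgrad e re_funP p1; apply/funext => x.
  by move: (pd j (re_fun u) x) (pd j (im_fun u) x) (pd j (re_fun v) x) => ? ? ?; ring.
rewrite im_funP !im_mgrad re_mgrad e re_funP p2; apply/funext => x.
by move: (pd j (re_fun u) x) (pd j (im_fun u) x) (pd j (im_fun v) x) => ? ? ?; ring.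
Qed.

Definition rmul (w : 'rV[R]_n -> R) u : E := fun x => (w x)%:C%C * u x.

Lemma re_rmul w u : re_fun (rmul w u) = (fun x => w x * re_fun u x).
Proof. by apply/funext => x; rewrite /re_fun /rmul; case: (u x) => p q /=; ring. Qed.

Lemma im_rmul w u : im_fun (rmul w u) = (fun x => w x * im_fun u x).
Proof. by apply/funext => x; rewrite /im_fun /rmul; case: (u x) => p q /=; ring. Qed.

Lemma rmul_lin w (z : R[i]) u v : rmul w (z *: u + v : E) = z *: rmul w u + rmul w v.
Proof.
apply/funext => x; rewrite [RHS](_ : _ = z * ((w x)%:C%C * u x) + (w x)%:C%C * v x)//.
by rewrite /rmul [(_ + _) x](_ : _ = z * u x + v x)// mulrDr mulrCA.
Qed.

Lemma continuous_bcsM (w f : 'rV[R]_n -> R) : continuous w -> bcs f -> bcs (fun x => w x * f x).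
Proof.
move=> cw bf; under eq_fun do rewrite mulrC; apply: bcsM => //.
  exact: continuous_measurable_rV.
exact: continuous_locally_bounded.
Qed.

Lemma sqrtV_continuous : continuous (fun x => Num.sqrt (V x)).
Proof.
by move=> x; apply: (@continuous_comp _ _ _ V Num.sqrt); [exact: cV|exact: sqrt_continuous].
Qed.

Lemma rmul_L2 (w : 'rV[R]_n -> R) u : continuous w -> ccs u -> L2 (rmul w u).
Proof.
by move=> cw [_ _ br bi]; apply: bcs_L2; rewrite ?re_rmul ?im_rmul; exact: continuous_bcsM.
Qed.

(** The real part of [hform]. The square root of [V] makes the electric term a pullback of
    [re_inner], so that the semi-inner product axioms are inherited. *)
Definition tform u v : R := \sum_(j < n) re_inner (mgrad a j u) (mgrad a j v) +
  re_inner (rmul (fun x => Num.sqrt (V x)) u) (rmul (fun x => Num.sqrt (V x)) v).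

Lemma tform_semi_inner : semi_inner [set u : E | test_fun u] tform.
Proof.
apply: semi_inner_sum => [|j].
- apply: (semi_inner_pull L2_semi_inner (A := rmul (fun x => Num.sqrt (V x)))).
  + exact: test_fun0.
  + exact: test_fun_lin.
  + by move=> u /test_fun_ccs cu; apply: rmul_L2 => //; exact: sqrtV_continuous.
  + by move=> z u v _ _; exact: rmul_lin.
- apply: (semi_inner_pull L2_semi_inner (A := fun u => (mgrad a j u : E))).
  + exact: test_fun0.
  + exact: test_fun_lin.
  + by move=> u /test_fun_ccs; exact: mgrad_L2.
  + by move=> z u v /test_fun_ccs cu /test_fun_ccs cv; exact: mgrad_lin.
Qed.

Lemma re_sum (I : Type) (r : seq I) (F : I -> R[i]) :
  complex.Re (\sum_(i <- r) F i) = \sum_(i <- r) complex.Re (F i).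
Proof. by apply: (big_morph (@complex.Re R)) => [[p q] [p' q']|]. Qed.

Lemma re_hform u v : test_fun u -> test_fun v -> complex.Re (hform a V u v) = tform u v.
Proof.
move=> /test_fun_ccs cu /test_fun_ccs cv; rewrite /tform /hform/=.
have sq x : Num.sqrt (V x) * Num.sqrt (V x) = V x by rewrite -expr2 sqr_sqrtr.
have [bu1 bu2] : bcs (re_fun (rmul (fun x => Num.sqrt (V x)) u)) /\ bcs (im_fun (rmul (fun x => Num.sqrt (V x)) u)).
  by case: cu => _ _ br bi; split; rewrite ?re_rmul ?im_rmul; apply: continuous_bcsM => //; exact: sqrtV_continuous.
have [bv1 bv2] : bcs (re_fun (rmul (fun x => Num.sqrt (V x)) v)) /\ bcs (im_fun (rmul (fun x => Num.sqrt (V x)) v)).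
  by case: cv => _ _ br bi; split; rewrite ?re_rmul ?im_rmul; apply: continuous_bcsM => //; exact: sqrtV_continuous.
rewrite /re_inner -RI_sum => [|j]; last first.
  have [b1 b2] := mgrad_bcs j cu; have [b3 b4] := mgrad_bcs j cv.
  by apply: bcsD; exact: bcsMb.
rewrite -RI_D.
- apply: RI_ext => x; rewrite {1}/re_fun; rewrite [LHS](_ : _ =
    complex.Re (\sum_(j < n) mgrad a j u x * conjc (mgrad a j v x)) +
    complex.Re ((V x)%:C%C * (u x * conjc (v x)))); last first.
    by move: (\sum_(j < n) _) (_ * (u x * _)) => [? ?] [? ?].
  rewrite re_sum !re_rmul !im_rmul; congr (_ + _).
    apply: eq_bigr => j _; rewrite /re_fun /im_fun.
    by case: (mgrad a j u x) (mgrad a j v x) => ? ? [? ?] /=; ring.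
  rewrite [RHS](_ : _ = Num.sqrt (V x) * Num.sqrt (V x) * (re_fun u x * re_fun v x + im_fun u x * im_fun v x)); last by ring.
  by rewrite sq /re_fun /im_fun; case: (u x) (v x) => ? ? [? ?] /=; ring.
- apply: bcs_sum => j; have [b1 b2] := mgrad_bcs j cu; have [b3 b4] := mgrad_bcs j cv.
  by apply: bcsD; exact: bcsMb.
- by apply: bcsD; exact: bcsMb.
Qed.

Lemma im_hform u v : test_fun u -> test_fun v ->
  complex.Im (hform a V u v) = tform u ('i%C *: v : E).
Proof.
move=> tu tv.
have tiv : test_fun ('i%C *: v : E) by rewrite -[_ *: _]addr0; apply: test_fun_lin => //; exact: test_fun0.
rewrite -re_hform// /hform/=; apply: RI_ext => x; rewrite /re_fun /im_fun.
have E1 z w : complex.Im (z * conjc w) = complex.Re (z * conjc ('i%C * w)) :> R.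
  by case: z w => ? ? [? ?] /=; ring.
have E2 (z w : R[i]) : complex.Im (z + w) = complex.Im z + complex.Im w by case: z w => ? ? [? ?].
have E3 (z w : R[i]) : complex.Re (z + w) = complex.Re z + complex.Re w by case: z w => ? ? [? ?].
have E4 (r : R) z : complex.Im (r%:C%C * z) = r * complex.Im z by case: z => ? ? /=; ring.
have E5 (r : R) z : complex.Re (r%:C%C * z) = r * complex.Re z by case: z => ? ? /=; ring.
rewrite E2 E3 E4 E5 E1 re_sum; congr (_ + _).
rewrite (@big_morph _ _ (@complex.Im R) 0 +%R 0 +%R E2 erefl); apply: eq_bigr => j _.
rewrite E1; congr (complex.Re (_ * conjc _)).
have := mgrad_lin j 'i%C (test_fun_ccs tv) (test_fun_ccs (@test_fun0 R n)).
have -> : mgrad a j (0 : E) = 0.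
  apply: cfun_ext; rewrite ?re_mgrad ?im_mgrad; apply/funext => y.
    by rewrite (C1_cst 0).2 /im_fun/= mulr0 subrr.
  by rewrite (C1_cst 0).2 /re_fun/= mulr0 addr0.
by rewrite !addr0 => ->.
Qed.

(** Both partial differentiation and multiplication by i a_j are skew-adjoint. *)
Lemma mgrad_adj j u w : ccs u -> ccs w ->
  re_inner (mgrad a j u) w = - re_inner u (mgrad a j w).
Proof.
move=> [Cru Ciu bru biu] [Crw Ciw brw biw].
have i1 := integration_by_parts_rV j Cru Crw bru.
have i2 := integration_by_parts_rV j Ciu Ciw biu.
have b1 : bcs (fun x => re_fun u x * pd j (re_fun w) x) by apply: bcsMb => //; exact: C1_pd_bcs.
have b2 : bcs (fun x => im_fun u x * pd j (im_fun w) x) by apply: bcsMb => //; exact: C1_pd_bcs.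
have b3 : bcs (fun x => pd j (re_fun u) x * re_fun w x) by apply: bcsMb => //; exact: C1_pd_bcs.
have b4 : bcs (fun x => pd j (im_fun u) x * im_fun w x) by apply: bcsMb => //; exact: C1_pd_bcs.
have b5 : bcs (fun x => a x 0 j * (re_fun u x * im_fun w x - im_fun u x * re_fun w x)).
  by apply: continuous_bcsM; [exact: (Ca j).1|apply: bcsB; exact: bcsMb].
rewrite /re_inner re_mgrad im_mgrad re_mgrad im_mgrad.
transitivity (RI (fun x => (pd j (re_fun u) x * re_fun w x + pd j (im_fun u) x * im_fun w x) +
   a x 0 j * (re_fun u x * im_fun w x - im_fun u x * re_fun w x))).
  by apply: RI_ext => x; move: (pd j (re_fun u) x) (pd j (im_fun u) x) => ? ?; ring.
rewrite RI_D//; last exact: bcsD.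
rewrite RI_D//; transitivity (- RI (fun x => (re_fun u x * pd j (re_fun w) x + im_fun u x * pd j (im_fun w) x) -
   a x 0 j * (re_fun u x * im_fun w x - im_fun u x * re_fun w x))).
  rewrite RI_B//; last exact: bcsD.
  by rewrite RI_D// i1 i2; ring.
by congr (- _); apply: RI_ext => x; move: (pd j (re_fun w) x) (pd j (im_fun w) x) => ? ?; ring.
Qed.

(** [psi] is H phi, that is V phi minus the sum of the second magnetic derivatives of phi; this
    provides the hypothesis that makes the form closable. *)
Lemma tform_adj phi : test_fun phi -> exists2 psi : E, L2 psi & forall u, test_fun u ->
  tform u phi = re_inner u psi.
Proof.
move=> tp; have cp := test_fun_ccs tp; have /test_funP[sr si [r pr]] := tp.
have cg j : ccs (mgrad a j phi).
  have [b1 b2] := mgrad_bcs j cp; split => //.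
    rewrite re_mgrad; have C2 := smooth_C1 [:: j] sr.
    have [Cq _ _ _] := cp; have [_ Ci _ _] := cp.
    have [C3 _] := C1M (Ca j) Ci; have [C4 _] := C1Z (-1) C3; have [C5 _] := C1D C2 C4.
    by rewrite (_ : (fun x => _) = (fun x => foldr pd (re_fun phi) [:: j] x + -1 * (a x 0 j * im_fun phi x)))//; apply/funext => x; rewrite mulN1r.
  rewrite im_mgrad; have C2 := smooth_C1 [:: j] si.
  by have [Cr _ _ _] := cp; have [C3 _] := C1M (Ca j) Cr; have [C5 _] := C1D C2 C3.
have VL : L2 (rmul V phi) by exact: rmul_L2.
have gL j : L2 (mgrad a j (mgrad a j phi) : E) by exact: mgrad_L2.
have sL : L2 (- \sum_(j < n) (mgrad a j (mgrad a j phi) : E)).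
  by apply: (in_N L2_semi_inner); apply: (in_sum L2_semi_inner).
exists (rmul V phi - \sum_(j < n) (mgrad a j (mgrad a j phi) : E)).
  exact: (in_D L2_semi_inner).
move=> u tu; have cu := test_fun_ccs tu; have uL := ccs_L2 cu.
rewrite /tform (hDr L2_semi_inner)// addrC; congr (_ + _).
  apply: RI_ext => x; rewrite !re_rmul !im_rmul.
  have sq : Num.sqrt (V x) * Num.sqrt (V x) = V x by rewrite -expr2 sqr_sqrtr.
  by move: (Num.sqrt (V x)) sq => w <-; ring.
rewrite (hNr L2_semi_inner)//; last by apply: (in_sum L2_semi_inner).
transitivity (\sum_(j < n) - re_inner u (mgrad a j (mgrad a j phi))).
  by apply: eq_bigr => j _; exact: mgrad_adj.
rewrite sumrN; congr (- _).
by rewrite (semi_inner_sumr _ L2_semi_inner).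
Qed.

End magnetic_form.

(** * From the abstract form to the operator *)

Section discreteness.
Context {R : realType} {n : nat}.
Local Notation E := ('rV[R]_n -> R[i]^o).
Variables (a : 'rV[R]_n -> 'rV[R]_n) (V : 'rV[R]_n -> R).
Hypotheses (Ca : forall j, C1 (fun x => a x 0 j)) (cV : continuous V) (V0 : forall x, 0 <= V x).
Local Notation t := (tform a V).
Hypothesis st : forall u : E, test_fun u -> re_inner u u <= t u u.
Hypothesis rel : forall e : R, 0 < e -> exists2 b : seq E, forall x, x \in b -> L2 x &
  forall u : E, test_fun u -> re_inner u u <= e * t u u + \sum_(x <- b) re_inner u x ^+ 2.
Implicit Types (u v f g : E).

Let T : set E := [set u : E | test_fun u].
Let D := closure_dom L2 T re_inner t.
Let h := closure_form L2 T re_inner t.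
Let HL := @L2_semi_inner R n.
Let cL := @L2_complete R n.
Let HT : semi_inner T t := tform_semi_inner Ca cV.
Let TL : T `<=` L2. Proof. by move=> u /test_fun_ccs/ccs_L2. Qed.
Let adj := tform_adj Ca cV V0.

Lemma form_approxP u (u_ : nat -> E) : form_approx a V u u_ <-> approx L2 T re_inner t u u_.
Proof.
have key : (forall k, test_fun (u_ k)) -> L2 u ->
   (sqnorm_on setT (u_ k \- u) @[k --> \oo] --> 0%E <-> cvg_in re_inner u_ u).
  move=> tu Lu; have e : (fun k => sqnorm_on setT (u_ k \- u)) =
      (fun k => (re_inner (u_ k - u) (u_ k - u))%:E).
    apply/funext => k; apply: (@L2_sqnorm R n (u_ k - u)).
    by apply: (in_B HL) => //; exact: (TL (tu k)).
  rewrite e; split=> [/fine_cvgP[_]//|c].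
  by apply/fine_cvgP; split; first exact: nearW.
have kt : (forall k, test_fun (u_ k)) -> forall k l,
    complex.Re (hform a V (u_ k \- u_ l) (u_ k \- u_ l)) = t (u_ k - u_ l) (u_ k - u_ l).
  by move=> tu k l; apply: (re_hform Ca cV V0); apply: (in_B HT); exact: tu.
split=> -[tu Lu c ca]; have /key {}key := tu.
  split=> //; first exact/key.
  by move=> e e0; have [N HN] := ca e e0; exists N => k l Nk Nl; rewrite -kt//; exact: HN.
split=> //; first exact/key.
by move=> e e0; have [N HN] := ca e e0; exists N => k l Nk Nl; rewrite kt//; exact: HN.
Qed.

Lemma form_domainP u : form_domain a V u <-> D u.
Proof. by split=> -[u_ /form_approxP au]; exists u_. Qed.

Lemma magnetic_schrodingerP u f : magnetic_schrodinger a V u f <-> weak_sol L2 D re_inner h u f.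
Proof.
split=> -[Du Lf uf]; split => //.
- exact/form_domainP.
- move=> v /form_domainP Dv; have [u_ [v_ [/form_approxP au /form_approxP av [c _]]]] := uf v Dv.
  rewrite -re_inner_inner.
  have := closure_formP HL HT TL adj au av.
  rewrite (_ : (fun k => t (u_ k) (v_ k)) = (fun k => complex.Re (hform a V (u_ k) (v_ k)))).
    by move=> c'; exact: (cvg_unique _ c' c).
  apply/funext => k; rewrite (re_hform Ca cV V0)//; first by case: au => + _ _ _; apply.
  by case: av => + _ _ _; apply.
- exact/form_domainP.
- move=> v /form_domainP Dv; have Dv' := Dv; have Du' := Du.
  have [u_ au] := Du'; have [v_ av] := Dv'.
  exists u_, v_; split; [exact/form_approxP|exact/form_approxP|].
  have tu k : test_fun (u_ k) by case: au => + _ _ _; apply.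
  have tv k : test_fun (v_ k) by case: av => + _ _ _; apply.
  split.
    rewrite re_inner_inner -uf//.
    rewrite (_ : (fun k => complex.Re (hform a V (u_ k) (v_ k))) = (fun k => t (u_ k) (v_ k))).
      exact: (closure_formP HL HT TL adj au av).
    by apply/funext => k; rewrite (re_hform Ca cV V0).
  (* The imaginary part is the real part with i v in place of v, and the sequence i v_k approximates
     i v. *)
  have aiv := approxP HL HT TL 'i%C av (approx_cst HL HT TL (@test_fun0 R n)).
  have Div : D ('i%C *: v) by exists (fun k => 'i%C *: v_ k + 0); rewrite -[_ *: v]addr0.
  rewrite im_inner_inner -uf//.
  rewrite (_ : (fun k => complex.Im (hform a V (u_ k) (v_ k))) = (fun k => t (u_ k) ('i%C *: v_ k + 0))).
    by have := closure_formP HL HT TL adj au aiv; rewrite [_ *: v + 0]addr0.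
  by apply/funext => k; rewrite (im_hform Ca cV V0)// addr0.
Qed.

Lemma magnetic_discrete : discrete_spectrum a V.
Proof.
have HD : semi_inner D h := closure_semi_inner HL HT TL adj.
have cD : complete_in D h := closure_complete HL cL HT TL st adj.
have DL : D `<=` L2 := @closure_dom_L _ _ L2 T re_inner t.
have sh u : D u -> re_inner u u <= h u u := @closure_form_ge _ _ _ _ _ _ HL HT TL st adj u.
have rD (e : R) : 0 < e -> exists2 b : seq E, forall x, x \in b -> L2 x &
    forall u, D u -> re_inner u u <= e * h u u + \sum_(x <- b) re_inner u x ^+ 2.
  move=> e0; have [b Lb Hb] := rel e0; exists b => //.
  exact: (closure_rellich HL HT TL adj Lb Hb).
(* A point that is not an eigenvalue lies in the resolvent set, so the spectrum consists of
   eigenvalues. *)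
have eig l : spectrum a V l -> exists2 u, weak_sol L2 D re_inner h u (l *: u) & 0 < re_inner u u.
  move=> sl; apply: contrapT => nex; apply: sl.
  have noe u : weak_sol L2 D re_inner h u (l *: u) -> re_inner u u = 0.
    move=> wu; apply/eqP; rewrite eq_le (semi_inner_ge0 HL) ?andbT; last by case: wu => /DL.
    by rewrite leNgt; apply/negP => u0; apply: nex; exists u.
  have noeC := no_eig_conj HL HD DL noe.
  split.
    have [C HC] := resolvent_bound HL HD cD DL sh rD noe.
    exists C => u g Lg /magnetic_schrodingerP wu; have := HC u g Lg wu.
    have Lu : L2 u by case: wu => /DL.
    by rewrite (L2_sqnorm Lu) (L2_sqnorm Lg) -EFinM lee_fin.
  move=> g Lg; have [u wu] := resolvent_solve HL HD cD DL sh rD noe noeC Lg.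
  by exists u; apply/magnetic_schrodingerP.
move=> l sl; split.
- have [e e0 He] := eigen_isolated HL HD DL sh rD l; exists e => // l' /eig[u wu u0] ll'.
  exact: He wu u0 ll'.
- have [u wu u0] := eig l sl; exists u; split; first exact/magnetic_schrodingerP.
  by rewrite L2_sqnorm ?lte_fin//; case: wu => /DL.
- have [m [e He]] := eigen_finite HL HD DL rD l; exists m, e => u [/magnetic_schrodingerP wu _].
  have [c [Lw w0]] := He u wu; exists c.
  have := re_inner0_ae Lw w0; apply: filterS => x.
  rewrite [X in X = 0 -> _](_ : _ = u x - \sum_(k < m) c k * e k x); first by move/subr0_eq.
  rewrite [LHS](_ : _ = u x - (\sum_(k < m) c k *: e k) x)//; congr (_ - _).
  by rewrite fct_sumE.
Qed.

End discreteness.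

(** * A monotone cut-off of class C^1 *)

Section step.
Context {R : realType}.

Definition possq (t : R) : R := Num.max 0 t ^+ 2.

Lemma possq_le0 t : t <= 0 -> possq t = 0.
Proof. by move=> t0; rewrite /possq max_l// expr0n. Qed.

Lemma possq_ge0 t : 0 <= t -> possq t = t ^+ 2.
Proof. by move=> t0; rewrite /possq max_r. Qed.

Lemma possq_derive (t : R) : is_derive t 1 possq (2 * Num.max 0 t).
Proof.
have [t0|t0|->] := ltgtP t 0.
- have e : {near t, possq =1 cst 0}.
    have : \forall s \near t, s < 0 by apply: lt_nbhsl.
    by apply: filterS => s s0; rewrite possq_le0// ltW.
  split; first by apply: (@near_eq_derivable _ _ _ (cst 0)); [apply: filterS e => s ->|exact: derivable_cst].
  by rewrite (near_eq_derive _ e) derive_cst mulr0.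
- have e : {near t, possq =1 (fun s : R => s * s)}.
    have : \forall s \near t, 0 < s by apply: lt_nbhsr.
    by apply: filterS => s s0; rewrite possq_ge0 ?expr2// ltW.
  have d : is_derive t 1 (fun s : R => s * s) (2 * t).
    have := @is_deriveM R R id id t 1 1 1 _ _.
    by move=> H; apply: (is_derive_eq (H _ _)); rewrite /GRing.scale/= mulr1 mulr_natl.
  split; first by apply: (@near_eq_derivable _ _ _ (fun s : R => s * s)); [apply: filterS e => s ->|].
  by rewrite (near_eq_derive _ e) derive_val.
- rewrite mulr0.
  have c : h^-1 *: (possq (h *: 1 + 0) - possq 0) @[h --> 0^'] --> (0 : R).
    apply/cvgrPdist_lt => e e0; exists e => // h /=; rewrite !sub0r !normrN => he h0.
    rewrite [possq 0]possq_le0// subr0 addr0 [h *: 1]mulr1.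
    have [hn|hp] := leP h 0; first by rewrite possq_le0// scaler0 normr0.
    by rewrite possq_ge0 ?(ltW hp)// /GRing.scale/= expr2 mulKf.
  by split; [apply/cvg_ex; exists 0|apply/cvg_lim].
Qed.

(** A composition of squared positive parts, hence of class C^1 with an explicit derivative; its
    monotonicity, [dstep_le0], gives the magnetic field the right sign around the holes. *)
Definition step (s : R) := possq (1 - possq (s - 1)).

Lemma step1 s : s <= 1 -> step s = 1.
Proof. by move=> s1; rewrite /step (@possq_le0 (s - 1)) ?subr_le0// subr0 possq_ge0 ?expr1n. Qed.

Lemma step0 s : 2 <= s -> step s = 0.
Proof.
move=> s2; rewrite /step (@possq_ge0 (s - 1)); last by lra.
by rewrite possq_le0//; nra.
Qed.

Lemma step_ge0 s : 0 <= step s. Proof. exact: sqr_ge0. Qed.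

Lemma step_le1 s : step s <= 1.
Proof.
rewrite /step; move: (sqr_ge0 (Num.max 0 (s - 1))); rewrite -/(possq (s - 1)).
move: (possq _) => y y0; rewrite /possq expr_le1//; last by rewrite le_max lexx.
by rewrite ge_max ler01; lra.
Qed.

Definition dstep (s : R) := - (4 * Num.max 0 (1 - possq (s - 1)) * Num.max 0 (s - 1)).

Lemma dstep_le0 s : dstep s <= 0.
Proof. by rewrite /dstep oppr_le0 !mulr_ge0// le_max lexx. Qed.

Lemma C1_step n (g : 'rV[R]_n -> R) : C1 g ->
  C1 (fun x => step (g x)) /\ forall j, pd j (fun x => step (g x)) = (fun x => dstep (g x) * pd j g x).
Proof.
move=> Cg.
have cm : continuous (fun t : R => 2 * Num.max 0 t).
  have -> : (fun t : R => 2 * Num.max 0 t) = (fun t => t + `|t|).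
    apply/funext => t; have [t0|t0] := leP t 0; first by rewrite ler0_norm// mulr0 subrr.
    by rewrite gtr0_norm//; ring.
  by move=> t; apply: cvgD; [exact: cvg_id|apply: cvg_norm; exact: cvg_id].
have [C0 p0] := C1_cst (-1) : C1 (fun _ : 'rV[R]_n => -1 : R) /\ _.
have [C1' p1] := C1D Cg C0.
have [C2 p2] := C1_comp C1' possq_derive cm.
have [C3 p3] := C1Z (-1) C2.
have [C4 p4] := C1_cst 1 : C1 (fun _ : 'rV[R]_n => 1 : R) /\ _.
have [C5 p5] := C1D C4 C3.
have [C6 p6] := C1_comp C5 possq_derive cm.
rewrite (_ : (fun x => step (g x)) = (fun x => possq (1 + -1 * possq (g x + -1)))); last first.
  by apply/funext => x; rewrite /step mulN1r.
split => // j; rewrite p6 p5 p4 p3 p2 p1 p0; apply/funext => x.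
by rewrite /dstep !mulN1r add0r addr0; move: (Num.max _ _) (Num.max _ _) (pd j g x) => ? ? ?; ring.
Qed.

End step.

Section omega.
Context {R : realType} {n : nat}.

Definition omega (x : 'rV[R]_n) : R := 1 + \sum_(i < n) x 0 i ^+ 2.

Lemma omega_ge1 x : 1 <= omega x.
Proof. by rewrite lerDl sumr_ge0// => i _; exact: sqr_ge0. Qed.

Lemma omega_coord (x : 'rV[R]_n) i : x 0 i ^+ 2 <= omega x.
Proof.
rewrite /omega (bigD1 i)//= addrCA lerDl addr_ge0// sumr_ge0// => j _; exact: sqr_ge0.
Qed.

Lemma omega_norm x (r : R) : omega x <= r -> `|x| <= r.
Proof.
move=> xr; have r1 := le_trans (omega_ge1 x) xr.
rewrite rV_normE ?(le_trans ler01)//; apply/forallP => i.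
have := le_trans (omega_coord x i) xr; rewrite ler_norml; nra.
Qed.

Lemma C1_omega : C1 omega /\ forall i, pd i omega = (fun x : 'rV[R]_n => 2 * x 0 i).
Proof.
have Cy2 (j : 'I_n) : C1 (fun x : 'rV[R]_n => x 0 j ^+ 2) /\ forall i, pd i (fun x => x 0 j ^+ 2) = (fun x : 'rV[R]_n => 2 * x 0 j * (j == i)%:R).
  have [C p] := @C1_coord R n j; have [C2 p2] := C1M C C.
  by split => // i; rewrite p2 p; apply/funext => x; ring.
have [C p] := C1_sum (index_enum 'I_n) (fun i => (Cy2 i).1).
have [C' p'] := @C1_cst R n 1; have [C2 p2] := C1D C' C; split => // i.
rewrite p2 p p'; apply/funext => x; rewrite add0r.
rewrite (bigD1 i)//= big1 ?addr0; last by move=> j ji; rewrite (Cy2 j).2 (negbTE ji) mulr0.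
by rewrite (Cy2 i).2 eqxx mulr1.
Qed.

End omega.

Section jacobian.
Context {R : realType} {n : nat}.
Implicit Types p q : 'rV[R]_n -> R.

Lemma RI_mulC p q : RI (fun x => p x * q x) = RI (fun x => q x * p x).
Proof. by apply: RI_ext => x; rewrite mulrC. Qed.

Local Opaque pd.

(** The Jacobian of two functions integrates to 0: integrate by parts twice and use the symmetry of
    the second derivatives of [q]. *)
Lemma RI_jacobian i j p q : C1 p -> C1 q -> C1 (pd i q) -> C1 (pd j q) -> bcs p ->
  RI (fun x => pd i q x * pd j p x) = RI (fun x => pd i p x * pd j q x).
Proof.
move=> Cp Cq Ci Cj bp; have cm := pd_comm Cq Ci Cj.
have i1 := integration_by_parts_rV i Cp Cj bp.
have i2 := integration_by_parts_rV j Cp Ci bp.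
rewrite cm in i1; rewrite (RI_mulC (pd i q)); apply: oppr_inj.
exact: (etrans (esym i2) i1).
Qed.

End jacobian.

(** * The magnetic field bounds the form from below *)

Section magnetic_bound.
Context {R : realType} {m : nat}.
Local Notation n := m.+2.
Local Notation E := ('rV[R]_n -> R[i]^o).
Variables (alpha V : 'rV[R]_n -> R).
Hypotheses (Calpha : C1 alpha) (cV : continuous V) (V0 : forall x, 0 <= V x).
Hypothesis field_bound : forall x, omega x <= pd ord0 alpha x + V x.
Implicit Types (u v : E).

(** With a single nonzero component, the field in the plane of coordinates 0 and n - 1 is
    [pd ord0 alpha]. *)
Definition potential (x : 'rV[R]_n) : 'rV[R]_n := \row_j (if j == ord_max then alpha x else 0).
Local Notation t := (tform potential V).

Lemma potential_C1 j : C1 (fun x => potential x 0 j).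
Proof.
have [e|e] := eqVneq j ord_max.
  by rewrite (_ : (fun x => _) = alpha)//; apply/funext => x; rewrite mxE e eqxx.
rewrite (_ : (fun x => _) = (fun=> 0)); first exact: (C1_cst 0).1.
by apply/funext => x; rewrite mxE (negbTE e).
Qed.

(* The right-hand side minus the left-hand side is the integral of |D_0 u - i D_1 u|^2. *)
Lemma pauli_bound (w p q p0 q0 p1 q1 : 'rV[R]_n -> R) : continuous w ->
  bcs p -> bcs q -> bcs p0 -> bcs q0 -> bcs p1 -> bcs q1 ->
  2 * (RI (fun x => q0 x * p1 x) - RI (fun x => p0 x * q1 x)) -
    RI (fun x => (2 * (p x * p0 x + q x * q0 x)) * w x) <=
  RI (fun x => p0 x * p0 x + q0 x * q0 x) +
  RI (fun x => (p1 x - w x * q x) * (p1 x - w x * q x) + (q1 x + w x * p x) * (q1 x + w x * p x)).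
Proof.
move=> cw bp bq bp0 bq0 bp1 bq1.
have b1 : bcs (fun x => p1 x - w x * q x) by apply: bcsB => //; exact: continuous_bcsM.
have b2 : bcs (fun x => q1 x + w x * p x) by apply: bcsD => //; exact: continuous_bcsM.
have b3 : bcs (fun x => q0 x * p1 x) by exact: bcsMb.
have b4 : bcs (fun x => p0 x * q1 x) by exact: bcsMb.
have b5 : bcs (fun x => (2 * (p x * p0 x + q x * q0 x)) * w x).
  by under eq_fun do rewrite mulrC; apply: continuous_bcsM => //; apply: bcsZ; apply: bcsD; exact: bcsMb.
have b6 : bcs (fun x => p0 x * p0 x + q0 x * q0 x) by apply: bcsD; exact: bcsMb.
have b7 : bcs (fun x => (p1 x - w x * q x) * (p1 x - w x * q x) + (q1 x + w x * p x) * (q1 x + w x * p x)).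
  by apply: bcsD; exact: bcsMb.
have b8 : bcs (fun x => q0 x * p1 x - p0 x * q1 x) by exact: bcsB.
have b9 : bcs (fun x => 2 * (q0 x * p1 x - p0 x * q1 x)) by exact: bcsZ.
rewrite -(RI_B b3 b4) -(RI_Z _ b8) -(RI_B b9 b5) -(RI_D b6 b7).
apply: RI_le; [exact: bcsB|exact: bcsD|] => x.
rewrite -subr_ge0 (_ : _ - _ = (p0 x + (q1 x + w x * p x)) ^+ 2 + (q0 x - (p1 x - w x * q x)) ^+ 2).
  by rewrite addr_ge0// sqr_ge0.
by ring.
Qed.

(** In [pauli_bound] the Jacobian part integrates to 0, and an integration by parts turns the rest
    into the integral of the field times |u|^2. Adding the electric term brings in [field_bound]. *)
Lemma tform_ge u : test_fun u ->
  RI (fun x => omega x * (re_fun u x * re_fun u x + im_fun u x * im_fun u x)) <= t u u.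
Proof.
move=> tu; have cu := test_fun_ccs tu; have [Cr Ci br bi] := cu.
have /test_funP[sr si _] := tu.
set p := re_fun u; set q := im_fun u.
have [CS pS] : C1 (fun x => p x * p x + q x * q x) /\ forall j, pd j (fun x => p x * p x + q x * q x) =
    (fun x => 2 * (p x * pd j p x + q x * pd j q x)).
  have [c1 e1] := C1M Cr Cr; have [c2 e2] := C1M Ci Ci; have [c3 e3] := C1D c1 c2.
  split => // j; rewrite e3 e1 e2; apply/funext => x.
  by move: (pd j _ x) (pd j _ x) => ? ?; ring.
have bS : bcs (fun x => p x * p x + q x * q x) by apply: bcsD; exact: bcsMb.
have bp j : bcs (pd j p) by exact: C1_pd_bcs.
have bq j : bcs (pd j q) by exact: C1_pd_bcs.
have bB : bcs (fun x => pd ord0 alpha x * (p x * p x + q x * q x)).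
  by apply: continuous_bcsM => //; exact: (Calpha.2 ord0).2.
have bV : bcs (fun x => V x * (p x * p x + q x * q x)) by exact: continuous_bcsM.
have bO : bcs (fun x => omega x * (p x * p x + q x * q x)).
  by apply: continuous_bcsM => //; exact: (C1_omega.1).1.
apply: (@le_trans _ _ (RI (fun x => pd ord0 alpha x * (p x * p x + q x * q x)) +
   RI (fun x => V x * (p x * p x + q x * q x)))).
  rewrite -(RI_D bB bV); apply: RI_le => //; first exact: bcsD.
  move=> x; rewrite -mulrDl; apply: ler_wpM2r; last exact: field_bound.
  by rewrite addr_ge0// -expr2 sqr_ge0.
rewrite /tform; apply: lerD; last first.
  rewrite /re_inner le_eqVlt; apply/orP; left; apply/eqP; apply: RI_ext => x.
  rewrite !re_rmul !im_rmul; have sq : Num.sqrt (V x) * Num.sqrt (V x) = V x by rewrite -expr2 sqr_sqrtr.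
  by rewrite -/p -/q; move: (Num.sqrt (V x)) sq => w <-; ring.
have g0 j : 0 <= re_inner (mgrad potential j u) (mgrad potential j u).
  by apply: RI_ge0 => x; rewrite addr_ge0// -expr2 sqr_ge0.
(* Only the two components in the plane of the field are kept; the others are nonnegative. *)
rewrite (bigD1 ord0)//= (bigD1 ord_max)//= addrA.
apply: (@le_trans _ _ (re_inner (mgrad potential ord0 u) (mgrad potential ord0 u) +
  re_inner (mgrad potential ord_max u) (mgrad potential ord_max u))); last first.
  by rewrite lerDl sumr_ge0.
have J : RI (fun x => pd ord0 q x * pd ord_max p x) = RI (fun x => pd ord0 p x * pd ord_max q x).
  exact: (RI_jacobian Cr Ci (smooth_C1 [:: ord0] si) (smooth_C1 [:: ord_max] si) br).
have iS := integration_by_parts_rV ord0 CS Calpha bS.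
have := pauli_bound Calpha.1 br bi (bp ord0) (bq ord0) (bp ord_max) (bq ord_max).
rewrite J subrr mulr0 add0r pS in iS *.
rewrite -iS /re_inner re_mgrad im_mgrad re_mgrad im_mgrad => H.
rewrite (RI_ext (g := fun x => (p x * p x + q x * q x) * pd ord0 alpha x)); last by move=> x; rewrite mulrC.
apply: le_trans H _; rewrite le_eqVlt; apply/orP; left; apply/eqP; congr (_ + _); apply: RI_ext => x.
  by rewrite mxE/= !mul0r subr0 addr0.
by rewrite mxE eqxx.
Qed.

Lemma tform_re_inner_le u : test_fun u -> re_inner u u <= t u u.
Proof.
move=> tu; apply: le_trans (tform_ge tu); have [Cr Ci br bi] := test_fun_ccs tu.
have bS : bcs (fun x => re_fun u x * re_fun u x + im_fun u x * im_fun u x) by apply: bcsD; exact: bcsMb.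
apply: RI_le => //; first by apply: continuous_bcsM => //; exact: (C1_omega.1).1.
move=> x; rewrite -[leLHS]mul1r; apply: ler_wpM2r; last exact: omega_ge1.
by rewrite addr_ge0// -expr2 sqr_ge0.
Qed.

End magnetic_bound.

Lemma cutoff_split (R : realType) (p q c w : R) : 1 <= w ->
  p * p + q * q <= (p * c) ^+ 2 + (q * c) ^+ 2 + w * (p * p + q * q).
Proof.
move=> w1; have S0 : 0 <= p * p + q * q by rewrite addr_ge0// -expr2 sqr_ge0.
apply: (@le_trans _ _ (w * (p * p + q * q))); last by rewrite lerDr addr_ge0// sqr_ge0.
by rewrite -[leLHS]mul1r; exact: ler_wpM2r.
Qed.

Lemma le_add_twice (R : realType) (x y z k b : R) : x <= y + k * b -> y <= k * b + z ->
  x <= 2 * k * b + z.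
Proof. lra. Qed.

(** * Compactness of the embedding of the form domain *)

Section magnetic_compactness.
Context {R : realType} {m : nat}.
Local Notation n := m.+2.
Local Notation E := ('rV[R]_n -> R[i]^o).
Variables (alpha V : 'rV[R]_n -> R).
Hypotheses (Calpha : C1 alpha) (cV : continuous V) (V0 : forall x, 0 <= V x).
Hypothesis field_bound : forall x, omega x <= pd ord0 alpha x + V x.
Implicit Types (u v : E).
Local Notation a := (potential alpha).
Local Notation t := (tform a V).

Lemma finite_bound (F : 'I_n -> 'rV[R]_n -> R) : (forall j, bcs (F j)) ->
  exists2 M, 0 <= M & forall j x, `|F j x| <= M.
Proof.
move=> bF; have /choice[M HM] : forall j, exists M : R, forall x, `|F j x| <= M by move=> j; case: (bF j).
exists (\sum_j `|M j|) => [|j x]; first exact: sumr_ge0.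
apply: le_trans (HM j x) _; apply: le_trans (ler_norm _) _.
by rewrite (bigD1 j)//= lerDl sumr_ge0.
Qed.

Lemma bcs_sqr2 (f g : 'rV[R]_n -> R) : bcs f -> bcs g -> bcs (fun x => f x * f x + g x * g x).
Proof. by move=> bf bg; apply: bcsD; exact: bcsMb. Qed.

Lemma sqr3_le (x y z : R) : (x + y + z) ^+ 2 <= 4 * x ^+ 2 + 4 * y ^+ 2 + 4 * z ^+ 2.
Proof.
rewrite -subr_ge0 (_ : _ - _ = (x - y) ^+ 2 + (y - z) ^+ 2 + (x - z) ^+ 2 + (x ^+ 2 + y ^+ 2 + z ^+ 2)); last by ring.
by rewrite !addr_ge0// sqr_ge0.
Qed.

(** On the support of [chi] the potential is bounded, so the ordinary gradient of chi u differs from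
    chi times the magnetic one by a bounded multiple of u, whose norm is itself bounded by the
    form. *)
Lemma cutoff_grad_le (chi : 'rV[R]_n -> R) : C1 chi -> bcs chi -> (forall x, 0 <= chi x <= 1) ->
  exists2 K : R, 0 < K & forall u, test_fun u ->
    grad2 (fun x => re_fun u x * chi x) + grad2 (fun x => im_fun u x * chi x) <= K * t u u.
Proof.
move=> Cchi bchi chi01.
have [M1 M10 HM1] := finite_bound (fun j => C1_pd_bcs j Cchi bchi).
have [|M2 M20 HM2] := finite_bound (F := fun j x => chi x * a x 0 j).
  by move=> j; apply: C1_bcsM => //; exact: potential_C1.
exists (4 + n%:R * (4 * M1 ^+ 2 + 4 * M2 ^+ 2)).
  by rewrite ltr_wpDr// mulr_ge0// addr_ge0// mulr_ge0// sqr_ge0.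
move=> u tu; have cu := test_fun_ccs tu; have [Cr Ci br bi] := cu.
have [C3 p3] := C1M Cr Cchi; have [C4 p4] := C1M Ci Cchi.
have b3 : bcs (fun x => re_fun u x * chi x) by exact: bcsMb.
have b4 : bcs (fun x => im_fun u x * chi x) by exact: bcsMb.
have bS := bcs_sqr2 br bi.
have key j : RI (fun x => pd j (fun x => re_fun u x * chi x) x ^+ 2) +
    RI (fun x => pd j (fun x => im_fun u x * chi x) x ^+ 2) <=
    4 * re_inner (mgrad a j u) (mgrad a j u) + (4 * M1 ^+ 2 + 4 * M2 ^+ 2) * re_inner u u.
  have [bg1 bg2] := mgrad_bcs (potential_C1 Calpha) j cu.
  have b5 : bcs (fun x => pd j (fun x => re_fun u x * chi x) x ^+ 2).
    by apply: bcsMb; exact: C1_pd_bcs.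
  have b6 : bcs (fun x => pd j (fun x => im_fun u x * chi x) x ^+ 2).
    by apply: bcsMb; exact: C1_pd_bcs.
  have b7 := bcs_sqr2 bg1 bg2.
  rewrite -(RI_D b5 b6) /re_inner -(RI_Z _ b7) -(RI_Z _ bS) -RI_D; [|exact: bcsZ..].
  apply: RI_le; [exact: bcsD|by apply: bcsD; exact: bcsZ|] => x.
  rewrite p3 p4 re_mgrad im_mgrad.
  have := HM1 j x; have := HM2 j x; have := chi01 x.
  move: (pd j (re_fun u) x) (pd j (im_fun u) x) (pd j chi x) (chi x) (a x 0 j) (re_fun u x) (im_fun u x).
  move=> p1 q1 c1 c w p q /andP[c0 cle] H2 H1.
  have c12 : c1 ^+ 2 <= M1 ^+ 2 by rewrite -(real_normK (num_real c1)) ler_pXn2r ?nnegrE.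
  have cw2 : (c * w) ^+ 2 <= M2 ^+ 2 by rewrite -(real_normK (num_real (c * w))) ler_pXn2r ?nnegrE.
  have c2 : c ^+ 2 <= 1 by rewrite expr_le1.
  (* Three terms: the magnetic derivative times [chi], the derivative of [chi], and the potential
     added back. *)
  have s1 : (p * c1 + c * p1) ^+ 2 <= 4 * ((p1 - w * q) * (p1 - w * q)) * c ^+ 2 + 4 * p ^+ 2 * c1 ^+ 2 + 4 * q ^+ 2 * (c * w) ^+ 2.
    have := sqr3_le (c * (p1 - w * q)) (p * c1) (q * (c * w)).
    by rewrite (_ : c * (p1 - w * q) + p * c1 + q * (c * w) = p * c1 + c * p1); last ring; rewrite !exprMn -!expr2; lra.
  have s2 : (q * c1 + c * q1) ^+ 2 <= 4 * ((q1 + w * p) * (q1 + w * p)) * c ^+ 2 + 4 * q ^+ 2 * c1 ^+ 2 + 4 * p ^+ 2 * (c * w) ^+ 2.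
    have := sqr3_le (c * (q1 + w * p)) (q * c1) (- p * (c * w)).
    by rewrite (_ : c * (q1 + w * p) + q * c1 + - p * (c * w) = q * c1 + c * q1); last ring; rewrite !exprMn sqrrN -!expr2; lra.
  have e1 : (p1 - w * q) * (p1 - w * q) * c ^+ 2 <= (p1 - w * q) * (p1 - w * q).
    by rewrite -[leRHS]mulr1; apply: ler_wpM2l => //; rewrite -expr2 sqr_ge0.
  have e2 : (q1 + w * p) * (q1 + w * p) * c ^+ 2 <= (q1 + w * p) * (q1 + w * p).
    by rewrite -[leRHS]mulr1; apply: ler_wpM2l => //; rewrite -expr2 sqr_ge0.
  have e3 : (p ^+ 2 + q ^+ 2) * c1 ^+ 2 <= (p ^+ 2 + q ^+ 2) * M1 ^+ 2.
    by apply: ler_wpM2l => //; rewrite addr_ge0// sqr_ge0.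
  have e4 : (p ^+ 2 + q ^+ 2) * (c * w) ^+ 2 <= (p ^+ 2 + q ^+ 2) * M2 ^+ 2.
    by apply: ler_wpM2l => //; rewrite addr_ge0// sqr_ge0.
  apply: le_trans (lerD s1 s2) _.
  rewrite !mulrDl -!expr2 in e3 e4 *; move: e1 e2; rewrite -!expr2; lra.
rewrite /grad2 -big_split/=; apply: le_trans (ler_sum _ (fun j _ => key j)) _.
rewrite big_split/= -mulr_sumr sumr_const card_ord [leRHS]mulrDl; apply: lerD.
  apply: ler_wpM2l => //; rewrite /tform lerDl; apply: RI_ge0 => x.
  by rewrite addr_ge0// -expr2 sqr_ge0.
rewrite -[leLHS]mulr_natl mulrA; apply: ler_wpM2l; last exact: tform_re_inner_le tu.
by rewrite mulr_ge0// addr_ge0// mulr_ge0// sqr_ge0.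
Qed.

(** Where k omega > 1 the form alone controls |u|^2, with the small factor k. The rest is seen by
    chi Re u and chi Im u, supported in a fixed ball, to which [rellich_bound] applies with the
    factor k / K. Each part costs half of [e]. *)
Lemma magnetic_rellich (e : R) : 0 < e -> exists2 b : seq E, forall x, x \in b -> L2 x &
  forall u, test_fun u -> re_inner u u <= e * t u u + \sum_(x <- b) re_inner u x ^+ 2.
Proof.
move=> e0; pose k := e / 2; have k0 : 0 < k by rewrite /k divr_gt0.
pose chi (x : 'rV[R]_n) := step (k * omega x).
have Cchi : C1 chi.
  have [Co _] := @C1_omega R n; have [Ck _] := C1Z k Co.
  exact: (C1_step Ck).1.
pose rho := 2 / k.
have rho0 : 0 <= rho by rewrite divr_ge0// ltW.
have chi0 x : rho < `|x| -> chi x = 0.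
  move=> xr; apply: step0; rewrite mulrC -ler_pdivrMr//.
  by rewrite leNgt; apply/negP => /ltW/omega_norm; rewrite leNgt xr.
have bchi : bcs chi by apply: continuous_bcs Cchi.1 _; exists rho.
have chi01 x : 0 <= chi x <= 1 by rewrite step_ge0 step_le1.
have [K K0 HK] := cutoff_grad_le Cchi bchi chi01.
have [|s bs Hs] := @rellich_bound R n rho (k / K) rho0; first exact: divr_gt0.
(* Pairing u with chi b and with i chi b yields the functionals of the cut-off real and imaginary
   parts. *)
pose B1 (b : 'rV[R]_n -> R) : E := fun x => (chi x * b x)%:C%C.
pose B2 (b : 'rV[R]_n -> R) : E := fun x => ((0 : R) +i* (chi x * b x))%C.
have bc0 : bcs (fun _ : 'rV[R]_n => 0 : R) by exact: bcs0.
exists (map B1 s ++ map B2 s).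
  move=> x; rewrite mem_cat => /orP[] /mapP[b /bs bb ->]; apply: bcs_L2 => //;
    by have := bcsMb bchi bb.
move=> u tu; have cu := test_fun_ccs tu; have [Cr Ci br bi] := cu.
have bS := bcs_sqr2 br bi.
have [C3 _] := C1M Cr Cchi; have [C4 _] := C1M Ci Cchi.
have b3 : bcs (fun x => re_fun u x * chi x) by exact: bcsMb.
have b4 : bcs (fun x => im_fun u x * chi x) by exact: bcsMb.
have H1 := Hs _ C3 b3 (fun x xr => etrans (congr1 _ (chi0 x xr)) (mulr0 _)).
have H2 := Hs _ C4 b4 (fun x xr => etrans (congr1 _ (chi0 x xr)) (mulr0 _)).
have b5 : bcs (fun x => (re_fun u x * chi x) ^+ 2) by exact: bcsMb.
have b6 : bcs (fun x => (im_fun u x * chi x) ^+ 2) by exact: bcsMb.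
have b7 : bcs (fun x => omega x * (re_fun u x * re_fun u x + im_fun u x * im_fun u x)).
  by apply: continuous_bcsM => //; exact: (@C1_omega R n).1.1.
have H3 : re_inner u u <= RI (fun x => (re_fun u x * chi x) ^+ 2) + RI (fun x => (im_fun u x * chi x) ^+ 2) +
    k * t u u.
  apply: (@le_trans _ _ (RI (fun x => (re_fun u x * chi x) ^+ 2) + RI (fun x => (im_fun u x * chi x) ^+ 2) +
     k * RI (fun x => omega x * (re_fun u x * re_fun u x + im_fun u x * im_fun u x)))); last first.
    rewrite lerD2l; apply: ler_wpM2l; first exact: ltW.
    exact: (tform_ge Calpha cV V0 field_bound tu).
  rewrite -(RI_D b5 b6) -(RI_Z _ b7) -RI_D; [|exact: bcsD|exact: bcsZ].
  apply: RI_le => //; first by apply: bcsD; [exact: bcsD|exact: bcsZ].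
  move=> x; have S0 : 0 <= re_fun u x * re_fun u x + im_fun u x * im_fun u x.
    by rewrite addr_ge0// -expr2 sqr_ge0.
  have o1 := omega_ge1 x; have /andP[c0 c1] := chi01 x.
  have [le|gt] := leP (k * omega x) 1; last first.
    by rewrite mulrA; exact: cutoff_split (ltW gt).
  have -> : chi x = 1 by exact: step1.
  rewrite !mulr1 !expr2 lerDl; apply: mulr_ge0; first exact: ltW.
  by apply: mulr_ge0 => //; exact: le_trans ler01 o1.
have g := HK u tu.
have E1 : RI (fun x => (re_fun u x * chi x) ^+ 2) + RI (fun x => (im_fun u x * chi x) ^+ 2) <=
   k * t u u + (\sum_(b <- s) RI (fun x => re_fun u x * chi x * b x) ^+ 2 +
                \sum_(b <- s) RI (fun x => im_fun u x * chi x * b x) ^+ 2).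
  apply: le_trans (lerD H1 H2) _; rewrite addrACA -mulrDr lerD2r.
  apply: le_trans (ler_wpM2l _ g) _; first by rewrite divr_ge0// ltW.
  by rewrite mulrA divfK// gt_eqF.
have E2 : \sum_(x <- map B1 s ++ map B2 s) re_inner u x ^+ 2 =
   \sum_(b <- s) RI (fun x => re_fun u x * chi x * b x) ^+ 2 +
                \sum_(b <- s) RI (fun x => im_fun u x * chi x * b x) ^+ 2.
  rewrite big_cat/= !big_map; congr (_ + _); apply: eq_bigr => b _; congr (_ ^+ 2); apply: RI_ext => x.
    by rewrite /B1 /re_fun /im_fun /=; ring.
  by rewrite /B2 /re_fun /im_fun /=; ring.
rewrite E2; have e2 : e = 2 * k by rewrite /k; field.
rewrite e2; exact: le_add_twice H3 E1.
Qed.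

Theorem potential_discrete : discrete_spectrum a V.
Proof.
apply: magnetic_discrete => //.
- exact: potential_C1.
- by move=> u tu; exact: tform_re_inner_le tu.
- exact: magnetic_rellich.
Qed.

End magnetic_compactness.

(** * A smooth bump function *)

Section flat_functions.
Context {R : realType}.

(** The powers of 1/s make the family stable under differentiation. *)
Definition flat_exp (k : nat) (s : R) : R := if 0 < s then (s^-1) ^+ k * expR (- s^-1) else 0.

(** From exp y >= y^(k+2) / (k+2)! at y = 1/s. The factor s^2 makes every member differentiable at 0
    with derivative 0. *)
Lemma flat_exp_bound k : exists2 C : R, 0 < C & forall s, `|flat_exp k s| <= C * s ^+ 2.
Proof.
exists (k.+2)`!%:R => [|s]; first by rewrite ltr0n fact_gt0.
rewrite /flat_exp; case: ifP => [s0|_]; last by rewrite normr0 mulr_ge0// sqr_ge0.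
have y0 : 0 < s^-1 by rewrite invr_gt0.
rewrite ger0_norm; last by apply: mulr_ge0; [apply: exprn_ge0; exact: ltW|exact: expR_ge0].
have := expR_ge1Dxn k.+1 (ltW y0) => H.
have f0 : (0 : R) < (k.+2)`!%:R by rewrite ltr0n fact_gt0.
rewrite expRN ler_pdivrMr ?expR_gt0//.
apply: (@le_trans _ _ ((k.+2)`!%:R * s ^+ 2 * (s^-1 ^+ k.+2 / (k.+2)`!%:R))); last first.
  apply: ler_wpM2l; first by rewrite mulr_ge0 ?sqr_ge0// ltW.
  by move: H; lra.
rewrite le_eqVlt; apply/orP; left; apply/eqP; rewrite !exprS.
by move: (s^-1 ^+ k) => a; field; rewrite !gt_eqF.
Qed.

Lemma flat_exp_derive k (s : R) :
  is_derive s 1 (flat_exp k) (- k%:R * flat_exp k.+1 s + flat_exp k.+2 s).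
Proof.
have [s0|s0|->] := ltgtP s 0.
- have e : {near s, flat_exp k =1 cst 0}.
    have : \forall x \near s, x < 0 by apply: lt_nbhsl.
    by apply: filterS => x x0; rewrite /flat_exp ltNge (ltW x0).
  rewrite [X in is_derive _ _ _ X](_ : _ = 0); last by rewrite /flat_exp !ltNge (ltW s0)/= mulr0 addr0.
  split; first by apply: (@near_eq_derivable _ _ _ (cst 0)); [apply: filterS e => x ->|exact: derivable_cst].
  by rewrite (near_eq_derive _ e) derive_cst.
- pose g (x : R) : R := (x^-1) ^+ k * expR (- x^-1).
  have e : {near s, flat_exp k =1 g}.
    have : \forall x \near s, 0 < x by apply: lt_nbhsr.
    by apply: filterS => x x0; rewrite /flat_exp x0.
  have sn : s != 0 by rewrite gt_eqF.
  have d1 : is_derive s 1 (fun x : R => x^-1) (- s ^- 2).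
    have := @is_deriveV R id s 1 1 sn (is_derive_id _ _).
    by move=> H; apply: (is_derive_eq H); rewrite /GRing.scale/= mulr1.
  have d2 : is_derive s 1 (fun x : R => expR (- x^-1)) (expR (- s^-1) * s ^- 2).
    have d3 : is_derive s 1 (fun x : R => - x^-1) (s ^- 2).
      by have := is_deriveN d1; rewrite opprK.
    exact: (is_derive1_comp (is_derive_expR _) d3).
  have d4 := is_deriveX k d1; rewrite exprfctE in d4.
  have d5 := is_deriveM d4 d2.
  have dg : is_derive s 1 g (- k%:R * flat_exp k.+1 s + flat_exp k.+2 s).
    apply: (is_derive_eq d5); rewrite /flat_exp s0 /GRing.scale/=.
    move: (expR _) => y; case: k {e g d4 d5} => [|k] /=; rewrite !exprS ?expr0; first by field.
    by move: (s^-1 ^+ k) => a; field.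
  split; first by apply: (@near_eq_derivable _ _ _ g); [apply: filterS e => x ->|].
  by rewrite (near_eq_derive _ e) derive_val.
- rewrite [X in is_derive _ _ _ X](_ : _ = 0); last by rewrite /flat_exp ltxx mulr0 addr0.
  have [C C0 HC] := flat_exp_bound k.
  have c : h^-1 *: (flat_exp k (h *: 1 + 0) - flat_exp k 0) @[h --> 0^'] --> (0 : R).
    apply/cvgrPdist_lt => e e0; exists (e / C) => [/=|h /=]; first by rewrite divr_gt0.
    rewrite !sub0r !normrN => he h0.
    rewrite [flat_exp k 0](_ : _ = 0); last by rewrite /flat_exp ltxx.
    rewrite subr0 addr0 [h *: 1]mulr1 normrM normfV.
    have hn : 0 < `|h| by rewrite normr_gt0.
    rewrite mulrC ltr_pdivrMr//; apply: le_lt_trans (HC h) _.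
    rewrite -(real_normK (num_real h)) expr2 mulrA ltr_pM2r//.
    by rewrite mulrC -ltr_pdivlMr.
  by split; [apply/cvg_ex; exists 0|apply/cvg_lim].
Qed.

End flat_functions.

Section flat_rV.
Context {R : realType} {n : nat}.

(** A class containing the bumps and closed under [pd]; derivatives of all orders then follow by
    induction on the list of directions. *)
Inductive flat_fun : ('rV[R]_n -> R) -> Prop :=
| flat_fun_exp k l b i : flat_fun (fun x => flat_exp k (l * x 0 i + b))
| flat_fun_cst c : flat_fun (fun=> c)
| flat_fun_add f g : flat_fun f -> flat_fun g -> flat_fun (fun x => f x + g x)
| flat_fun_mul f g : flat_fun f -> flat_fun g -> flat_fun (fun x => f x * g x).

Lemma flat_fun_C1 f : flat_fun f -> C1 f /\ forall j, flat_fun (pd j f).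
Proof.
elim=> {f} [k l b i|c|f g ff [Cf IHf] fg [Cg IHg]|f g ff [Cf IHf] fg [Cg IHg]].
- have [Ci pi_] := @C1_coord R n i; have [C1l pl] := C1Z l Ci.
  have [Cb pb] := @C1_cst R n b; have [CA pA] := C1D C1l Cb.
  have cc m : continuous (@flat_exp R m) by move=> t; exact: is_derive_cont1 (flat_exp_derive m t).
  have cd : continuous (fun s : R => - k%:R * flat_exp k.+1 s + flat_exp k.+2 s).
    move=> t; apply: cvgD; last exact: cc.
    apply: (@continuous_comp _ _ _ (flat_exp k.+1) (fun s : R => - k%:R * s)); first exact: cc.
    exact: mulrl_continuous.
  have [CF pF] := C1_comp CA (flat_exp_derive k) cd; split => // j.
  rewrite pF pA pl pi_ pb.
  apply: flat_fun_mul; last exact: flat_fun_cst.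
  apply: flat_fun_add; last exact: flat_fun_exp.
  by apply: flat_fun_mul; [exact: flat_fun_cst|exact: flat_fun_exp].
- by have [C p] := @C1_cst R n c; split => // j; rewrite p; exact: flat_fun_cst.
- by have [C p] := C1D Cf Cg; split => // j; rewrite p; exact: flat_fun_add.
- have [C p] := C1M Cf Cg; split => // j; rewrite p.
  by apply: flat_fun_add; exact: flat_fun_mul.
Qed.

Lemma flat_fun_smooth f : flat_fun f -> smooth_on setT f.
Proof.
move=> ff s x _; have : flat_fun (foldr pd f s).
  by elim: s => //= j s /flat_fun_C1[_]; exact.
by move=> /flat_fun_C1[[c d] _]; split; [exact: c|move=> j; case: ((d j).1 x)].
Qed.

Lemma flat_fun_prod (I : Type) (r : seq I) (F : I -> 'rV[R]_n -> R) :
  (forall i, flat_fun (F i)) -> flat_fun (fun x => \prod_(i <- r) F i x).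
Proof.
move=> fF; elim: r => [|i r IH].
  by under eq_fun do rewrite big_nil; exact: flat_fun_cst.
by under eq_fun do rewrite big_cons; exact: flat_fun_mul.
Qed.

Definition bump (x : 'rV[R]_n) : R :=
  \prod_(i < n) (flat_exp 0 (1 + x 0 i) * flat_exp 0 (1 - x 0 i)).

Lemma bump_flat (r : R) c : flat_fun (fun x => bump (r *: (x - c))).
Proof.
rewrite /bump; apply: flat_fun_prod => i.
apply: flat_fun_mul.
  rewrite (_ : (fun x => _) = (fun x : 'rV[R]_n => flat_exp 0 (r * x 0 i + (1 - r * c 0 i)))).
    exact: flat_fun_exp.
  by apply/funext => x; rewrite !mxE; congr flat_exp; ring.
rewrite (_ : (fun x => _) = (fun x : 'rV[R]_n => flat_exp 0 (- r * x 0 i + (1 + r * c 0 i)))).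
  exact: flat_fun_exp.
by apply/funext => x; rewrite !mxE; congr flat_exp; ring.
Qed.

Lemma bump_C1 : C1 bump.
Proof.
have := (flat_fun_C1 (bump_flat 1 0)).1; rewrite (_ : (fun x => _) = bump)//.
by apply/funext => x; rewrite scale1r subr0.
Qed.

Lemma bump0 x : 1 < `|x| -> bump x = 0.
Proof.
move=> x1; have [i xi] : exists i, 1 < `|x 0 i|.
  apply: contrapT => nex; move: x1; rewrite ltNge => /negP; apply.
  rewrite rV_normE//; apply/forallP => i; rewrite leNgt; apply/negP => xi; apply: nex; by exists i.
rewrite /bump (bigD1 i)//= [X in X * _](_ : _ = 0) ?mul0r// /flat_exp.
move: xi; have [x0|x0] := ler0P (x 0 i) => xi.
  by rewrite [0 < 1 + _]ltNge (_ : 1 + _ <= 0) ?mul0r//; lra.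
by rewrite [0 < 1 - _]ltNge (_ : 1 - _ <= 0) ?mulr0//; lra.
Qed.

Lemma bump_ge x : `|x| <= 1 / 2 -> (expR (- 2) ^+ 2) ^+ n <= bump x.
Proof.
move=> x1; rewrite /bump -[X in _ ^+ X]card_ord -prodr_const.
apply: ler_prod => i _; rewrite sqr_ge0/= expr2.
have f (s : R) : 1 / 2 <= s -> expR (- 2) <= flat_exp 0 s.
  move=> s1; have s0 : 0 < s by lra.
  rewrite /flat_exp s0 expr0 mul1r ler_expR lerN2 invf_ple ?posrE//; lra.
have := le_trans (rV_norm_coord x i) x1; rewrite ler_norml => /andP[? ?].
by apply: ler_pM; rewrite ?expR_ge0//; apply: f; lra.
Qed.

End flat_rV.

(** * The potentials *)

Section construction.
Context {R : realType} {m : nat}.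
Local Notation n := m.+2.
Implicit Types x : 'rV[R]_n.

(** The gaps between consecutive centers grow with k, so a cube of edge d <= k about the k-th center
    meets no other hole. Coordinate 0 of every center is 0, on which the sign in [weight_upto_prop]
    rests. *)
Definition center k : 'rV[R]_n := \row_j (if j == ord_max then (4 * k.+1 ^ 2)%:R else 0).

(* Every value 2^-m is taken infinitely often. *)
Definition radius (k : nat) : R := 2^-1 ^+ logn 2 k.+1.

Definition dist2 k x : R := \sum_(i < n) (x 0 i - center k 0 i) ^+ 2.

Definition hole k x : R := step (radius k ^- 2 * dist2 k x).

Definition weight_upto N x : R := \prod_(k < N) (1 - hole k x).

(** The infinite product of the factors 1 - hole k: by [weight_uptoE], those of index above |x|
    equal 1. *)
Definition weight x : R := weight_upto (Num.truncn `|x|).+1 x.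

Lemma radius_gt0 k : 0 < radius k. Proof. by rewrite exprn_gt0. Qed.

Lemma radius_le1 k : radius k <= 1.
Proof. by rewrite exprn_ile1//; lra. Qed.

Lemma hole_itv01 k x : 0 <= hole k x <= 1.
Proof. by rewrite step_ge0 step_le1. Qed.

Lemma hole0 k x : 2 * radius k ^+ 2 <= dist2 k x -> hole k x = 0.
Proof.
move=> H; apply: step0; rewrite mulrC ler_pdivlMr//.
by rewrite exprn_gt0// radius_gt0.
Qed.

Lemma hole1 k x : dist2 k x <= radius k ^+ 2 -> hole k x = 1.
Proof.
move=> H; apply: step1; rewrite mulrC ler_pdivrMr ?mul1r//.
by rewrite exprn_gt0// radius_gt0.
Qed.

Lemma hole0_coord k x i : 2 <= `|x 0 i - center k 0 i| -> hole k x = 0.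
Proof.
move=> H; apply: hole0.
apply: (@le_trans _ _ ((x 0 i - center k 0 i) ^+ 2)).
  rewrite -(real_normK (num_real (x 0 i - _))).
  have := radius_le1 k; have := radius_gt0 k; move: H; move: `|_| (radius k) => a b; nra.
by rewrite /dist2 (bigD1 i)//= lerDl sumr_ge0// => j _; exact: sqr_ge0.
Qed.

Lemma weight_uptoE N x : (Num.truncn `|x| < N)%N -> weight_upto N x = weight x.
Proof.
move=> xN; rewrite -(subnKC xN); elim: (N - _)%N => [|j IH]; first by rewrite addn0.
rewrite addnS -IH /weight_upto big_ord_recr /=; set k := (_ + j)%N.
rewrite (@hole0_coord k x ord_max) ?subr0 ?mulr1//.
rewrite mxE eqxx distrC.
have xk : `|x 0 ord_max| <= k%:R.
  apply: le_trans (rV_norm_coord x _) _; apply: le_trans (ltW (truncnS_gt `|x|)) _.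
  by rewrite ler_nat /k leq_addr.
have k2 : k%:R + 2 <= (4 * k.+1 ^ 2)%:R :> R.
  by rewrite natrM natrX -[k.+1%:R]natr1; have := ler0n R k; move: k%:R => a; nra.
have := ler_norm ((4 * k.+1 ^ 2)%:R - x 0 ord_max); have := ler_norm (x 0 ord_max).
by move: xk k2; move: (4 * k.+1 ^ 2)%:R => b; lra.
Qed.

Lemma C1_dist2 k : C1 (dist2 k) /\ forall i, pd i (dist2 k) = (fun x : 'rV[R]_n => 2 * (x 0 i - center k 0 i)).
Proof.
have Cy2 (j : 'I_n) : C1 (fun x : 'rV[R]_n => (x 0 j - center k 0 j) ^+ 2) /\
    forall i, pd i (fun x => (x 0 j - center k 0 j) ^+ 2) =
      (fun x : 'rV[R]_n => 2 * (x 0 j - center k 0 j) * (j == i)%:R).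
  have [C0 p0] := @C1_coord R n j; have [C' p'] := @C1_cst R n (- center k 0 j).
  have [C p] := C1D C0 C'; have [C2 p2] := C1M C C; split => // i; rewrite p2 p p0 p'.
  by apply/funext => x; ring.
have [C p] := C1_sum (index_enum 'I_n) (fun i => (Cy2 i).1).
split => // i; rewrite p; apply/funext => x.
rewrite (bigD1 i)//= big1 ?addr0; last by move=> j ji; rewrite (Cy2 j).2 (negbTE ji) mulr0.
by rewrite (Cy2 i).2 eqxx mulr1.
Qed.

(** A hole is a nonincreasing function of the distance to its center; of the derivative only this
    radial form and its sign are retained. *)
Lemma C1_hole k : C1 (hole k) /\
  forall i, exists2 b : 'rV[R]_n -> R, forall x, b x <= 0 & pd i (hole k) = (fun x => b x * (x 0 i - center k 0 i)).
Proof.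
have [Cd pdd] := C1_dist2 k; have [CZ pZ] := C1Z (radius k ^- 2) Cd.
have [C p] := C1_step CZ; split => // i.
exists (fun x => dstep (radius k ^- 2 * dist2 k x) * (radius k ^- 2 * 2)).
  by move=> x; rewrite mulr_le0_ge0 ?dstep_le0// mulr_ge0// invr_ge0 sqr_ge0.
by rewrite p pZ pdd; apply/funext => x; rewrite !mulrA.
Qed.

Lemma weight_upto_prop N : [/\ C1 (weight_upto N), forall x, 0 <= weight_upto N x <= 1 &
  forall x, 0 <= x 0 ord0 * pd ord0 (weight_upto N) x].
Proof.
elim: N => [|N [C IH1 IH2]].
  have e : weight_upto 0 = (fun=> 1) by apply/funext => x; rewrite /weight_upto big_ord0.
  have [C p] := @C1_cst R n 1.
  by rewrite e; split => // x; [rewrite ler01 lexx|rewrite p mulr0].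
have e : weight_upto N.+1 = (fun x => weight_upto N x * (1 + -1 * hole N x)).
  by apply/funext => x; rewrite /weight_upto big_ord_recr/= mulN1r.
have [Ch /(_ ord0)[b b0 pb]] := C1_hole N.
have [C1' p1] := @C1_cst R n 1; have [C2 p2] := C1Z (-1) Ch; have [C3 p3] := C1D C1' C2.
have [C4 p4] := C1M C C3; rewrite e; split => // x.
  by have := IH1 x; have := hole_itv01 N x; move: (weight_upto N x) (hole N x) => ? ?; nra.
rewrite p4 p3 p1 p2 pb.
have -> : center N 0 ord0 = 0 by rewrite mxE.
have := b0 x; have := hole_itv01 N x; have := IH1 x; have := IH2 x.
move: (weight_upto N x) (hole N x) (b x) (x 0 ord0) (pd ord0 (weight_upto N) x) => w h c y p H1 /andP[H2 H3] /andP[H4 H5] H6.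
(* The new factor contributes a nonnegative multiple of x_0^2, because [c] is at most 0 and the
   center has coordinate 0 equal to 0. *)
rewrite (_ : y * _ = w * (- c) * y ^+ 2 + (1 - h) * (y * p)); last by ring.
apply: addr_ge0; last by apply: mulr_ge0 => //; lra.
by apply: mulr_ge0; [apply: mulr_ge0 => //; lra|exact: sqr_ge0].
Qed.

Lemma weight_prop : [/\ C1 weight, forall x, 0 <= weight x <= 1 &
  forall x, 0 <= x 0 ord0 * pd ord0 weight x].
Proof.
have loc (r : R) x : `|x| < r -> weight x = weight_upto (Num.truncn r).+1 x.
  by move=> xr; rewrite weight_uptoE// ltnS; apply: le_truncn; exact: ltW.
split.
- apply: C1_local => r; exists (weight_upto (Num.truncn r).+1); last exact: loc.
  by have [] := weight_upto_prop (Num.truncn r).+1.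
- by move=> x; have [_ + _] := weight_upto_prop (Num.truncn `|x|).+1; apply.
- move=> x; have [_ _ /(_ x)] := weight_upto_prop (Num.truncn (`|x| + 1)).+1.
  rewrite /pd (@near_eq_derive _ _ _ weight (weight_upto (Num.truncn (`|x| + 1)).+1))//.
  have : \forall y \near x, `|y| < `|x| + 1.
    have := @norm_continuous _ _ x => /cvgrPdist_lt/(_ 1 ltr01).
    by apply: filterS => y /=; rewrite ltr_distlC => /andP[_ ->].
  by apply: filterS => y; exact: loc.
Qed.

(* The factor x_0 makes x_0 * pd 0 weight nonnegative, so that cutting off only
   adds to the magnetic field pd 0 alpha. *)
Definition alpha x : R := x 0 ord0 * omega x * weight x.

Definition electric x : R := omega x * (1 - weight x).

Lemma alpha_C1 : C1 alpha.
Proof.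
have [C1' _] := @C1_coord R n ord0; have [C2 _] := @C1_omega R n; have [C3 _] := C1M C1' C2.
have [Cw _ _] := weight_prop; exact: (C1M C3 Cw).1.
Qed.

Lemma electric_continuous : continuous electric.
Proof.
have [C2 _] := @C1_omega R n; have [Cw _ _] := weight_prop.
have [C0 _] := @C1_cst R n 1; have [C3 _] := C1Z (-1) Cw; have [C4 _] := C1D C0 C3.
have [C5 _] := C1M C2 C4; rewrite (_ : electric = (fun x => omega x * (1 + -1 * weight x))).
  exact: C5.1.
by apply/funext => x; rewrite /electric mulN1r.
Qed.

Lemma electric_ge0 x : 0 <= electric x.
Proof.
have [_ /(_ x)/andP[_ w1] _] := weight_prop.
by rewrite mulr_ge0 ?subr_ge0// (le_trans ler01)// omega_ge1.
Qed.

(** Of the three terms in the derivative of alpha, [omega * weight] completes the electric potential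
    to [omega]; the other two are nonnegative. *)
Lemma alpha_field_bound x : omega x <= pd ord0 alpha x + electric x.
Proof.
have [C1' p1] := @C1_coord R n ord0; have [C2 p2] := @C1_omega R n; have [C3 p3] := C1M C1' C2.
have [Cw /(_ x)/andP[w0 w1] /(_ x) wx] := weight_prop; have [_ p4] := C1M C3 Cw.
rewrite /alpha p4 p3 p2 p1 eqxx /electric.
have o1 := omega_ge1 x; move: w0 w1 wx o1.
move: (weight x) (omega x) (x 0 ord0) (pd ord0 weight x) => w o y p w0 w1 wx o1.
have H1 : 0 <= (y * p) * o by rewrite mulr_ge0//; lra.
have H2 : 0 <= w * y ^+ 2 by rewrite mulr_ge0// sqr_ge0.
rewrite /=; nra.
Qed.

Lemma construction_admissible : admissible (potential alpha) electric.
Proof.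
have Ca := potential_C1 alpha_C1.
have bK (K : set 'rV[R]_n) : compact K -> exists r : R, forall x, K x -> `|x| <= r.
  move=> /compact_bounded [M [_ HM]]; exists (M + 1) => x Kx.
  by apply: (HM (M + 1)) => //; rewrite ltrDl ltr01.
split; last exact: electric_ge0.
- split; first by move=> j; exact: C1_measurable.
  move=> K /bK[r Kr]; have [M HM] := C1_locally_bounded alpha_C1 r; exists M.
  apply: aeW => x Kx; have xM := HM x (Kr x Kx).
  rewrite rV_normE ?(le_trans _ xM)//; apply/forallP => j; rewrite mxE.
  by case: ifP => // _; rewrite normr0 (le_trans _ xM).
- have mE := continuous_measurable_rV electric_continuous.
  have lE := continuous_locally_bounded electric_continuous.
  split => // K cK; have [r Kr] := bK K cK.
  pose rho := Num.max r 0; have rho0 : 0 <= 2 * rho by rewrite mulr_ge0// le_max lexx orbT.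
  have mK : measurable K.
    rewrite -[K]setCK; apply: measurableC; apply: open_measurable_rV; apply: closed_openC.
    by apply: compact_closed cK; exact: norm_hausdorff.
  have ib := bcs_integrable (bcs_indic_cube (0 : 'rV[R]_n) mE lE rho0).
  have := integrableS measurableT mK (@subsetT _ K) ib.
  apply: eq_integrable => // x /set_mem Kx /=.
  rewrite indicE mem_set ?mul1r// cubeE//= subr0 (_ : 2 * rho / 2 = rho); last by field.
  by apply: le_trans (Kr x Kx) _; rewrite le_max lexx.
Qed.

End construction.

(** * Failure of the energy condition *)

Section local_energy_bound.
Context {R : realType}.

Lemma cube_interior n (c x : 'rV[R]_n) d : `|x - c| < d / 2 -> (cube c d)° x.
Proof.
move=> xd; have e0 : 0 < d / 2 - `|x - c| by lra.
have d0 : 0 <= d by have := normr_ge0 (x - c); lra.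
have := @nbhs_ball_norm R 'rV[R]_n x (PosNum e0).
apply: filterS => y /= xy; rewrite cubeE//=.
by have := ler_distD x y c; rewrite (distrC y x); lra.
Qed.

Lemma sub_cube_interior n (c : 'rV[R]_n) s d : 0 <= s -> s < d -> cube c s `<=` (cube c d)°.
Proof. by move=> s0 sd x; rewrite cubeE//= => xs; apply: cube_interior; lra. Qed.

Lemma is_derive_dilation n (f : 'rV[R]_n -> R) (r : R) c j : C1 f ->
  pd j (fun x => f (r *: (x - c))) = (fun x => r * pd j f (r *: (x - c))).
Proof.
move=> Cf; apply/funext => x; apply: pd_derive; apply/is_derive_line0.
have /is_derive_line0 := is_derive_scale j (r *: (x - c)) r Cf.
rewrite (_ : (fun s : R => f (r *: (x - c) + s *: (r *: delta_mx 0 j))) =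
  (fun s => f (r *: (x + s *: delta_mx 0 j - c))))//.
apply/funext => s; congr f; apply/rowP => i; rewrite !mxE; ring.
Qed.

Context {m : nat}.
Local Notation n := m.+2.
Local Notation E := ('rV[R]_n -> R[i]^o).

Lemma weight0 k (x : 'rV[R]_n) : hole k x = 1 -> weight x = 0.
Proof.
move=> hk; rewrite -(@weight_uptoE _ _ (maxn (Num.truncn `|x|) k).+1); last by rewrite ltnS leq_maxl.
have kN : (k < (maxn (Num.truncn `|x|) k).+1)%N by rewrite ltnS leq_maxr.
by rewrite /weight_upto (bigD1 (Ordinal kN))//= hk subrr mul0r.
Qed.

Lemma local_energy_ge0 (a : 'rV[R]_n -> 'rV[R]_n) c d : (0 <= local_energy a c d)%E.
Proof.
apply: le_ereal_inf_tmp => _ [u _ <-]; apply: mule_ge0.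
  by apply: integral_ge0 => x _; rewrite lee_fin sumr_ge0// => j _; rewrite addr_ge0 ?sqr_ge0.
rewrite lee_fin invr_ge0; apply: fine_ge0; apply: integral_ge0 => x _.
by rewrite lee_fin addr_ge0 ?sqr_ge0.
Qed.

(** A rescaled bump is supported where [alpha] vanishes, so its magnetic gradient is the ordinary
    one and scaling gives a multiple of [radius k ^- 2]. The constant depends on neither d nor k. *)
Lemma local_energy_le : exists2 C : R, 0 < C & forall d k, 0 < d -> radius k <= d ->
  (local_energy (potential alpha) (center k : 'rV[R]_n) d <= (C * radius k ^- 2)%:E)%E.
Proof.
have bb : bcs (@bump R n) by apply: continuous_bcs bump_C1.1 _; exists 1; exact: bump0.
have /choice[Mf HM] : forall j, exists M : R, forall x, `|pd j (@bump R n) x| <= M.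
  by move=> j; case: (C1_pd_bcs j bump_C1 bb).
pose M := \sum_j `|Mf j|.
have M0 : 0 <= M by exact: sumr_ge0.
have {}HM j x : `|pd j (@bump R n) x| <= M.
  apply: le_trans (HM j x) _; apply: le_trans (ler_norm _) _.
  by rewrite /M (bigD1 j)//= lerDl sumr_ge0.
pose b0 : R := (expR (- 2) ^+ 2) ^+ n.
have b00 : 0 < b0 by rewrite !exprn_gt0// expR_gt0.
have n0 : (0 : R) < 2 * n%:R by rewrite mulr_gt0// ltr0n.
exists (n%:R * (M ^+ 2 + 1) * 2 ^+ n / b0 ^+ 2 * (2 * n%:R) ^+ 2) => [|d k d0 kd].
  have M1 : 0 < M ^+ 2 + 1 by rewrite ltr_wpDl ?sqr_ge0.
  by do !apply: mulr_gt0 => //; rewrite ?invr_gt0 ?exprn_gt0 ?ltr0n.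
(* Dividing by 2 n fits the ball of radius [r] in the maximum norm into the Euclidean ball where the
   hole equals 1. *)
set c : 'rV[R]_n := center k; pose r : R := radius k / (2 * n%:R).
have k0 := @radius_gt0 R k.
have r0 : 0 < r by rewrite divr_gt0.
have nr : 2 * n%:R * r = radius k by rewrite /r mulrC divfK// gt_eqF.
clearbody r.
have n1 : (1 : R) <= n%:R by rewrite ler1n.
have rk : 2 * r <= radius k by rewrite -nr; nra.
pose b x := @bump R n (r^-1 *: (x - c)).
pose u : E := fun x => (b x)%:C%C.
have ru : re_fun u = b by [].
have iu : im_fun u = (fun=> 0) by [].
have [Cb _] := flat_fun_C1 (@bump_flat R n r^-1 c).
have out x : r < `|x - c| -> 1 < `|r^-1 *: (x - c)|.
  by move=> xr; rewrite normrZ gtr0_norm ?invr_gt0// mulrC ltr_pdivlMr ?mul1r.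
have bout x : r < `|x - c| -> b x = 0 by move=> /out/bump0.
have ab x : alpha x * b x = 0.
  have [xr|xr] := leP `|x - c| r; last by rewrite bout ?mulr0.
  rewrite /alpha (@weight0 k x) ?mulr0 ?mul0r//; apply: hole1.
  apply: (@le_trans _ _ (\sum_(i < n) r ^+ 2)).
    apply: ler_sum => i _; have := le_trans (rV_norm_coord (x - c) i) xr.
    by rewrite !mxE ler_norml -/c; move: (_ - _) => y; nra.
  have -> : \sum_(i < n) r ^+ 2 = n%:R * r ^+ 2 by rewrite sumr_const card_ord mulr_natl.
  rewrite -nr [leRHS]exprMn; apply: ler_wpM2r; first exact: sqr_ge0.
  by nra.
have pdb j x : pd j b x = r^-1 * pd j (@bump R n) (r^-1 *: (x - c)).
  exact: (congr1 (fun f => f x) (is_derive_dilation r^-1 c j (@bump_C1 R n))).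
have gradE j x : sqmod (mgrad (potential alpha) j u x) = pd j b x ^+ 2.
  have e1 := congr1 (fun f => f x) (re_mgrad (potential alpha) j u).
  have e2 := congr1 (fun f => f x) (im_mgrad (potential alpha) j u).
  rewrite /sqmod -[complex.Re _]/(re_fun (mgrad (potential alpha) j u) x) e1.
  rewrite -[complex.Im _]/(im_fun (mgrad (potential alpha) j u) x) e2.
  rewrite iu ru (C1_cst 0).2 mulr0 subr0 add0r mxE; case: ifP => _; last by rewrite mul0r expr0n addr0.
  by rewrite ab expr0n addr0.
have u2 x : sqmod (u x) = b x ^+ 2 by rewrite /sqmod/= expr0n addr0.
have bbs : bcs b.
  apply: continuous_bcs Cb.1 _; exists (r + `|c|) => x xr; apply: bout.
  by have := ler_normB (x - c) (- c); rewrite opprK subrK normrN; lra.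
have rle : 0 <= 2 * r by rewrite mulr_ge0// ltW.
pose W := (cube c d)°.
have mW : measurable W by apply: open_measurable_rV; exact: open_interior.
have bg : bcs (fun x => \sum_(j < n) pd j b x ^+ 2).
  by apply: bcs_sum => j; apply: bcsMb; exact: C1_pd_bcs.
have num : (\int[lebesgue_rV n]_(x in W) (\sum_(j < n) sqmod (mgrad (potential alpha) j u x))%:E
    <= (n%:R * (M ^+ 2 + 1) * r ^- 2 * (2 * r) ^+ n)%:E)%E.
  under eq_integral => x _ do (under eq_bigr => j _ do rewrite gradE).
  apply: (@le_trans _ _ (\int[lebesgue_rV n]_x (\sum_(j < n) pd j b x ^+ 2)%:E)%E).
    apply: ge0_subset_integral => //; first by apply/measurable_EFinP; exact: bcs_measurable.
    by move=> x _; rewrite lee_fin sumr_ge0// => j _; exact: sqr_ge0.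
  rewrite -RI_EFin// lee_fin -(RI_indic_cube c rle) -RI_Z; last exact: bcs_indic.
  apply: RI_le => // [|x]; first by apply: bcsZ; exact: bcs_indic.
  apply: (@le_trans _ _ (\sum_(j < n) (M ^+ 2 + 1) * (r ^- 2 * \1_(cube c (2 * r)) x))); last first.
    by rewrite sumr_const card_ord -[leLHS]mulr_natl -!mulrA.
  apply: ler_sum => j _; rewrite pdb indicE; have [xc|xc] := boolP (x \in cube c (2 * r)).
    rewrite mulr1 exprMn exprVn mulrC; apply: ler_wpM2r; first by rewrite invr_ge0 sqr_ge0.
    rewrite -(real_normK (num_real _)); apply: (@le_trans _ _ (M ^+ 2)); last by rewrite lerDl.
    by rewrite ler_pXn2r ?nnegrE.
  rewrite (@pd_support _ _ j (@bump R n) 1); [|exact: bump0|].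
    by rewrite !mulr0 expr0n.
  apply: out; rewrite ltNge; apply: contra xc => xr; rewrite inE cubeE//=.
  by apply: le_trans xr _; rewrite mulrC mulKf.
have bb2 : bcs (fun x => b x ^+ 2) by exact: bcsMb.
have denT : (sqnorm_on W u <= (RI (fun x => b x ^+ 2))%:E)%E.
  rewrite RI_EFin// /sqnorm_on; under eq_integral => x _ do rewrite u2.
  apply: ge0_subset_integral => //; first by apply/measurable_EFinP; exact: bcs_measurable.
  by move=> x _; rewrite lee_fin sqr_ge0.
have den : b0 ^+ 2 * r ^+ n <= fine (sqnorm_on W u).
  have s0 : (0 <= sqnorm_on W u)%E by apply: integral_ge0 => x _; rewrite lee_fin u2 sqr_ge0.
  rewrite -lee_fin fineK; last by rewrite ge0_fin_numE//; apply: le_lt_trans denT (ltry _).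
  rewrite -(RI_indic_cube c (ltW r0)) -RI_Z; last by apply: bcs_indic; exact: ltW.
  rewrite RI_EFin; last by apply: bcsZ; apply: bcs_indic; exact: ltW.
  apply: (@le_trans _ _ (\int[lebesgue_rV n]_(x in cube c r) (b x ^+ 2)%:E)%E).
    rewrite [leRHS]integral_mkcond; apply: ge0_le_integral => //.
    - by move=> x _; rewrite lee_fin mulr_ge0// sqr_ge0.
    - by apply/measurable_EFinP; apply: bcs_measurable; apply: bcsZ; apply: bcs_indic; exact: ltW.
    - apply/(measurable_restrictT _ _).1; first exact: measurable_cube.
      by apply/measurable_EFinP; apply: measurable_funTS; exact: bcs_measurable bb2.
    - move=> x _; rewrite patchE indicE; case: ifP => xc; last by rewrite mulr0.
      have bx : b0 <= b x.
        apply: bump_ge; have := set_mem xc; rewrite cubeE ?(ltW r0)//= => xr.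
        by rewrite normrZ gtr0_norm ?invr_gt0// mulrC ler_pdivrMr// mulrC; move: xr; lra.
      by rewrite mulr1 lee_fin ler_pXn2r ?nnegrE ?(ltW b00)// (le_trans (ltW b00)).
  rewrite /sqnorm_on; under [in leRHS]eq_integral => x _ do rewrite u2.
  apply: ge0_subset_integral => //.
  - exact: measurable_cube.
  - by apply/measurable_EFinP; apply: measurable_funTS; exact: bcs_measurable bb2.
  - by move=> x _; rewrite lee_fin sqr_ge0.
  - by apply: sub_cube_interior; [exact: ltW|lra].
have den0 : 0 < b0 ^+ 2 * r ^+ n by rewrite mulr_gt0// exprn_gt0.
apply: (@le_trans _ _ ((\int[lebesgue_rV n]_(x in W) (\sum_(j < n) sqmod (mgrad (potential alpha) j u x))%:E
          * ((fine (sqnorm_on W u))^-1)%:E)%E)).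
  apply: ereal_inf_lbound; exists u => //; split.
  - have sb := flat_fun_smooth (@bump_flat R n r^-1 c).
    split; first by move=> s x _; exact: sb.
    by move=> s x _; exact: smooth_cst0.
  - split; [apply: measurable_funTS; exact: bcs_measurable bbs|rewrite iu; exact: measurable_cst|].
    exact: le_lt_trans denT (ltry _).
  - exists c; first by apply: cube_interior; rewrite subrr normr0 divr_gt0.
    apply/eqP => /(congr1 (@complex.Re R)) /=; rewrite /b subrr scaler0.
    have := @bump_ge R n 0; rewrite normr0 => /(_ _) => H; apply/eqP; rewrite gt_eqF//.
    by apply: lt_le_trans b00 (H _); lra.
apply: (@le_trans _ _ ((n%:R * (M ^+ 2 + 1) * r ^- 2 * (2 * r) ^+ n)%:E * ((b0 ^+ 2 * r ^+ n)^-1)%:E)%E).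
  apply: lee_pmul => //.
  - by apply: integral_ge0 => x _; rewrite lee_fin sumr_ge0// => j _; rewrite addr_ge0 ?sqr_ge0.
  - by rewrite lee_fin invr_ge0; apply: le_trans den; exact: ltW.
  - by rewrite lee_fin lef_pV2 ?posrE//; exact: lt_le_trans den0 den.
rewrite -EFinM lee_fin le_eqVlt; apply/orP; left; apply/eqP.
rewrite -nr [(2 * r) ^+ n]exprMn; have : r ^+ n != 0 by rewrite expf_neq0// gt_eqF.
have : 2 * n%:R != 0 :> R by rewrite gt_eqF.
have : r != 0 by rewrite gt_eqF.
have : b0 != 0 by rewrite gt_eqF.
move: (2 * n%:R) (r ^+ n) (2 ^+ n) => N X Y b0' r0' N0 X0; move: n%:R => nn.
by field; rewrite b0' r0' N0 X0.
Qed.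

(** The set removed is the cube of half-edge [s], outside of which hole k vanishes. The other holes
    do not meet Q_d, so [electric] is 0 on what remains. *)
Lemma molchanov_le0 (gamma : R) k d s : 2 * radius k <= s -> 2 * s <= d -> d <= k%:R ->
  (cap_in_cube (center k : 'rV[R]_n) d (cube (center k) (2 * s)) <=
   gamma%:E * cap_in_cube (center k : 'rV[R]_n) d (cube (center k) d))%E ->
  (molchanov gamma (center k : 'rV[R]_n) d electric <= 0)%E.
Proof.
move=> ks sd dk cap; set c := center k.
have k0 := @radius_gt0 R k; have s0 : 0 < s by lra.
have s20 : 0 <= 2 * s by rewrite mulr_ge0// ltW.
have d0 : 0 <= d by lra.
have V0 x : (cube c d `\` cube c (2 * s)) x -> electric x = 0.
  move=> [xd xs]; rewrite /electric (_ : weight x = 1) ?subrr ?mulr0//.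
  rewrite /weight /weight_upto big1// => -[j jN] _ /=.
  (* Along the axis two centers j and k differ by at least 4 (2 k + 1), which exceeds d/2 + 2 since
     d <= k. *)
  have [->|jk] := eqVneq j k; last first.
    rewrite (@hole0_coord _ _ j x ord_max) ?subr0//.
    have := xd ord_max; rewrite /c !mxE eqxx !natrM.
    have kk : k.+1%:R = k%:R + 1 :> R by rewrite natr1.
    move: jk; rewrite neq_ltn => /orP[] jk.
      have jR : j.+1%:R <= k%:R :> R by rewrite ler_nat.
      have j0 := ler0n R j.+1; have kn := ler0n R k.
      have sq : j.+1%:R * j.+1%:R <= k%:R * k%:R :> R by rewrite ler_pM.
      rewrite kk ler_norml => /andP[x1 x2]; apply: le_trans (ler_norm _).
      by move: sq x1 dk; move: (j.+1%:R * j.+1%:R) k%:R kn => a b; nra.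
    have jR : k%:R + 2 <= j.+1%:R :> R by rewrite -natrD ler_nat addn2 ltnS.
    have kn := ler0n R k.
    have sq : (k%:R + 2) * (k%:R + 2) <= j.+1%:R * j.+1%:R :> R by rewrite ler_pM// addr_ge0.
    rewrite kk ler_norml => /andP[x1 x2]; rewrite distrC; apply: le_trans (ler_norm _).
    by move: sq x2 dk; move: (j.+1%:R * j.+1%:R) k%:R kn => a b; nra.
  rewrite hole0 ?subr0//; have [i xi] : exists i, s < `|x 0 i - c 0 i|.
    apply: contrapT => nex; apply: xs => i; rewrite leNgt; apply/negP => xi; apply: nex; exists i.
    by move: xi; rewrite (_ : 2 * s / 2 = s)//; field.
  apply: (@le_trans _ _ ((x 0 i - c 0 i) ^+ 2)); last first.
    by rewrite /dist2 (bigD1 i)//= lerDl sumr_ge0// => l _; exact: sqr_ge0.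
  rewrite -(real_normK (num_real (x 0 i - _))).
  by move: xi ks k0; move: `|_| (radius k) => y e; nra.
apply: (@le_trans _ _ (\int[lebesgue_rV n]_(x in cube c d `\` cube c (2 * s)) (electric x)%:E)%E).
  apply: ereal_inf_lbound; exists (cube c (2 * s)) => //; split=> //; first exact: cube_compact.
  by move=> x xs i; apply: le_trans (xs i) _; lra.
by rewrite (eq_integral (cst 0%E)) ?integral0// => x /set_mem/V0 ->.
Qed.

End local_energy_bound.

Section counterexample.
Context {R : realType} {m : nat}.
Local Notation n := m.+2.

(** [16 ^+ N] is, up to constants, the inverse square of the half-edge: this is the scale at which
    [profile] matches the capacity. In dimension 2 the logarithm comes from averaging N+1 cut-offs;
    in higher dimension one cut-off is enough. *)
Lemma cap_profile (d S : R) : 0 < d -> 0 < S -> exists2 C : R, 0 < C & forall N (c : 'rV[R]_n),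
  (cap_in_cube c d (cube c (2 * (d / 4 / 4 ^+ N))) <= (C * profile n (S * 16 ^+ N))%:E)%E.
Proof.
move=> d0 S0; have d40 : 0 < d / 4 by lra.
rewrite /cap_in_cube /profile; case: eqP => [[m0]|nm].
  subst m; have S1 : 1 <= 1 + S by lra.
  have L0 : 0 <= ln (1 + S) by exact: ln_ge0.
  have [L [L16 lnE]] : exists L : R, 0 <= L /\ forall N, ln (16 ^+ N) = N%:R * L.
    exists (ln 16); split; first by apply: ln_ge0; lra.
    by move=> N; rewrite lnXn// mulr_natl.
  exists (96 * (1 + ln (1 + S) + L)) => [|N c]; first by lra.
  apply: le_trans (@capacity_le R 2 (cube c (2 * d))° c (d / 4) N d40 _) _.
    apply: sub_cube_interior; lra.
  rewrite lee_fin.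
  have p0 i : (0 : R) < 4 ^+ i by rewrite exprn_gt0.
  (* In dimension 2 all scales carry the same energy. *)
  rewrite (eq_bigr (fun=> 16)) => [|i _]; last first.
    by have := p0 i; move: (4 ^+ i) => x x0; field; rewrite !gt_eqF.
  rewrite sumr_const card_ord -[_ *+ N.+1]mulr_natr.
  set T := S * 16 ^+ N.
  have T0 : 0 < T by rewrite mulr_gt0// exprn_gt0.
  have N0 : (0 : R) < N.+1%:R by [].
  have lT : 0 <= ln (1 + T) by apply: ln_ge0; lra.
  (* The logarithm of [1 + T] grows at most linearly in N, like the number of cut-offs. *)
  have lnT : 1 + ln (1 + T) <= (1 + ln (1 + S) + L) * N.+1%:R.
    have e16 : (1 : R) <= 16 ^+ N by rewrite exprn_ege1//; lra.
    have : ln (1 + T) <= ln ((1 + S) * 16 ^+ N).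
      have T1 : 0 < 1 + T by lra.
      have P1 : 0 < (1 + S) * 16 ^+ N by rewrite mulr_gt0 ?exprn_gt0//; lra.
      by rewrite ler_ln ?posrE// /T; move: e16; move: (16 ^+ N) => a; lra.
    rewrite lnM ?posrE ?exprn_gt0//; last by lra.
    rewrite lnE -[N.+1%:R]natr1; have := ler0n R N; move: N%:R => a.
    move: (ln (1 + T)) (ln (1 + S)) L0 => x y y0 a0 H.
    by have := mulr_ge0 y0 a0; have := mulr_ge0 L16 a0; move: H; lra.
  rewrite (_ : _ * (3 * _) = 96 / N.+1%:R); last by field; rewrite gt_eqF.
  rewrite -[leRHS]mulrA; apply: ler_wpM2l => //.
  have lT1 : 0 < 1 + ln (1 + T) by move: lT; move: (ln (1 + T)) => x; lra.
  move: lnT lT1 N0; move: (1 + ln (1 + T)) (1 + ln (1 + S) + L) N.+1%:R => x y z xyz x0 z0.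
  by rewrite ler_pdivlMr// mulrC ler_pdivrMr.
(* Chosen so that [1 + T <= (b * 4 ^+ N) ^+ 2]. *)
pose b := Num.sqrt (1 + S).
have b0 : 0 < b by rewrite sqrtr_gt0; lra.
have b2 : b ^+ 2 = 1 + S by rewrite sqr_sqrtr//; lra.
exists (n%:R * (3 * 4 ^+ n) * (d / 4) ^+ m * b ^+ m) => [|N c].
  apply: mulr_gt0; last exact: exprn_gt0.
  apply: mulr_gt0; last exact: exprn_gt0.
  by apply: mulr_gt0; [exact: ltr0Sn|apply: mulr_gt0; [by []|exact: exprn_gt0]].
have p0 : (0 : R) < 4 ^+ N by rewrite exprn_gt0.
have r0 : 0 < d / 4 / 4 ^+ N by rewrite divr_gt0.
(* A single cut-off, at the scale of the small cube itself. *)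
have := @capacity_le R n setT c (d / 4 / 4 ^+ N) 0 r0 (@subsetT _ _).
set r := d / 4 / 4 ^+ N; have rn : r != 0 by rewrite gt_eqF.
have -> : n%:R * (3 * (1%:R ^- 2 * \sum_(i < 1) (4 ^+ i / r) ^+ 2 * (4 * (r / 4 ^+ i)) ^+ n)) =
    n%:R * (3 * 4 ^+ n) * r ^+ m.
  rewrite big_ord1 !expr0 !divr1 [(4 * r) ^+ n]exprMn [r ^+ n]exprS [r ^+ m.+1]exprS.
  by move: (r ^+ m) (4 ^+ n) n%:R => x y z; field.
rewrite expr0 divr1 => /le_trans; apply; rewrite lee_fin.
set T := S * 16 ^+ N.
have T0 : 0 < T by rewrite mulr_gt0// exprn_gt0.
have pT : ((b * 4 ^+ N) ^+ m)^-1 <= (1 + T) `^ ((2 - n%:R) / 2).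
  rewrite (_ : (2 - n%:R) / 2 = - (m%:R / 2)); last first.
    by rewrite -addn2 natrD; field.
  rewrite powRN lef_pV2 ?posrE ?exprn_gt0 ?mulr_gt0 ?powR_gt0//; last by lra.
  have -> : (b * 4 ^+ N) ^+ m = ((b * 4 ^+ N) ^+ 2) `^ (m%:R / 2).
    rewrite -(@powR_mulrn _ _ 2) ?mulr_ge0 ?(ltW b0) ?(ltW p0)// -powRrM.
    by rewrite (_ : 2%:R * (m%:R / 2) = m%:R :> R); [rewrite powR_mulrn// mulr_ge0 ?(ltW b0) ?(ltW p0)|field].
  apply: ge0_ler_powR; rewrite ?nnegrE ?divr_ge0 ?sqr_ge0//; first by lra.
  rewrite exprMn b2 -exprM mulnC exprM (_ : 4 ^+ 2 = 16 :> R); last by lra.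
  have : (1 : R) <= 16 ^+ N by rewrite exprn_ege1//; lra.
  by rewrite /T; lra.
have bm : b ^+ m != 0 by rewrite expf_neq0// gt_eqF.
have pm : (4 ^+ N) ^+ m != 0 :> R by rewrite expf_neq0// gt_eqF.
have -> : n%:R * (3 * 4 ^+ n) * r ^+ m =
    n%:R * (3 * 4 ^+ n) * (d / 4) ^+ m * b ^+ m * ((b * 4 ^+ N) ^+ m)^-1.
  have -> : (d / 4) ^+ m = r ^+ m * (4 ^+ N) ^+ m by rewrite -exprMn /r divfK// gt_eqF.
  rewrite [(b * 4 ^+ N) ^+ m]exprMn; move: bm pm; move: (r ^+ m) (b ^+ m) ((4 ^+ N) ^+ m) (4 ^+ n) n%:R => x y z w v h1 h2.
  by field; rewrite h1 h2.
apply: ler_wpM2l pT; apply: mulr_ge0; last by rewrite exprn_ge0// ltW.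
apply: mulr_ge0; last by rewrite exprn_ge0// ltW.
by apply: mulr_ge0; [exact: ler0n|apply: mulr_ge0; [by []|exact: exprn_ge0]].
Qed.

(** Take k + 1 to be 2^M times an odd number exceeding j. *)
Lemma radius_infinitely_often (M j : nat) : exists2 k, (j <= k)%N & radius k = 2^-1 ^+ M :> R.
Proof.
exists (2 ^ M * j.*2.+1).-1.
  have : (j.*2.+1 <= 2 ^ M * j.*2.+1)%N by rewrite leq_pmull// expn_gt0.
  case: (_ * _)%N => // k; rewrite ltnS => /= H; apply: leq_trans H.
  by rewrite -addnn leq_addr.
rewrite /radius prednK; last by rewrite muln_gt0 expn_gt0.
rewrite lognM ?expn_gt0// pfactorK// [logn 2 j.*2.+1]lognE/=.
by rewrite dvdn2/= odd_double/= addn0.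
Qed.

(** Stated for a general nonincreasing [G], so as to cover both f and its product with the constant
    c_n g(d)^-1 d^2. *)
Lemma energy_condition_fails (G h : R -> R) (d : R) : 0 < d ->
  (forall s t, 0 <= s -> s <= t -> G t <= G s) ->
  h t @[t --> +oo] --> +oo -> (forall t, 0 <= t -> G t = profile n t * h t) ->
  ~ energy_condition (potential alpha) (electric : 'rV[R]_n -> R) G d.
Proof.
move=> d0 Gd hoo GE ec.
have [kap kap0 Hkap] := @cap_cube_gt0 R m d d0.
have [C C0 HC] := @local_energy_le R m.
(* A negative power of 2 far below d: the removed cube, of half-edge d/4 4^-N, must contain the hole
   of radius lam 4^-N with room to spare. *)
pose q := (Num.truncn (64 / d + 64)).+1.
pose lam : R := 2^-1 ^+ q.
have lam0 : 0 < lam by rewrite exprn_gt0.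
have lamd : lam * 64 <= d /\ lam <= 1.
  have qq : 64 / d + 64 <= 2 ^+ q.
    apply: le_trans (ltW (truncnS_gt _)) _; rewrite -natrX ler_nat; exact: ltnW (ltn_expl _ _).
  have e : lam * 2 ^+ q = 1 by rewrite /lam exprVn mulVf// expf_neq0.
  have : lam * (64 / d + 64) <= lam * 2 ^+ q by apply: ler_wpM2l => //; exact: ltW.
  rewrite e.
  have z : 0 < 64 / d by rewrite divr_gt0.
  have zd : 64 / d * d = 64 by rewrite divfK// gt_eqF.
  by split; nra.
(* For the radius lam / 4^N, the bound of [local_energy_le] times d^2 is exactly [S * 16 ^+ N]. *)
pose S := C / lam ^+ 2 * d ^+ 2.
have S0 : 0 < S by rewrite mulr_gt0 ?divr_gt0 ?exprn_gt0.
have [C2 C20 HC2] := cap_profile d0 S0.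
(* The growth of h fixes the radius: at T it must outweigh the ratio of the constants of the two
   capacity estimates. *)
have [N HN] : exists N, C2 / kap <= h (S * 16 ^+ N).
  have [X [_ HX]] := (cvgryPge h).1 hoo (C2 / kap).
  exists (Num.truncn (`|X| / S)).+1; apply: HX.
  set N := (Num.truncn _).+1; have XN : `|X| / S < N%:R by exact: truncnS_gt.
  apply: le_lt_trans (ler_norm X) _; rewrite -ltr_pdivrMl// mulrC.
  apply: lt_le_trans XN _; rewrite -natrX ler_nat; exact: ltnW (ltn_expl _ _).
pose T := S * 16 ^+ N; rewrite -/T in HN.
have T0 : 0 < T by rewrite mulr_gt0// exprn_gt0.
pose M := (q + N.*2)%N.
(* One more than the bound on the local energy; the Molchanov term will be at most 0. *)
pose A := C / (2^-1 ^+ M) ^+ 2 + 1.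
have [r0 [_ Hr0]] := ec A.
(* Beyond this index the center lies outside the radius [r0], and [d <= k]. *)
pose j := (Num.truncn (`|r0| + 1 + d)).+1.
have [k jk kM] := radius_infinitely_often M j.
have jR : `|r0| + 1 + d < k%:R by apply: lt_le_trans (truncnS_gt _) _; rewrite ler_nat.
have := Hr0 (`|r0| + 1); have := ler_norm r0 => r00.
have H : r0 < `|r0| + 1 by lra.
move=> /(_ H (center k)).
have cn : `|r0| + 1 <= `|center k : 'rV[R]_n|.
  apply: le_trans (rV_norm_coord (center k) ord_max); rewrite mxE eqxx normr_nat.
  apply: (@le_trans _ _ k%:R); first by lra.
  rewrite ler_nat; apply: leq_trans (leqnSn k) _; rewrite expnS expn1.
  by apply: (@leq_trans (4 * k.+1)); rewrite ?leq_mul2l ?leq_pmulr ?leq_pmull.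
move=> /(_ cn).
have rE : radius k = lam / 4 ^+ N :> R.
  rewrite kM /M exprD -/lam -muln2 mulnC exprM [2^-1 ^+ 2](_ : _ = 4^-1); last by lra.
  by rewrite exprVn.
have p1 : (1 : R) <= 4 ^+ N by rewrite exprn_ege1//; lra.
have p0 : (0 : R) < 4 ^+ N by lra.
have pV : 0 < (4 ^+ N)^-1 :> R by rewrite invr_gt0.
have pV1 : (4 ^+ N)^-1 <= 1 :> R by rewrite invf_le1.
have kd : radius k <= d by rewrite rE; nra.
have le1 := HC d k d0 kd; have le0 := @local_energy_ge0 R m (potential alpha) (center k) d.
set E := local_energy _ _ _ in le1 le0 *.
have fE : E \is a fin_num by rewrite ge0_fin_numE//; exact: le_lt_trans le1 (ltry _).
have f0 : 0 <= fine E by exact: fine_ge0.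
have f1 : fine E * d ^+ 2 <= T.
  have : fine E <= C * radius k ^- 2 by rewrite -lee_fin fineK.
  move=> H1; apply: le_trans (ler_wpM2r (sqr_ge0 d) H1) _.
  rewrite /T /S rE le_eqVlt; apply/orP; left; apply/eqP.
  rewrite (_ : 16 ^+ N = (4 ^+ N) ^+ 2); last by rewrite -exprM mulnC exprM; congr (_ ^+ _); lra.
  by field; rewrite !gt_eqF.
have pr0 : 0 <= profile n T.
  rewrite /profile; case: ifP => _; last exact: powR_ge0.
  by rewrite invr_ge0 addr_ge0// ln_ge0//; lra.
(* The local energy is only known to satisfy [fine E * d ^+ 2 <= T]; as [G] is nonincreasing, gamma
   is at least [G T]. *)
have GT : C2 * profile n T <= G (fine E * d ^+ 2) * kap.
  apply: (@le_trans _ _ (G T * kap)).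
    rewrite GE ?(ltW T0)// -[leRHS]mulrA [leLHS]mulrC; apply: ler_wpM2l => //.
    by rewrite -ler_pdivrMr.
  by apply: ler_wpM2r; [exact: ltW|apply: Gd => //; rewrite mulr_ge0// sqr_ge0].
have G0 : 0 <= G (fine E * d ^+ 2).
  have : 0 <= G (fine E * d ^+ 2) * kap by apply: le_trans GT; rewrite mulr_ge0// ltW.
  by rewrite pmulr_lge0.
have mol : (molchanov (G (fine E * d ^+ 2)%R) (center k : 'rV[R]_n) d electric <= 0)%E.
  apply: (@molchanov_le0 _ _ _ k d (d / 4 / 4 ^+ N)).
  - by rewrite rE mulrA; apply: ler_wpM2r; [exact: ltW|lra].
  - have : d / 4 / 4 ^+ N <= d / 4 by rewrite ler_pdivrMr//; nra.
    by move: (d / 4 / _) => x; lra.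
  - by have := normr_ge0 r0; lra.
  - apply: le_trans (HC2 N (center k)) _.
    apply: (@le_trans _ _ ((G (fine E * d ^+ 2)%R)%:E * kap%:E)%E).
      by rewrite -EFinM lee_fin.
    by apply: lee_wpmul2l; [rewrite lee_fin|exact: Hkap].
have m2 : ((d ^- n)%:E * molchanov (G (fine E * d ^+ 2)%R) (center k : 'rV[R]_n) d electric <= 0)%E.
  by apply: mule_ge0_le0 => //; rewrite lee_fin invr_ge0 exprn_ge0// ltW.
apply/negP; rewrite -ltNge; apply: (@le_lt_trans _ _ ((C * radius k ^- 2)%:E + 0)%E).
  exact: leeD.
by rewrite adde0 lte_fin /A kM ltrDl.
Qed.

End counterexample.

Theorem theorem1p7 (R : realType) (n : nat) (n_ge2 : (2 <= n)%N) :
  (exists (a : 'rV[R]_n -> 'rV[R]_n) (V : 'rV[R]_n -> R),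
     [/\ admissible a V,
         discrete_spectrum a V
       & forall f : R -> R, slow_fun n f ->
           forall d : R, 0 < d -> ~ energy_condition a V f d]) /\
  (forall f : R -> R, slow_fun n f ->
     forall (d0 : R) (g : R -> R), classG d0 g ->
     forall cn : R, 0 < cn ->
     ~ (forall (a : 'rV[R]_n -> 'rV[R]_n) (V : 'rV[R]_n -> R),
          admissible a V -> discrete_spectrum a V ->
          \forall d \near 0^'+,
            energy_condition a V (fun t => cn * f t * (g d)^-1 * d ^+ 2) d)).
Proof.
case: n n_ge2 => [//|[//|m]] _.
have adm := @construction_admissible R m.
have dis : discrete_spectrum (potential alpha) (electric : 'rV[R]_m.+2 -> R).
  apply: potential_discrete.
  - exact: alpha_C1.
  - exact: electric_continuous.
  - exact: electric_ge0.
  - exact: alpha_field_bound.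
split.
  exists (potential alpha), electric; split => // f [_ fd [h hoo fh]] d d0.
  exact: (energy_condition_fails d0 fd hoo fh).
move=> f [_ fd [h hoo fh]] d0 g [d00 g0 _ _] cn cn0 nec.
have [e /= e0 He] := nec _ _ adm dis.
(* Small enough for the condition to be assumed at d and for g d to be positive. *)
pose d := Num.min (e / 2) (d0 / 2).
have dp : 0 < d by rewrite lt_min !divr_gt0.
have dd : d < d0 by rewrite gt_min; apply/orP; right; lra.
have ec : energy_condition (potential alpha) (electric : 'rV[R]_m.+2 -> R)
    (fun t => cn * f t * (g d)^-1 * d ^+ 2) d.
  apply: He => //=; rewrite sub0r normrN gtr0_norm// gt_min; apply/orP; left; lra.
have gd : 0 < g d by apply: g0; rewrite dp.
(* With d fixed this is a positive constant, and K h still tends to infinity. *)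
pose K := cn * (g d)^-1 * d ^+ 2.
have K0 : 0 < K by rewrite /K !mulr_gt0 ?invr_gt0 ?exprn_gt0.
have KE t : cn * f t * (g d)^-1 * d ^+ 2 = K * f t by rewrite /K; ring.
apply: (@energy_condition_fails R m (fun t => cn * f t * (g d)^-1 * d ^+ 2) (fun t => K * h t) d dp) ec.
- by move=> s t s0 st; rewrite !KE ler_wpM2l ?(ltW K0)//; exact: fd.
- apply/cvgryPge => A; move/cvgryPge : hoo => /(_ (A / K)).
  by apply: filterS => t; rewrite ler_pdivrMr// mulrC.
- by move=> t t0; rewrite KE fh// mulrCA.
Qed.
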